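(* Suppose that the following conditions hold: (i) $\rho_1:= \int_{0}^{\infty} ds \int_{s}^{\infty} \alpha(x-s) g'(x-s,1-) G(dx)< 1$; (ii) there exists a constant $\alpha_{1}\in (0,\infty)$ such that the function $t\mapsto e^{\alpha_{1} t}[1-G(t)]$ is directly Riemann integrable over $[0,\infty)$ and $\int_{0}^{\infty} e^{\alpha_{1} s} ds \int_{s}^{\infty} \alpha(x-s) g'(x-s,1-) G(dx) = 1$; (iii) $\int_{\mathfrak{N}(0,\infty)^\circ} L(d \nu) \int_{0}^{\infty} e^{\alpha_{1} x} \nu(dx) <\infty$; (iv) $\int_{0}^{\infty} e^{2\alpha_1 x} G(dx)<\infty$ and $\|g''(\cdot,1-)\|<\infty$. Let $Y=(Y_t:t\ge0)$, under $\mathbf{P}_\sigma$, be a càdlàg realization of the $(\alpha,g,G,\psi)$-process started from $\sigma$ at time zero, and let $Z_t=\int_0^tY_s\,ds$. Then for any $\sigma \in \mathfrak{N}(0, \infty)$ and $f \in B(0, \infty)$ we have, as $t\rightarrow\infty$, $$\frac{1}{t}\langle Z_{t},f\rangle\rightarrow \int_{\mathfrak{N}(0,\infty)^{\circ}}\langle \nu, \Pi_{\infty}f\rangle L(d \nu)$$ by convergence in probability with respect to $\mathbf{P}_{\sigma}$, where $\Pi_\infty f(x)=\int_0^\infty\pi_sf(x)\,ds$.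
   Context: Notation. $\mathbb{N}=\{0,1,2,\ldots\}$; ''positive'' means nonnegative. $\mathfrak{M}(0,\infty)$ is the set of finite Borel measures on $(0,\infty)$ with the weak convergence topology, $\mathfrak{N}(0,\infty)$ its subset of integer-valued measures, $\mathfrak{N}(0,\infty)^\circ=\mathfrak{N}(0,\infty)\setminus\{\mathbf{0}\}$ with $\mathbf{0}$ the null measure. $B(0,\infty)$ is the set of bounded Borel functions on $(0,\infty)$; $C^1(0,\infty)$ is the set of bounded continuous functions on $(0,\infty)$ with bounded continuous first derivative; superscript $+$ denotes the positive elements; $\|\cdot\|$ is the supremum norm. Any function on $A\subset\mathbb{R}$ is extended by $0$ to $\mathbb{R}\setminus A$. $\langle\nu,f\rangle=\int_{(0,\infty)}f\,d\nu$. $\int_a^b=\int_{(a,b]}$ and $\int_a^\infty=\int_{(a,\infty)}$. Parameters. $\alpha\in C^1(0,\infty)^+$. For each $x\in(0,\infty)$, $\{p(x,i):i\in\mathbb{N}\}$ is a probability distribution, $p(\cdot,i)\in C^1(0,\infty)^+$ for every $i$, and $\sup_{x>0}\sum_{i\ge1}i\,p(x,i)<\infty$; put $g(x,z)=\sum_{i\ge0}p(x,i)z^i$ for $z\in[0,1]$, assume $g(\cdot,z)\in C^1(0,\infty)^+$ for each $z$; $g'$ and $g''$ are the first and second derivatives in $z$, so $g'(x,1-)=\sum_i i\,p(x,i)$ and $g''(x,1-)=\sum_i i(i-1)p(x,i)$. $G$ is a continuous probability distribution on $(0,\infty)$, and $G(t)=G((0,t])$. $L(d\nu)$ is a finite measure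 on $\mathfrak{N}(0,\infty)^\circ$ and $\psi(f)=\int_{\mathfrak{N}(0,\infty)^\circ}(1-e^{-\langle\nu,f\rangle})L(d\nu)$ for $f\in B(0,\infty)^+$. The $(\alpha,g,G,\psi)$-process is the Markov process with state space $\mathfrak{N}(0,\infty)$ whose transition semigroup $(P_t)_{t\ge0}$ is determined by $$\int e^{-\langle \nu, f\rangle} P_t(\sigma, d \nu)=\exp \Big\{-\langle\sigma, u_t f\rangle-\int_0^t \psi(u_s f)\, d s\Big\},\quad f \in B(0,\infty)^{+},$$ where $(t,x)\mapsto u_tf(x)$ is the unique locally bounded positive solution of $u_{t}f(x)=f(x-t)+\int_{0}^{t} \alpha(x-s)[1-g(x-s,\langle G,e^{-u_{t-s} f}\rangle)]ds$. In ''càdlàg realization'', mass reaching $0$ is discarded (left limits are understood with mass at $0$ discarded). $\langle Z_t,f\rangle=\int_0^t\langle Y_s,f\rangle ds$. For $f\in B(0,\infty)$, $(t,x)\mapsto\pi_tf(x)$ is the unique locally bounded solution of $\pi_{t} f(x)=f(x-t)+\int_{0}^{t} \alpha(x-s) g'(x-s,1-) \langle G,\pi_{t-s}f\rangle ds$. A nonnegative function $f$ on $[0,\infty)$ is directly Riemann integrable over $[0,\infty)$ if for any $a>0$, $\sum_{n\ge1}aM_n(a)<\infty$, and $\lim_{a\to0}\sum_{n\ge1}aM_n(a)=\lim_{a\to0}\sum_{n\ge1}am_n(a)$, where $M_n(a)$ and $m_n(a)$ are the supremum and infimum of $f$ over $[(n-1)a,na]$. *)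

(* Defs.v *)
From HB Require Import structures.
From mathcomp Require Import all_boot all_order all_algebra.
From mathcomp Require Import all_classical all_reals all_analysis.

Set Implicit Arguments.
Unset Strict Implicit.
Unset Printing Implicit Defensive.

Import Order.TTheory GRing.Theory Num.Theory.
Import numFieldNormedType.Exports.

Local Open Scope classical_set_scope.
Local Open Scope ring_scope.

(* A function on (0,oo) is represented by a function R -> R whose values
   outside (0,oo) are irrelevant; the convention that such functions vanish
   outside (0,oo) is enforced by [ext0] wherever it matters. *)

Definition pos_reals (R : realType) : set R := `]0, +oo[.
Arguments pos_reals {R}.

Definition ext0 (R : realType) (f : R -> R) : R -> R := f \_ pos_reals.

Section function_spaces.
Context {R : realType}.
Implicit Type f : R -> R.

Definition bounded_on_pos f := exists M : R, forall x, 0 < x -> `|f x| <= M.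

Definition nonneg_on_pos f := forall x, 0 < x -> 0 <= f x.

Definition continuous_on_pos f := forall x, 0 < x -> {for x, continuous f}.

Definition is_B f := measurable_fun pos_reals f /\ bounded_on_pos f.

Definition is_Bplus f := is_B f /\ nonneg_on_pos f.

Definition is_C f := continuous_on_pos f /\ bounded_on_pos f.

Definition is_C1 f :=
  [/\ is_C f, forall x, 0 < x -> derivable f x 1 & is_C (derive1 f)].

Definition is_C1plus f := is_C1 f /\ nonneg_on_pos f.

End function_spaces.

(* The set N(0,oo) of integer-valued finite Borel measures on (0,oo): a Borel
   measure on the line that does not charge (-oo,0]. *)
Record config (R : realType) := Config {
  config_measure :> {finite_measure set (measurableTypeR R) -> \bar R} ;
  config_pos : config_measure `]-oo, 0]%classic = 0%E ;
  config_int : forall A : set (measurableTypeR R), measurable A ->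
    exists n : nat, config_measure A = n%:R%:E }.

Definition pairing (R : realType) (nu : config R) (f : R -> R) : R :=
  \int[nu]_(x in pos_reals) f x.

Section config_structure.
Context (R : realType).

HB.instance Definition _ := gen_eqMixin (config R).
HB.instance Definition _ := gen_choiceMixin (config R).

Let null_pos : (mzero : {finite_measure set (measurableTypeR R) -> \bar R})
  `]-oo, 0]%classic = 0%E.
Proof. by []. Qed.

Let null_int (A : set (measurableTypeR R)) : measurable A ->
  exists n : nat, (mzero : {finite_measure set (measurableTypeR R) -> \bar R}) A
    = n%:R%:E.
Proof. by exists 0%N. Qed.

Definition null_config : config R := Config null_pos null_int.

HB.instance Definition _ := isPointed.Build (config R) null_config.

Definition Cb := {f : R -> R | is_C f}.

HB.instance Definition _ := gen_eqMixin Cb.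
HB.instance Definition _ := gen_choiceMixin Cb.

(* Weak convergence: the coarsest topology making nu |-> <nu,f> continuous for
   all bounded continuous f on (0,oo). *)
Definition weak_eval (nu : config R) : {ptws Cb -> R} :=
  fun f => pairing nu (sval f).

HB.instance Definition _ :=
  Topological.copy (config R) (initial_topology weak_eval).

Definition config_measurable : set (set (config R)) :=
  <<s (open : set (set (config R))) >>.

Let config_measurable0 : config_measurable set0.
Proof. exact: sigma_algebra0. Qed.

Let config_measurableC (A : set (config R)) :
  config_measurable A -> config_measurable (~` A).
Proof. exact: sigma_algebraC. Qed.

Let config_measurable_bigcup (F : (set (config R))^nat) :
  (forall i, config_measurable (F i)) -> config_measurable (\bigcup_i F i).
Proof. exact: sigma_algebra_bigcup. Qed.

Definition config_display : measure_display.
Proof. by constructor. Qed.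

HB.instance Definition _ :=
  @isMeasurable.Build config_display (config R) config_measurable
    config_measurable0 config_measurableC config_measurable_bigcup.

Definition nonnull_config : set (config R) := [set nu | nu setT != 0%E].

End config_structure.
Arguments nonnull_config {R}.

Section parameters.
Context {R : realType}.
Implicit Types (alpha : R -> R) (p : R -> nat -> R)
  (G : probability (measurableTypeR R) R)
  (L : {finite_measure set (config R) -> \bar R}).

Definition gen_fun p (x z : R) : R := limn (series (fun i => p x i * z ^+ i)).

(* g'(x,1-) *)
Definition gen_fun1 p (x : R) : R := lim (derive1 (gen_fun p x) z @[z --> 1^'-]).

(* g''(x,1-), possibly infinite *)
Definition gen_fun2 p (x : R) : \bar R :=
  lim ((derive1n 2 (gen_fun p x) z)%:E @[z --> 1^'-]).

Definition is_offspring_law p :=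
  [/\ forall x, 0 < x -> forall i, 0 <= p x i,
      forall x, 0 < x -> series (p x) @ \oo --> (1 : R),
      forall i, is_C1plus (p ^~ i),
      exists M : R, forall x, 0 < x ->
        (\sum_(1 <= i <oo) (i%:R * p x i)%:E <= M%:E)%E &
      forall z, 0 <= z <= 1 -> is_C1plus (gen_fun p ^~ z)].

Definition dist_fun G (t : R) : R := fine (G `]0, t]%classic).

Definition is_lifetime_law G :=
  G `]-oo, 0]%classic = 0%E /\ continuous (dist_fun G).

(* A measure on N(0,oo) minus the null measure, seen as one on N(0,oo). *)
Definition is_immigration_measure L := L (~` nonnull_config) = 0%E.

Definition mean_G G (f : R -> R) : R := \int[G]_(x in pos_reals) f x.

Definition psi L (f : R -> R) : R :=
  \int[L]_(nu in nonnull_config) (1 - expR (- pairing nu f)).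

(* Locally bounded Borel functions (t,x) |-> v t x on [0,oo) x (0,oo) *)
Definition locally_bounded (v : R -> R -> R) :=
  measurable_fun ([set` `[0 : R, +oo[] `*` @pos_reals R)
    (fun tx : R * R => v tx.1 tx.2) /\
  forall T : R, exists M : R,
    forall t x, 0 <= t <= T -> 0 < x -> `|v t x| <= M.

Definition is_cumulant alpha p G (f : R -> R) (u : R -> R -> R) :=
  [/\ locally_bounded u,
      forall t, 0 <= t -> nonneg_on_pos (u t) &
      forall t x, 0 <= t -> 0 < x ->
        u t x = ext0 f (x - t) +
          \int[lebesgue_measure]_(s in `]0, t])
            (ext0 alpha (x - s) *
             (1 - gen_fun p (x - s)
                    (mean_G G (fun y => expR (- u (t - s) y)))))].

Definition is_moment alpha p G (f : R -> R) (v : R -> R -> R) :=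
  locally_bounded v /\
  forall t x, 0 <= t -> 0 < x ->
    v t x = ext0 f (x - t) +
      \int[lebesgue_measure]_(s in `]0, t])
        (ext0 alpha (x - s) * gen_fun1 p (x - s) * mean_G G (v (t - s))).

(* Pi_oo f, in terms of v = (t,x) |-> pi_t f(x) *)
Definition potential (v : R -> R -> R) (x : R) : R :=
  \int[lebesgue_measure]_(s in pos_reals) v s x.

(* int_s^oo alpha(x-s) g'(x-s,1-) G(dx) *)
Definition renewal_density alpha p G (s : R) : \bar R :=
  (\int[G]_(x in `]s, +oo[) (alpha (x - s) * gen_fun1 p (x - s))%:E)%E.

End parameters.

Section direct_riemann.
Context {R : realType}.
Local Open Scope ereal_scope.

Definition riemann_cell (a : R) (n : nat) : set R :=
  `[(n.-1%:R * a)%R, (n%:R * a)%R].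

Definition upper_sum (f : R -> R) (a : R) : \bar R :=
  \sum_(1 <= n <oo) a%:E * ereal_sup [set (f x)%:E | x in riemann_cell a n].

Definition lower_sum (f : R -> R) (a : R) : \bar R :=
  \sum_(1 <= n <oo) a%:E * ereal_inf [set (f x)%:E | x in riemann_cell a n].

Definition directly_riemann_integrable (f : R -> R) :=
  [/\ forall x, (0 <= x)%R -> (0 <= f x)%R,
      forall a, (0 < a)%R -> upper_sum f a < +oo &
      exists l : \bar R,
        upper_sum f a @[a --> 0^'+] --> l /\ lower_sum f a @[a --> 0^'+] --> l].

End direct_riemann.

Section process.
Context {R : realType}.

(* K t is the kernel P_t for t >= 0; its values at t < 0 are irrelevant. *)
Definition is_transition_semigroup (alpha : R -> R) (p : R -> nat -> R)
    (G : probability (measurableTypeR R) R)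
    (L : {finite_measure set (config R) -> \bar R})
    (K : R -> R.-pker (config R) ~> (config R)) :=
  [/\ forall sigma (B : set (config R)), measurable B ->
        K 0 sigma B = \d_sigma B,
      forall s t sigma (B : set (config R)), 0 <= s -> 0 <= t -> measurable B ->
        K (s + t) sigma B = (\int[K s sigma]_nu K t nu B)%E &
      forall f, is_Bplus f -> exists2 u, is_cumulant alpha p G f u &
        forall t sigma, 0 <= t ->
          (\int[K t sigma]_nu (expR (- pairing nu f))%:E)%E =
          (expR (- pairing sigma (u t) -
                 \int[lebesgue_measure]_(s in `]0, t]) psi L (u s)))%:E].

Context {d : measure_display} {Omega : measurableType d}.
Implicit Types (P : probability Omega R) (Y : R -> Omega -> config R).

Definition past Y (s : R) : set (set Omega) :=
  <<s [set A | exists r (B : set (config R)),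
        [/\ 0 <= r <= s, measurable B & A = Y r @^-1` B]] >>.

(* Markov property with respect to the natural filtration; only the Y t with
   t >= 0 matter. The initial law is the Dirac mass at sigma; equality of
   configurations is not required, as two of them may differ on non-Borel sets. *)
Definition is_markov P Y (K : R -> R.-pker (config R) ~> (config R))
    (sigma : config R) :=
  [/\ forall t, 0 <= t -> measurable_fun setT (Y t),
      forall B : set (config R), measurable B -> P (Y 0 @^-1` B) = \d_sigma B &
      forall s t A (B : set (config R)), 0 <= s -> 0 <= t ->
        past Y s A -> measurable B ->
        P (A `&` Y (s + t) @^-1` B) = (\int[P]_(w in A) K t (Y s w) B)%E].

(* nu is the left limit at t of y when mass at 0 is discarded: the test
   functions are the bounded continuous ones that vanish at 0. *)
Definition is_left_limit (y : R -> config R) (t : R) (nu : config R) :=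
  forall f, is_C f -> f x @[x --> 0^'+] --> 0 ->
    pairing (y s) f @[s --> t^'-] --> pairing nu f.

Definition is_cadlag (y : R -> config R) :=
  (forall t, 0 <= t -> y s @[s --> t^'+] --> y t) /\
  (forall t, 0 < t -> exists nu, is_left_limit y t nu).

Definition is_cadlag_realization (alpha : R -> R) (p : R -> nat -> R)
    (G : probability (measurableTypeR R) R)
    (L : {finite_measure set (config R) -> \bar R}) P Y (sigma : config R) :=
  (exists2 K, is_transition_semigroup alpha p G L K & is_markov P Y K sigma) /\
  forall w, is_cadlag (Y ^~ w).

(* <Z_t, f> with Z_t = int_0^t Y_s ds *)
Definition occupation Y (t : R) (f : R -> R) (w : Omega) : R :=
  \int[lebesgue_measure]_(s in `]0, t]) pairing (Y s w) f.

Definition cvg_in_probability P (X : R -> Omega -> R) (c : R) :=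
  forall eps : R, 0 < eps ->
    P [set w | eps < `|X t w - c|] @[t --> +oo] --> 0%E.

End process.

(* Main.v *)
Require Import Defs.
From HB Require Import structures.
From mathcomp Require Import all_boot all_order all_algebra.
From mathcomp Require Import all_classical all_reals all_analysis.
From mathcomp Require Import measurable_realfun.
From mathcomp Require Import ring lra.

(** A particle with residual life [y] gives birth at mean rate
[k(y) = alpha(y) g'(y,1-)], and its children have residual lives drawn from
[G]. Counting generations, the expected occupation of a particle started at
[x] together with all its descendants is
[Pi f(x) = F(x) + K(x) <G,F> / (1 - rho1)], where [F(x)] is the integral of [f]
over the particle's own life ([own_occupation]), [K(x)] its mean number of
children ([mean_offspring]) and [rho1 = <G,K> < 1]. This is
[lineage_occupation]; being at most linear in [x], it is integrable under [G]
and under the immigrating configurations, and the candidate limit is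
[c = int <nu, Pi f> L(dnu)] ([occupation_rate]). The exponential moments of
[G] and of [L] enter through the first moments.

Take [f >= 0], and let [u] be the cumulant of [la f] for a small [la > 0].
Since [1 - g(y,z) <= g'(y,1-) (1 - z)] and [1 - exp(-v) <= v], Tonelli's theorem
applied to the cumulant equation gives [int u_t dt <= la Pi f]. Consequently
[u <= C la] uniformly, and for such small [u] the same inequalities can be
reversed if [k] is replaced by a chord slope slightly below it. Therefore the
total immigration exponent [A = int psi(u_t) dt] lies between [la (c - e)] and
[la c] ([total_exponent_le], [total_exponent_ge]).

Let [E_s = exp(- la <Y_s,f>)] and [b_t = exp(- int_0^t psi(u_s) ds)], which
decreases to [a = exp(- A)]. The Laplace formula gives [E E_t <= b_t], and
with the Markov property [E (E_r E_(r+t)) <= b_t E E_r]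
([integral_laplace2_le]). For [r] and [t] large these are at most
[a + eta] and [(a + eta)^2], while [E E_s] is at least [a] up to a term
integrable in [s]; hence the time average [H_t / t] of [E_s] tends to [a] in
[L^2] ([square_deviation_le]).

To come back to [Z_t = int_0^t <Y_s,f> ds], note that [(1 - H_t / t) / la] is
at most [Z_t / t] along every path. The smaller quantity is close in mean to
[(1 - a) / la], itself close to [c], and the mean of the larger one is at most
[c + C / t]; two random variables that are ordered and have almost the same
mean are close in [L^1] ([mean_deviation_cvg]).

For a signed [f] the result follows by difference. The limit is identified by
splitting the moment equation into positive and negative parts, each of which
has a finite total mass by the same renewal inequality; integrating in time
shows that [int pi_s f ds] is the difference of the two values of [Pi]
([moment_potential]). *)

Import Order.TTheory GRing.Theory Num.Theory.
Import numFieldNormedType.Exports.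

Local Open Scope classical_set_scope.
Local Open Scope ring_scope.

(** * Integration without measurability, translation, the half-line *)

Section integration_tools.
Context {R : realType}.
Local Notation mu := (@lebesgue_measure R).
Local Open Scope ereal_scope.

(** The integral of a nonnegative function is a supremum over simple functions
    below it, hence is monotone for all functions, measurable or not. *)
Lemma ge0_le_integral_nomeas d (T : measurableType d)
    (m : {measure set T -> \bar R}) (D : set T) (f g : T -> \bar R) :
  (forall x, D x -> 0 <= f x) -> (forall x, D x -> f x <= g x) ->
  \int[m]_(x in D) f x <= \int[m]_(x in D) g x.
Proof.
move=> f0 fg; rewrite (integral_mkcond D f) (integral_mkcond D g).
have f0' x : 0 <= (f \_ D) x by apply: erestrict_ge0.
have g0' x : 0 <= (g \_ D) x.
  by apply: erestrict_ge0 => y Dy; exact: le_trans (f0 _ Dy) (fg _ Dy).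
rewrite !ge0_integralTE//.
apply: le_ereal_sup => _ [h hf <-]; exists h => // x.
apply: le_trans (hf x) _; rewrite !patchE; case: ifPn => // xD.
exact/fg/set_mem.
Qed.

(** By uniqueness, since both sides agree on half-open intervals. *)
Lemma lebesgue_measure_shift (c : R) (A : set R) : measurable A ->
  pushforward mu (fun x : measurableTypeR R => (x - c)%R : measurableTypeR R) A = mu A.
Proof.
have mphi : measurable_fun setT (fun x : measurableTypeR R => (x - c)%R : measurableTypeR R).
  exact: measurable_funB.
pose phi := HB.pack_for {mfun measurableTypeR R >-> measurableTypeR R}
  (fun x : measurableTypeR R => (x - c)%R : measurableTypeR R)
  (isMeasurableFun.Build _ _ _ _ _ mphi).
move=> mA; apply/esym.
apply: (@lebesgue_measure_unique _ (pushforward mu phi)) => //= _ [[a b]] _ <-.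
rewrite /pushforward.
rewrite (_ : _ @^-1` _ = `]a + c, b + c]%classic%R); last first.
  by apply/seteqP; split => x /=; rewrite !in_itv/= ltrBrDr lerBlDr.
rewrite !lebesgue_measure_itv/= !lte_fin ltrD2r.
by case: ifPn => // _; rewrite -!EFinB; congr (_%:E); ring.
Qed.

Lemma ge0_integral_shift (f : R -> \bar R) (c : R) :
  measurable_fun setT f -> (forall x, 0 <= f x) ->
  \int[mu]_x f (x - c)%R = \int[mu]_x f x.
Proof.
move=> mf f0.
have mphi : measurable_fun setT (fun x : measurableTypeR R => (x - c)%R : measurableTypeR R).
  exact: measurable_funB.
have := @ge0_integral_pushforward _ _ _ _ _ _ mphi mu setT f measurableT mf
   (fun y _ => f0 y).
rewrite preimage_setT => <-.
by apply: eq_measure_integral => A mA _; exact: lebesgue_measure_shift.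
Qed.

Lemma integral_probability_cst d (T : measurableType d) (P : probability T R) (c : R) :
  \int[P]_w (cst c%:E w) = c%:E.
Proof. by rewrite integral_cst// [X in _ * X](probability_setT P) mule1. Qed.

End integration_tools.

Section positive_half_line.
Context {R : realType}.

Lemma ext0_pos (f : R -> R) x : 0 < x -> ext0 f x = f x.
Proof. by move=> x0; rewrite /ext0 patchE ifT// mem_setE in_itv/= x0. Qed.

Lemma ext0_le0 (f : R -> R) x : x <= 0 -> ext0 f x = 0.
Proof. by move=> x0; rewrite /ext0 patchE ifF// mem_setE in_itv/= andbT ltNge x0. Qed.

Lemma ext0_ge0 (f : R -> R) x : nonneg_on_pos f -> 0 <= ext0 f x.
Proof.
by move=> f0; have [x0|x0] := ltP 0 x; [rewrite ext0_pos// f0|rewrite ext0_le0].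
Qed.

Lemma measurable_pos_reals : measurable (@pos_reals R : set (measurableTypeR R)).
Proof. exact: measurable_itv. Qed.

Lemma measurable_ext0 (f : R -> R) :
  measurable_fun (@pos_reals R) f -> measurable_fun setT (ext0 f).
Proof. by move/(measurable_restrictT f measurable_pos_reals). Qed.

(** Continuity is tested at points of an open set, so it is continuity of the
    restriction. *)
Lemma measurable_continuous_on_pos (f : R -> R) :
  continuous_on_pos f -> measurable_fun (@pos_reals R) f.
Proof.
move=> cf; apply: open_continuous_measurable_fun; first exact: interval_open.
by move=> x; rewrite inE /pos_reals/= in_itv/= andbT; exact: cf.
Qed.

Lemma inv_nat_itv (n : nat) : 0 < (n.+1%:R^-1 : R) <= 1.
Proof. by rewrite invr_gt0 ltr0Sn invf_le1// ler1n. Qed.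

End positive_half_line.

Lemma integral_supported_pos {R : realType}
    (m : {measure set (measurableTypeR R) -> \bar R}) (g : R -> \bar R) :
  m `]-oo, 0]%classic = 0%E -> measurable_fun setT g -> (forall x, 0 <= g x)%E ->
  (\int[m]_(x in pos_reals) g x = \int[m]_x g x)%E.
Proof.
move=> m0 mg g0.
rewrite [RHS](ge0_negligible_integral (N := (`]-oo, 0%R]%classic : set (measurableTypeR R))))//=.
congr (integral m _ g); apply/seteqP; split => x; rewrite /pos_reals/= !in_itv/= andbT.
  by move=> x0; split => //; apply/negP; rewrite -ltNge.
by case=> _ /negP; rewrite -ltNge.
Qed.

(** * Renewal inequalities integrated over time *)

Section renewal.
Context {R : realType}.
Local Notation mu := (@lebesgue_measure R).
Local Open Scope ereal_scope.

Lemma integral_convolution (k W : R -> \bar R) :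
  measurable_fun setT k -> measurable_fun setT W ->
  (forall s, 0 <= k s) -> (forall t, 0 <= W t) ->
  \int[mu]_t \int[mu]_s (k s * W (t - s)%R) =
  (\int[mu]_s k s) * (\int[mu]_t W t).
Proof.
move=> mk mW k0 W0.
pose f (z : R * R) := k z.2 * W (z.1 - z.2)%R.
have mf : measurable_fun setT f.
  apply: emeasurable_funM; first exact: measurableT_comp.
  by apply: (measurableT_comp mW); exact: measurable_funB.
have f0 z : 0 <= f z by rewrite mule_ge0.
transitivity (\int[mu]_s \int[mu]_t f (t, s)).
  exact: (fubini_tonelli (m1 := mu) (m2 := mu) f).
rewrite -ge0_integralZr//; last by exact: integral_ge0.
apply: eq_integral => s _; rewrite /f/= ge0_integralZl//.
  by rewrite (ge0_integral_shift W).
by apply: (measurableT_comp mW); exact: measurable_funB.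
Qed.

Lemma measurable_convolution (k W : R -> \bar R) :
  measurable_fun setT k -> measurable_fun setT W ->
  (forall s, 0 <= k s) -> (forall t, 0 <= W t) ->
  measurable_fun setT (fun t : R => \int[mu]_s (k s * W (t - s)%R)).
Proof.
move=> mk mW k0 W0.
pose f (z : R * R) := k z.2 * W (z.1 - z.2)%R.
have f0 z : 0 <= f z by rewrite mule_ge0.
apply: (measurable_fun_fubini_tonelli_F (m2 := mu) f) => //.
apply: emeasurable_funM; first exact: measurableT_comp.
by apply: (measurableT_comp mW); exact: measurable_funB.
Qed.

Section totals.
Variables (G : {sigma_finite_measure set (measurableTypeR R) -> \bar R}).
Variables (k h w : R -> R -> \bar R).
Hypotheses (mk : measurable_fun setT (fun z : R * R => k z.1 z.2))
  (mh : measurable_fun setT (fun z : R * R => h z.1 z.2))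
  (mw : measurable_fun setT (fun z : R * R => w z.1 z.2)).
Hypotheses (k0 : forall x s, 0 <= k x s) (h0 : forall x t, 0 <= h x t)
  (w0 : forall t x, 0 <= w t x).

Definition mean_of t := \int[G]_x w t x.
Definition total_of x := \int[mu]_t w t x.
(** Right-hand side of a renewal equation in which a particle started at [x]
    contributes [h x t] itself and, at time [s], reproduces with intensity
    [k x s]; each child then contributes the [G]-average of [w] at the remaining
    time. *)
Definition forcing x t := h x t + \int[mu]_s (k x s * mean_of (t - s)%R).

Lemma measurable_mean_of : measurable_fun setT mean_of.
Proof.
exact: (measurable_fun_fubini_tonelli_F (m2 := G) (fun z : R * R => w z.1 z.2)).
Qed.

Lemma mean_of_ge0 t : 0 <= mean_of t.
Proof. exact: integral_ge0. Qed.

Lemma integral_mean_of : \int[mu]_t mean_of t = \int[G]_x total_of x.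
Proof. exact: (fubini_tonelli (m1 := mu) (m2 := G) (fun z : R * R => w z.1 z.2)). Qed.

Lemma measurable_section2 (g : R -> R -> \bar R) x :
  measurable_fun setT (fun z : R * R => g z.1 z.2) -> measurable_fun setT (g x).
Proof. by move=> mg; exact: (measurableT_comp mg (measurable_pair1 x)). Qed.

Lemma measurable_section1 (g : R -> R -> \bar R) x :
  measurable_fun setT (fun z : R * R => g z.1 z.2) -> measurable_fun setT (g ^~ x).
Proof. by move=> mg; exact: (measurableT_comp mg (measurable_pair2 x)). Qed.

Lemma measurable_total (g : R -> R -> \bar R) :
  measurable_fun setT (fun z : R * R => g z.1 z.2) ->
  (forall x s, 0 <= g x s) -> measurable_fun setT (fun x : R => \int[mu]_s g x s).
Proof.
move=> mg g0.
exact: (measurable_fun_fubini_tonelli_F (m2 := mu) (fun z : R * R => g z.1 z.2)).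
Qed.

Lemma integral_forcing x : \int[mu]_t forcing x t =
  \int[mu]_t h x t + (\int[mu]_s k x s) * \int[mu]_t mean_of t.
Proof.
have mm := measurable_mean_of.
rewrite /forcing ge0_integralD//.
- congr (_ + _); apply: integral_convolution => //; last exact: mean_of_ge0.
  exact: measurable_section2.
- exact: measurable_section2.
- by move=> t _; apply: integral_ge0 => s _; rewrite mule_ge0// mean_of_ge0.
- apply: measurable_convolution => //; last exact: mean_of_ge0.
  exact: measurable_section2.
Qed.

Let Htot := \int[G]_x \int[mu]_t h x t.
Let Ktot := \int[G]_x \int[mu]_s k x s.

(** Integrating over time turns the convolution into a product, and averaging
    over [G] closes the equation on a single number. *)
Lemma mean_integral_forcing :
  \int[G]_x \int[mu]_t forcing x t = Htot + Ktot * \int[mu]_t mean_of t.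
Proof.
under eq_integral do rewrite integral_forcing.
have J0 : 0 <= \int[mu]_t mean_of t by apply: integral_ge0 => t _; exact: mean_of_ge0.
have K0 x : 0 <= \int[mu]_s k x s by exact: integral_ge0.
rewrite ge0_integralD//.
- congr (_ + _); rewrite ge0_integralZr//; exact: measurable_total.
- by move=> x _; exact: integral_ge0.
- exact: measurable_total.
- by move=> x _; rewrite mule_ge0.
- by apply: emeasurable_funM => //; exact: measurable_total.
Qed.

Lemma total_le_forcing : (forall x t, w t x <= forcing x t) ->
  (forall x, total_of x <=
    \int[mu]_t h x t + (\int[mu]_s k x s) * \int[mu]_t mean_of t) /\
  \int[mu]_t mean_of t <= Htot + Ktot * \int[mu]_t mean_of t.
Proof.
move=> wf; split.
  by move=> x; rewrite -integral_forcing; exact: ge0_le_integral_nomeas.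
rewrite -mean_integral_forcing integral_mean_of; apply: ge0_le_integral_nomeas.
  by move=> x _; exact: integral_ge0.
by move=> x _; exact: ge0_le_integral_nomeas.
Qed.

Lemma total_ge_forcing : (forall x t, forcing x t <= w t x) ->
  (forall x,
    \int[mu]_t h x t + (\int[mu]_s k x s) * \int[mu]_t mean_of t <= total_of x) /\
  Htot + Ktot * \int[mu]_t mean_of t <= \int[mu]_t mean_of t.
Proof.
have f0 x t : 0 <= forcing x t.
  rewrite adde_ge0//; apply: integral_ge0 => s _.
  by rewrite mule_ge0// mean_of_ge0.
move=> fw; split.
  by move=> x; rewrite -integral_forcing; exact: ge0_le_integral_nomeas.
rewrite -mean_integral_forcing [leRHS]integral_mean_of.
apply: ge0_le_integral_nomeas; first by move=> x _; exact: integral_ge0.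
by move=> x _; exact: ge0_le_integral_nomeas.
Qed.

End totals.

End renewal.

Section renewal_bounds.
Context {R : realType}.
Local Notation mu := (@lebesgue_measure R).
Local Open Scope ereal_scope.

(** Monotone convergence along half-lines. *)
Lemma ge0_integral_le_itv (f : R -> \bar R) (c : \bar R) :
  measurable_fun setT f -> (forall x, 0 <= f x) ->
  (forall n : nat, \int[mu]_(x in `]-oo, n%:R]) f x <= c) ->
  \int[mu]_x f x <= c.
Proof.
move=> mf f0 fc.
pose F (n : nat) : set R := `]-oo, n%:R]%classic.
have FT : \bigcup_n F n = setT.
  apply/seteqP; split => // x _; exists (Num.truncn `|x|%R).+1 => //=.
  rewrite /F/= in_itv/=; apply: le_trans (ler_norm x) _.
  by apply: ltW; exact: Num.Theory.truncnS_gt.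
have := @ge0_nondecreasing_set_cvg_integral _ (measurableTypeR R) R F f mu.
rewrite FT => cv.
have {}cv : \int[mu]_(x in F i) f x @[i --> \oo] --> \int[mu]_x f x.
  apply: cv => //.
  - move=> m n mn; rewrite subsetEset => x; rewrite /F/= !in_itv/= => xm.
    by apply: le_trans xm _; rewrite ler_nat.
  - by move=> i; exact: measurable_itv.
  - by move=> i; exact: measurable_funTS.
rewrite -(cvg_lim _ cv)//; apply: lime_le; first by apply/cvg_ex; eexists; exact: cv.
exact: nearW.
Qed.

Variables (G : {finite_measure set (measurableTypeR R) -> \bar R}).
Variables (k h w : R -> R -> \bar R).
Hypotheses (mk : measurable_fun setT (fun z : R * R => k z.1 z.2))
  (mh : measurable_fun setT (fun z : R * R => h z.1 z.2))
  (mw : measurable_fun setT (fun z : R * R => w z.1 z.2)).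
Hypotheses (k0 : forall x s, 0 <= k x s) (h0 : forall x t, 0 <= h x t)
  (w0 : forall t x, 0 <= w t x).
Hypothesis k_le0 : forall x s, (s <= 0)%R -> k x s = 0.
Hypothesis w_lt0 : forall t x, (t < 0)%R -> w t x = 0.
Hypothesis w_bnd : forall T : R, exists C : R, forall t x, (t <= T)%R -> w t x <= C%:E.
Variables (m r : R).
Hypothesis Hm : \int[G]_x \int[mu]_t h x t = m%:E.
Hypothesis Kr : \int[G]_x \int[mu]_s k x s = r%:E.
Hypothesis r1 : (r < 1)%R.

(** With [J] the total mass, Tonelli gives [J <= m + r J], which bounds [J]
    because [r < 1] as soon as [J] is finite. Finiteness is obtained by cutting
    [w] off at time [n]: the cut-off function satisfies the same inequality,
    since a convolution only looks at the past. *)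
Lemma renewal_mean_le : (forall x t, w t x <= forcing G k h w x t) ->
  \int[mu]_t mean_of G w t <= (m / (1 - r))%:E.
Proof.
move=> wf; apply: ge0_integral_le_itv.
- exact: measurable_mean_of.
- by move=> t; exact: mean_of_ge0.
move=> n.
pose wn t x := if (t <= n%:R)%R then w t x else 0.
have wn0 t x : 0 <= wn t x by rewrite /wn; case: ifP.
have mwn : measurable_fun setT (fun z : R * R => wn z.1 z.2).
  by apply: measurable_fun_ifT => //; exact: measurable_fun_ler.
have meanwn t : mean_of G wn t = (mean_of G w \_ `]-oo, n%:R]) t.
  rewrite patchE /mean_of /wn mem_setE in_itv/=.
  by case: ifP => // _; rewrite integral0.
have -> : \int[mu]_(x in `]-oo, n%:R]) mean_of G w x = \int[mu]_t mean_of G wn t.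
  by rewrite integral_mkcond; apply: eq_integral => t _; rewrite meanwn.
have wnf x t : wn t x <= forcing G k h wn x t.
  rewrite {1}/wn; case: ifPn => [tn|_]; last first.
    rewrite adde_ge0//; apply: integral_ge0 => s _; rewrite mule_ge0//.
    exact: mean_of_ge0.
  apply: le_trans (wf x t) _; apply: leeD2l.
  apply: ge0_le_integral_nomeas => [s _|s _]; first by rewrite mule_ge0// mean_of_ge0.
  have [s0|s0] := lerP s 0%R; first by rewrite k_le0// !mul0e.
  rewrite meanwn patchE mem_setE in_itv/= ifT//.
  by apply: le_trans tn; rewrite gerBl ltW.
have [C wC] := w_bnd n%:R.
have [g gE] : exists g : R, G setT = g%:E.
  have : G setT \is a fin_num by exact: fin_num_measure.
  by move=> /fineK <-; eexists.
have Jfin : \int[mu]_t mean_of G wn t \is a fin_num.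
  rewrite ge0_fin_numE; last by apply: integral_ge0 => t _; exact: mean_of_ge0.
  apply: (@le_lt_trans _ _ (\int[mu]_(t in `[0%R, n%:R]) (cst (Num.max C 0 * g)%:E t))).
    rewrite (integral_mkcond (`[0%R, n%:R]%classic : set (measurableTypeR R))); apply: ge0_le_integral_nomeas.
      by move=> t _; exact: mean_of_ge0.
    move=> t _; rewrite meanwn !patchE !mem_setE !in_itv/=.
    case: ifP => [tn|_]; last by rewrite andbF.
    have [t0|t0] := ltP t 0%R => /=.
      by rewrite /mean_of integral0_eq// => x _; rewrite w_lt0.
    rewrite /cst EFinM -gE -integral_cst//.
    apply: ge0_le_integral_nomeas => // x _.
    by apply: le_trans (wC _ _ tn) _; rewrite lee_fin le_max lexx.
  rewrite integral_cst//= lebesgue_measure_itv/=; case: ifP => _.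
    by rewrite -EFinB -EFinM ltry.
  by rewrite mule0 ltry.
have [_] := @total_le_forcing _ G k h wn mk mh mwn k0 h0 wn0 wnf.
rewrite Hm Kr -(fineK Jfin) -EFinM -EFinD !lee_fin.
set J := fine _ => JJ; rewrite ler_pdivlMr ?subr_gt0//; lra.
Qed.

Lemma renewal_mean_ge : \int[mu]_t mean_of G w t \is a fin_num ->
  (forall x t, forcing G k h w x t <= w t x) ->
  (m / (1 - r))%:E <= \int[mu]_t mean_of G w t.
Proof.
move=> Jfin fw.
have [_] := @total_ge_forcing _ G k h w mk mh mw k0 h0 w0 fw.
rewrite Hm Kr -(fineK Jfin) -EFinM -EFinD !lee_fin.
set J := fine _ => JJ; rewrite ler_pdivrMr ?subr_gt0//; lra.
Qed.

End renewal_bounds.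

(** * Chord slopes of a probability generating function at 1 *)

Section power_series_slope.
Context {R : realType}.
Variables (q : nat -> R) (M : R).
Hypotheses (q0 : forall i, 0 <= q i) (q1 : series q @ \oo --> (1 : R)).
Hypothesis qM : (\sum_(1 <= i <oo) (i%:R * q i)%:E <= M%:E)%E.

Let g (z : R) : R := limn (series (fun i => q i * z ^+ i)).

Let slope (y : R) : R := (1 - g y) / (1 - y).

Let partial_mean_le n : \sum_(0 <= i < n) i%:R * q i <= M.
Proof.
rewrite -lee_fin; apply: le_trans qM.
have [->|n0] := posnP n.
  by rewrite big_geq//; apply: nneseries_ge0 => i _ _; rewrite lee_fin mulr_ge0.
rewrite big_ltn// mul0r add0r -sumEFin.
by apply: nneseries_lim_ge => i _ _; rewrite lee_fin mulr_ge0.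
Qed.

Let is_cvg_g z : 0 <= z <= 1 -> cvgn (series (fun i => q i * z ^+ i)).
Proof.
move=> /andP[z0 z1]; apply: (@series_le_cvg _ _ q) => //.
- by move=> n; rewrite mulr_ge0// exprn_ge0.
- by move=> n; rewrite ler_piMr// exprn_ile1.
- by apply/cvg_ex; exists 1.
Qed.

Let cvg_shift k : cvgn (series (fun i => (i + k)%:R * q (i + k)%N)).
Proof.
apply: nondecreasing_is_cvgn.
  apply/nondecreasing_seqP => n.
  by rewrite !seriesEnat/= big_nat_recr//= lerDl mulr_ge0.
exists M => _ [n _ <-]; rewrite seriesEnat/=.
apply: le_trans (partial_mean_le (n + k)).
rewrite (@big_cat_nat _ _ _ k _ (n + k))//= ?leq_addl//.
rewrite [X in _ + X](_ : _ = \sum_(0 <= i < n) (i + k)%:R * q (i + k)%N).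
  by rewrite lerDr sumr_ge0// => i _; rewrite mulr_ge0.
by rewrite -{1}(add0n k) big_addn addnK.
Qed.

Let cvg_d (z : R) : 0 <= z <= 1 -> cvgn (pseries (pseries_diffs q) z).
Proof.
move=> /andP[z0 z1].
apply: (@series_le_cvg _ _ (fun i => (i + 1)%:R * q (i + 1)%N)) => //.
- by move=> n; rewrite /pseries_diffs !mulr_ge0// exprn_ge0.
- by move=> n; rewrite mulr_ge0.
- move=> n; rewrite /pseries_diffs addn1 ler_piMr ?mulr_ge0// exprn_ile1//.
Qed.

(** Termwise differentiation at [z] asks for convergence of the second derivative
    series at some [K > z]; as [n K^(n-1) (1 - K) <= 1 - K^n], the first moment
    gives it. *)
Let is_derive_g (z : R) : 0 <= z < 1 ->
  is_derive z (1 : R) g (limn (pseries (pseries_diffs q) z)).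
Proof.
move=> /andP[z0 z1].
pose K := (1 + z) / 2.
have K01 : 0 < K < 1 by rewrite /K; lra.
have zK : z < K by rewrite /K; lra.
have Kn1 n : 0 <= K ^+ n <= 1 by rewrite exprn_ge0 ?exprn_ile1//; lra.
have geo n : n.+1%:R * K ^+ n * (1 - K) <= 1 - K ^+ n.+1.
  elim: n => [|n IH]; first by rewrite expr0 expr1 mulr1 mul1r.
  have := Kn1 n.+1; move: IH; rewrite !exprS => IH /andP[H0 H1].
  rewrite -(natr1 n.+1); set a := n.+1%:R in IH *; set b := K ^+ n in IH H0 H1 *.
  have : K * (a * b * (1 - K)) <= K * (1 - K * b) by rewrite ler_wpM2l//; lra.
  have : 0 <= (1 - K * b) * (1 - K) by rewrite mulr_ge0//; lra.
  lra.
apply: (@pseries_snd_diffs _ q K z).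
- by apply: is_cvg_g; lra.
- by apply: cvg_d; lra.
- apply: (@series_le_cvg _ _ (fun i => (1 - K)^-1 * ((i + 2)%:R * q (i + 2)%N))).
  + by move=> n; rewrite /pseries_diffs !mulr_ge0//; case/andP: (Kn1 n).
  + by move=> n; rewrite !mulr_ge0// invr_ge0; lra.
  + move=> n; rewrite /pseries_diffs/= addn2 mulrAC ler_wpM2r ?mulr_ge0//.
    rewrite -div1r ler_pdivlMr; last by lra.
    by apply: le_trans (geo n) _; rewrite gerBl; case/andP: (Kn1 n.+1).
  + exact: is_cvg_seriesZ.
- by rewrite !ger0_norm//; lra.
Qed.

Let g' (z : R) : R := limn (pseries (pseries_diffs q) z).

Let tangent_monomial (z t : R) n : 0 <= z -> 0 <= t ->
  z ^+ n.+1 + n.+1%:R * z ^+ n * (t - z) <= t ^+ n.+1.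
Proof.
move=> z0 t0; elim: n => [|n IH]; first by rewrite expr0 !expr1; lra.
have zn0 : 0 <= z ^+ n by rewrite exprn_ge0.
have := ler_wpM2l t0 IH; rewrite -(exprS t) => /(le_trans _); apply.
rewrite !exprS -(natr1 n.+1); set b := z ^+ n in zn0 *.
have := mulr_ge0 zn0 (mulr_ge0 (ler0n R n.+1) (sqr_ge0 (t - z))).
set a := n.+1%:R; lra.
Qed.

(** Termwise, from the convexity of monomials. *)
Let tangent_le (z t : R) : 0 <= z < 1 -> 0 <= t <= 1 ->
  g z + g' z * (t - z) <= g t.
Proof.
move=> z01 t01.
have z01' : 0 <= z <= 1 by lra.
have z0 : 0 <= z by lra.
have t0 : 0 <= t by lra.
have cz : series (fun i => q i * z ^+ i) n.+1 @[n --> \oo] --> g z.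
  by rewrite (cvg_shiftS (series _)); exact: is_cvg_g.
have ct : series (fun i => q i * t ^+ i) n.+1 @[n --> \oo] --> g t.
  by rewrite (cvg_shiftS (series _)); exact: is_cvg_g.
have cd : pseries (pseries_diffs q) z n * (t - z) @[n --> \oo] --> g' z * (t - z).
  by apply: cvgMl; exact: cvg_d.
apply: (ler_cvg_to (cvgD cz cd) ct); apply: nearW => n /=.
rewrite [leLHS](_ : _ = series (fun i => q i * z ^+ i) n.+1 +
  pseries (pseries_diffs q) z n * (t - z))//.
rewrite /pseries !seriesEnat/= !big_nat_recl//= !expr0 -addrA lerD2l.
rewrite mulr_suml -big_split/=; apply: ler_sum => i _.
rewrite /pseries_diffs (_ : _ + _ =
  q i.+1 * (z ^+ i.+1 + i.+1%:R * z ^+ i * (t - z))); last by ring.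
by rewrite ler_wpM2l// tangent_monomial.
Qed.

Let g_1 : g 1 = 1.
Proof.
rewrite /g; apply/cvg_lim => //; rewrite (_ : (fun _ => _) = q)//.
by apply/funext => i; rewrite expr1n mulr1.
Qed.

Let g_lip (z : R) : 0 <= z <= 1 -> 1 - g z <= M * (1 - z).
Proof.
move=> z01; suff : 1 - M * (1 - z) <= g z by lra.
have cz : series (fun i => q i * z ^+ i) @ \oo --> g z by exact: is_cvg_g.
have cq : series q n - M * (1 - z) @[n --> \oo] --> 1 - M * (1 - z).
  by apply: cvgB => //; exact: cvg_cst.
apply: (ler_cvg_to cq cz); apply: nearW => n.
have := partial_mean_le n; rewrite !seriesEnat/= => Mn.
suff : \sum_(0 <= i < n) q i - \sum_(0 <= i < n) q i * z ^+ i <= M * (1 - z).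
  by lra.
rewrite -sumrB.
apply: (@le_trans _ _ ((\sum_(0 <= i < n) i%:R * q i) * (1 - z))); last first.
  by rewrite ler_wpM2r//; lra.
rewrite mulr_suml; apply: ler_sum => i _.
rewrite -{1}(mulr1 (q i)) -mulrBr mulrAC mulrC ler_wpM2r//.
case: i => [|i]; first by rewrite expr0 mul0r subrr.
have z0 : 0 <= z by lra.
have := tangent_monomial 1 z i ler01 z0; rewrite !expr1n; lra.
Qed.

Let g'_le (z : R) : 0 <= z < 1 -> g' z <= slope z.
Proof.
move=> z01; rewrite /slope ler_pdivlMr; last by lra.
have := tangent_le z 1 z01 ltac:(lra); rewrite g_1; lra.
Qed.

Let g'_ge0 (z : R) : 0 <= z < 1 -> 0 <= g' z.
Proof.
move=> z01; apply: limr_ge; first by apply: cvg_d; lra.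
apply: nearW => n; rewrite /pseries seriesEnat/=; apply: sumr_ge0 => i _.
by rewrite /pseries_diffs !mulr_ge0// exprn_ge0//; lra.
Qed.

Lemma slope_le_bound (y : R) : 0 <= y < 1 -> slope y <= M.
Proof.
move=> y01; rewrite /slope ler_pdivrMr; last by lra.
by apply: g_lip; lra.
Qed.

Lemma slope_ge0 (y : R) : 0 <= y < 1 -> 0 <= slope y.
Proof. by move=> y01; apply: le_trans (g'_ge0 y y01) (g'_le y y01). Qed.

(** The tangent inequality at [z], evaluated at [y]. *)
Lemma slope_le (y z : R) : 0 <= y <= z -> z < 1 -> slope y <= slope z.
Proof.
move=> yz z1.
have z01 : 0 <= z < 1 by lra.
have h1 := g'_le z z01.
have h2 := tangent_le z y z01 ltac:(lra).
rewrite {1}/slope ler_pdivrMr; last by lra.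
have h3 : 1 - g z = slope z * (1 - z) by rewrite /slope divfK//; lra.
have : (slope z - g' z) * (z - y) >= 0 by rewrite mulr_ge0//; lra.
lra.
Qed.

Let limit_slope := limn (fun n : nat => slope (1 - n.+1%:R^-1)).

Let dist1n (n : nat) : 0 <= 1 - n.+1%:R^-1 :> R /\ 1 - n.+1%:R^-1 < 1 :> R.
Proof.
split; last by rewrite ltrBlDr ltrDl invr_gt0.
by rewrite subr_ge0 invf_le1// ler1n.
Qed.

Let cvg_slope : slope (1 - n.+1%:R^-1) @[n --> \oo] --> limit_slope.
Proof.
apply: nondecreasing_is_cvgn.
  move=> m n mn; have [h1 h2] := dist1n m; have [h3 h4] := dist1n n.
  apply: slope_le => //; rewrite h1/= lerD2l lerN2 lef_pV2 ?posrE//.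
  by rewrite ler_nat.
exists M => _ [n _ <-]; have [h1 h2] := dist1n n.
by apply: slope_le_bound; rewrite h1 h2.
Qed.

Let slope_le_limit (y : R) : 0 <= y < 1 -> slope y <= limit_slope.
Proof.
move=> /andP[y0 y1]; apply: (cvgr_to_ge cvg_slope).
near=> n; have [h1 h2] := dist1n n.
apply: slope_le => //; rewrite y0/= lerBrDr -lerBrDl -lef_pV2 ?posrE ?invr_gt0 ?subr_gt0//.
rewrite invrK; apply: (@le_trans _ _ n%:R); last by rewrite ler_nat.
near: n; exact: nbhs_infty_ger.
Unshelve. all: by end_near. Qed.

(** The derivative at [z] is at most the chord slope, and the tangent inequality
    at [z], evaluated at a fixed [y], bounds it from below by a quantity that
    tends to the chord slope at [y] as [z] tends to 1. *)
Lemma cvg_derive_left : derive1 g z @[z --> 1^'-] --> limit_slope.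
Proof.
have M0 : 0 <= M by apply: le_trans (slope_ge0 0 _) (slope_le_bound 0 _); lra.
have dg (z : R) : 0 <= z < 1 -> derive1 g z = g' z.
  by move=> z01; rewrite derive1E; have := is_derive_g z z01 => H; exact: derive_val.
apply/cvgrPdist_le => e e0.
have e20 : 0 < e / 2 by lra.
have /cvgrPdist_le/(_ _ e20) [N _ /(_ N (leqnn N))/=] := cvg_slope.
have [h1 h2] := dist1n N; set y : R := 1 - N.+1%:R^-1 in h1 h2 * => hy.
have {hy} hy : limit_slope - e / 2 <= slope y.
  by move: hy => /ler_normlP[_]; lra.
near=> z.
have yz : y < z by near: z; exact: nbhs_left_gt.
have z1 : z < 1 by near: z; exact: nbhs_left_lt.
have zz : M * (1 - z) <= e / 2 * (1 - y).
  have : 1 - e / 2 * (1 - y) / (M + 1) < z.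
    near: z; apply: nbhs_left_gt; rewrite ltrBlDr ltrDl divr_gt0//; last by lra.
    by rewrite mulr_gt0//; lra.
  rewrite ltrBlDr -ltrBlDl ltr_pdivlMr; last by lra.
  move=> h; apply: ltW; apply: le_lt_trans h; rewrite mulrC ler_wpM2l//; lra.
have z01 : 0 <= z < 1 by lra.
have g'z : g' z <= limit_slope.
  by apply: le_trans (g'_le z z01) (slope_le_limit z z01).
have : (limit_slope - e) * (1 - y) <= g' z * (1 - y).
  have := tangent_le z y z01 ltac:(lra).
  have := g_lip z ltac:(lra).
  have : slope y * (1 - y) = 1 - g y by rewrite /slope divfK//; lra.
  have := g'_ge0 z z01.
  have : (slope y - (limit_slope - e / 2)) * (1 - y) >= 0.
    by rewrite mulr_ge0//; lra.
  nra.
rewrite ler_pM2r; last by lra.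
move=> h; rewrite dg//; apply/ler_normlP; split; lra.
Unshelve. all: by end_near. Qed.

Lemma limit_derive : lim (derive1 g z @[z --> 1^'-]) = limit_slope.
Proof. exact/cvg_lim/cvg_derive_left. Qed.

Lemma slope_cvg : slope (1 - n.+1%:R^-1) @[n --> \oo] -->
  lim (derive1 g z @[z --> 1^'-]).
Proof. by rewrite limit_derive; exact: cvg_slope. Qed.

Lemma slope_le_derive (y : R) : 0 <= y < 1 ->
  slope y <= lim (derive1 g z @[z --> 1^'-]).
Proof. by rewrite limit_derive; exact: slope_le_limit. Qed.

Lemma series_at1 : g 1 = 1. Proof. exact: g_1. Qed.

End power_series_slope.

(** * Mean birth rates *)

Section offspring.
Context {R : realType}.
Variables (alpha : R -> R) (p : R -> nat -> R).
Hypotheses (halpha : is_C1plus alpha) (hp : is_offspring_law p).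

(** Slope of the chord of the generating function over [1 - d, 1]; it increases
    to the mean number of children as [d] decreases to 0. *)
Definition offspring_slope (d x : R) : R := (1 - gen_fun p x (1 - d)) / d.

Let offspring_bound : exists2 M : R, 0 <= M & forall x, 0 < x ->
  (\sum_(1 <= i <oo) (i%:R * p x i)%:E <= M%:E)%E.
Proof.
case: hp => _ _ _ [M hM] _; exists (Num.max 0 M); first by rewrite le_max lexx.
by move=> x x0; apply: le_trans (hM x x0) _; rewrite lee_fin le_max lexx orbT.
Qed.

Let slopeE d x : offspring_slope d x = (1 - gen_fun p x (1 - d)) / (1 - (1 - d)).
Proof. by rewrite subKr. Qed.

Lemma offspring_slope_ge0 d x : 0 < d <= 1 -> 0 < x -> 0 <= offspring_slope d x.
Proof.
move=> d01 x0; have [M _ hM] := offspring_bound; have [p0 p1 _ _ _] := hp.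
rewrite slopeE; apply: (@slope_ge0 _ (p x) M (p0 x x0) (p1 x x0) (hM x x0)).
by lra.
Qed.

Lemma offspring_slope_le_mean d x : 0 < d <= 1 -> 0 < x ->
  offspring_slope d x <= gen_fun1 p x.
Proof.
move=> d01 x0; have [M _ hM] := offspring_bound; have [p0 p1 _ _ _] := hp.
rewrite slopeE.
apply: (@slope_le_derive _ (p x) M (p0 x x0) (p1 x x0) (hM x x0)).
by lra.
Qed.

Lemma offspring_slope_anti d e x : 0 < d <= e -> e <= 1 -> 0 < x ->
  offspring_slope e x <= offspring_slope d x.
Proof.
move=> de e1 x0; have [M _ hM] := offspring_bound; have [p0 p1 _ _ _] := hp.
rewrite !slopeE.
by apply: (@slope_le _ (p x) M (p0 x x0) (p1 x x0) (hM x x0)); lra.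
Qed.

Lemma offspring_slope_cvg x : 0 < x ->
  offspring_slope n.+1%:R^-1 x @[n --> \oo] --> gen_fun1 p x.
Proof.
move=> x0; have [M _ hM] := offspring_bound; have [p0 p1 _ _ _] := hp.
under eq_fun do rewrite slopeE.
exact: (@slope_cvg _ (p x) M (p0 x x0) (p1 x x0) (hM x x0)).
Qed.

Lemma offspring_mean_ge0 x : 0 < x -> 0 <= gen_fun1 p x.
Proof.
move=> x0; have h1 : 0 < (1 : R) <= 1 by lra.
exact: le_trans (offspring_slope_ge0 1 x h1 x0) (offspring_slope_le_mean 1 x h1 x0).
Qed.

Lemma offspring_mean_bounded : exists2 M : R, 0 <= M &
  forall x, 0 < x -> gen_fun1 p x <= M.
Proof.
have [M M0 hM] := offspring_bound; have [p0 p1 _ _ _] := hp.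
exists M => // x x0; apply: (cvgr_to_le (offspring_slope_cvg x x0)).
apply: nearW => n; have := @inv_nat_itv R n; set d := _^-1 => d01.
rewrite slopeE.
apply: (@slope_le_bound _ (p x) M (p0 x x0) (p1 x x0) (hM x x0)).
by lra.
Qed.

Lemma gen_fun_1 x : 0 < x -> gen_fun p x 1 = 1.
Proof.
move=> x0; have [M _ hM] := offspring_bound; have [p0 p1 _ _ _] := hp.
exact: (@series_at1 _ (p x) (p1 x x0)).
Qed.

Lemma gen_fun_slope z x : 0 <= z < 1 -> 0 < x ->
  1 - gen_fun p x z = offspring_slope (1 - z) x * (1 - z).
Proof. by move=> z01 x0; rewrite /offspring_slope subKr divfK//; lra. Qed.

Lemma one_sub_gen_fun_ge0 z x : 0 <= z <= 1 -> 0 < x -> 0 <= 1 - gen_fun p x z.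
Proof.
move=> z01 x0; have [->|z1] := eqVneq z 1; first by rewrite gen_fun_1// subrr.
have z01' : 0 <= z < 1 by lra.
by rewrite gen_fun_slope// mulr_ge0 ?offspring_slope_ge0//; lra.
Qed.

Lemma one_sub_gen_fun_le z x : 0 <= z <= 1 -> 0 < x ->
  1 - gen_fun p x z <= gen_fun1 p x * (1 - z).
Proof.
move=> z01 x0; have [->|z1] := eqVneq z 1; first by rewrite gen_fun_1// subrr mulr0.
have z01' : 0 <= z < 1 by lra.
by rewrite gen_fun_slope// ler_wpM2r ?offspring_slope_le_mean//; lra.
Qed.

(** The chord over a larger interval has a smaller slope. *)
Lemma one_sub_gen_fun_ge d z x : 0 < d <= 1 -> 1 - d <= z <= 1 -> 0 < x ->
  offspring_slope d x * (1 - z) <= 1 - gen_fun p x z.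
Proof.
move=> d01 dz x0; have [->|z1] := eqVneq z 1; first by rewrite gen_fun_1// subrr mulr0.
have z01' : 0 <= z < 1 by lra.
by rewrite gen_fun_slope// ler_wpM2r ?offspring_slope_anti//; lra.
Qed.

Definition birth_rate (x : R) : R := ext0 alpha x * gen_fun1 p x.

Definition birth_rate_slope (d x : R) : R := ext0 alpha x * offspring_slope d x.

Lemma measurable_ext0_alpha : measurable_fun setT (ext0 alpha).
Proof.
case: halpha => -[[ca _] _ _] _.
by apply: measurable_ext0; exact: measurable_continuous_on_pos.
Qed.

Lemma measurable_birth_rate_slope d : 0 < d <= 1 ->
  measurable_fun setT (birth_rate_slope d).
Proof.
move=> d01; rewrite [X in measurable_fun _ X](_ : _ =
    ext0 alpha \* ext0 (offspring_slope d)); last first.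
  apply/funext => x; rewrite /birth_rate_slope/=.
  have [x0|x0] := ltP 0 x; first by rewrite !(ext0_pos _ x).
  by rewrite !(ext0_le0 _ x)// !mul0r.
apply: measurable_funM; first exact: measurable_ext0_alpha.
apply: measurable_ext0; apply: measurable_continuous_on_pos => x x0.
have d1 : 0 <= 1 - d <= 1 by lra.
have [_ _ _ _ /(_ _ d1)[[[cg _] _ _] _]] := hp.
by apply: cvgM; [apply: cvgB; [exact: cvg_cst|exact: cg]|exact: cvg_cst].
Qed.

Lemma birth_rate_slope_cvg x :
  birth_rate_slope n.+1%:R^-1 x @[n --> \oo] --> birth_rate x.
Proof.
rewrite /birth_rate_slope /birth_rate; have [x0|x0] := ltP 0 x.
  by apply: cvgMr; exact: offspring_slope_cvg.
rewrite ext0_le0// mul0r; under eq_fun do rewrite mul0r; exact: cvg_cst.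
Qed.

(** The derivative at 1 is a limit of chord slopes, each of them measurable
    because the generating function is continuous in [x]. *)
Lemma measurable_birth_rate : measurable_fun setT birth_rate.
Proof.
apply: (@measurable_fun_cvg _ _ _ setT (fun n => birth_rate_slope n.+1%:R^-1)).
  by move=> n; apply: measurable_birth_rate_slope; exact: inv_nat_itv.
by move=> x _; exact: birth_rate_slope_cvg.
Qed.

Let alpha_ge0 x : 0 <= ext0 alpha x.
Proof. by apply: ext0_ge0; case: halpha. Qed.

Lemma birth_rate_le0 x : x <= 0 -> birth_rate x = 0.
Proof. by move=> x0; rewrite /birth_rate ext0_le0// mul0r. Qed.

Lemma birth_rate_pos x : 0 < x -> birth_rate x = alpha x * gen_fun1 p x.
Proof. by move=> x0; rewrite /birth_rate ext0_pos. Qed.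

Lemma birth_rate_slope_le0 d x : x <= 0 -> birth_rate_slope d x = 0.
Proof. by move=> x0; rewrite /birth_rate_slope ext0_le0// mul0r. Qed.

Lemma birth_rate_ge0 x : 0 <= birth_rate x.
Proof.
have [x0|x0] := ltP 0 x; last by rewrite birth_rate_le0.
by rewrite mulr_ge0// offspring_mean_ge0.
Qed.

Lemma birth_rate_slope_ge0 d x : 0 < d <= 1 -> 0 <= birth_rate_slope d x.
Proof.
move=> d01; have [x0|x0] := ltP 0 x; last by rewrite birth_rate_slope_le0.
by rewrite mulr_ge0// offspring_slope_ge0.
Qed.

Lemma birth_rate_slope_anti d e x : 0 < d <= e -> e <= 1 ->
  birth_rate_slope e x <= birth_rate_slope d x.
Proof.
move=> de e1; have [x0|x0] := ltP 0 x.
  by rewrite ler_wpM2l// offspring_slope_anti.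
by rewrite !birth_rate_slope_le0.
Qed.

Lemma birth_rate_bounded : exists2 C : R, 0 <= C & forall x, birth_rate x <= C.
Proof.
case: halpha => -[[_ [A hA]] _ _] a0.
have [M M0 hM] := offspring_mean_bounded.
exists (`|A| * M); first by rewrite mulr_ge0.
move=> x; have [x0|x0] := ltP 0 x; last by rewrite birth_rate_le0// mulr_ge0.
rewrite /birth_rate ext0_pos// ler_pM ?hM//; first exact: a0.
  exact: offspring_mean_ge0.
by apply: le_trans (ler_norm _) _; apply: le_trans (hA x x0) _; exact: ler_norm.
Qed.

End offspring.

(** * Measurability of random configurations *)

Section configurations.
Context {R : realType}.
Local Open Scope ereal_scope.
Implicit Types nu : config R.

Lemma config_setC_pos nu : nu (~` pos_reals) = 0.
Proof.
rewrite -(config_pos nu); congr (nu _).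
apply/seteqP; split => x; rewrite /pos_reals/= !in_itv/= andbT.
  by move/negP; rewrite -leNgt.
by rewrite leNgt => /negP.
Qed.

Lemma config_mass_fin nu : nu setT \is a fin_num.
Proof. exact: fin_num_measure. Qed.

(** An integer that tends to 0 vanishes: the mass beyond [N] is eventually null. *)
Lemma config_bounded_support nu :
  exists N : nat, nu `]N%:R, +oo[%classic = 0.
Proof.
pose F (n : nat) : set (measurableTypeR R) := `]n%:R, +oo[%classic.
have mF n : measurable (F n) by exact: measurable_itv.
have F0 : \bigcap_n F n = set0.
  apply/seteqP; split => // x /(_ (Num.truncn `|x|%R).+1 I).
  rewrite /F/= in_itv/= andbT => h; have := lt_le_trans h (ler_norm x).
  by rewrite ltNge ltW// truncnS_gt.
have := @nonincreasing_cvg_mu _ (measurableTypeR R) R nu F.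
rewrite F0 measure0 => cv.
have {}cv : nu (F n) @[n --> \oo] --> 0.
  apply: cv => //.
  - by rewrite -ge0_fin_numE//; exact: fin_num_measure.
  - move=> m n mn; rewrite subsetEset => x; rewrite /F/= !in_itv/= !andbT.
    by apply: le_lt_trans; rewrite ler_nat.
have /fine_cvgP[_ /cvgrPdist_lt/(_ _ ltr01)] := cv.
case=> N _ /(_ N (leqnn N)) /=; rewrite sub0r normrN => h.
exists N; have [n nE] := config_int nu (mF N).
move: h; rewrite -/(F N) nE/= ger0_norm//.
by rewrite (ltr_nat R n 1) ltnS leqn0 => /eqP ->.
Qed.

(** Almost all of the mass lies in a bounded interval. *)
Lemma config_first_moment nu : \int[nu]_x `|x|%:E < +oo.
Proof.
have [N hN] := config_bounded_support nu.
apply: (@le_lt_trans _ _ (\int[nu]_x (cst N%:R%:E x))); last first.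
  rewrite integral_cst// -ge0_fin_numE; last by rewrite mule_ge0.
  by rewrite fin_numM// config_mass_fin.
apply: ae_ge0_le_integral => //.
- by apply/measurable_EFinP; apply: measurableT_comp => //; exact: normr_measurable.
- by move=> x _; rewrite lee_fin.
exists (~` pos_reals `|` `]N%:R, +oo[%classic); split.
- apply: measurableU; last exact: measurable_itv.
  by apply: measurableC; exact: measurable_pos_reals.
- apply: null_set_setU => //; first by apply: measurableC; exact: measurable_pos_reals.
  exact: config_setC_pos.
- move=> x /= /not_implyP[_] /negP; rewrite lee_fin -ltNge => Nx.
  have [x0|x0] := ltP 0%R x.
    by right; rewrite /= in_itv/= andbT -(gtr0_norm x0).
  by left; rewrite /pos_reals/= in_itv/= andbT => /(lt_le_trans)/(_ x0); rewrite ltxx.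
Qed.

Lemma pairing_mkcond nu (f : R -> R) :
  pairing nu f = fine (\int[nu]_x (ext0 f x)%:E).
Proof.
rewrite /pairing /Rintegral integral_mkcond; congr fine.
by apply: eq_integral => x _; rewrite restrict_EFin.
Qed.

Lemma continuous_pairing (f : R -> R) : is_C f ->
  continuous (fun nu : config R => pairing nu f).
Proof.
move=> Cf nu.
have c1 := @initial_continuous (config R) {ptws Cb R -> R} (@weak_eval R).
have c2 := @proj_continuous (Cb R) (fun=> R) (exist _ f Cf : Cb R).
exact: (continuous_comp (c1 nu) (c2 _)).
Qed.

Lemma measurable_pairing_C (f : R -> R) : is_C f ->
  measurable_fun setT (fun nu : config R => pairing nu f).
Proof.
move=> Cf.
have cont := continuous_pairing f Cf.
apply: (measurability _ (RGenOpens.measurableE R)).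
move=> _ [_ [a [b ->] <-]]; rewrite setTI.
apply: sub_sigma_algebra; move/continuousP : cont; apply.
exact: interval_open.
Qed.

(** Continuous functions that increase to the indicator of a half-line. *)
Definition ramp (a : R) (n : nat) (y : R) : R :=
  (Num.min 1 (n%:R * Num.max 0 (y - a)))%R.

Lemma ramp_itv a n y : (0 <= ramp a n y <= 1)%R.
Proof.
rewrite /ramp; apply/andP; split; last by rewrite ge_min lexx.
by rewrite le_min ler01 mulr_ge0// le_max lexx.
Qed.

Lemma continuous_ramp a n : continuous (ramp a n).
Proof.
move=> x; apply: (@continuous_min R R (cst 1%R)
  (fun y => n%:R * Num.max 0 (y - a))%R); first exact: cvg_cst.
apply: cvgMr; apply: (@continuous_max R R (cst 0%R) (fun y => y - a)%R).
  exact: cvg_cst.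
by apply: cvgB; [exact: cvg_id|exact: cvg_cst].
Qed.

Lemma is_C_ramp a n : is_C (ramp a n).
Proof.
split; first by move=> x _; exact: continuous_ramp.
exists 1%R => x _; have /andP[h1 h2] := ramp_itv a n x.
by rewrite ger0_norm.
Qed.

Lemma ramp_cvg a y : (ramp a n y)%:E @[n --> \oo] --> (\1_(`]a, +oo[) y : R)%:E.
Proof.
apply: cvg_EFin; first exact: nearW.
rewrite indicE mem_setE in_itv/= andbT; apply: cvg_near_cst.
have [ay|ay] := ltP a y; last first.
  apply: nearW => n /=; rewrite /ramp max_l; last by rewrite subr_le0.
  by rewrite mulr0 min_r.
near=> n; rewrite /= /ramp max_r ?subr_ge0 1?ltW// min_l//.
rewrite -ler_pdivrMr ?subr_gt0// div1r.
near: n; exact: nbhs_infty_ger.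
Unshelve. all: by end_near. Qed.

Lemma config_setI_pos nu (A : set (measurableTypeR R)) : measurable A ->
  nu (A `&` pos_reals) = nu A.
Proof.
move=> mA; rewrite [RHS](measureDI nu mA measurable_pos_reals).
rewrite [X in _ = X + _](_ : _ = 0) ?add0e//.
apply: (@subset_measure0 _ _ _ nu _ (~` pos_reals)) => //.
- by apply: measurableD => //; exact: measurable_pos_reals.
- by apply: measurableC; exact: measurable_pos_reals.
- exact: config_setC_pos.
Qed.

Lemma integral_ramp_cvg nu a :
  \int[nu]_(x in pos_reals) (ramp a n x)%:E @[n --> \oo] --> nu `]a, +oo[%classic.
Proof.
have -> : nu `]a, +oo[%classic = \int[nu]_(x in pos_reals) limn (fun n => (ramp a n x)%:E).
  rewrite (eq_integral (fun x => (\1_(`]a, +oo[%classic : set (measurableTypeR R)) x : R)%:E)); last first.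
    by move=> x _; apply/cvg_lim => //; exact: ramp_cvg.
  rewrite integral_indic//; last exact: measurable_pos_reals.
  by symmetry; apply: config_setI_pos; exact: measurable_itv.
apply: cvg_monotone_convergence.
- exact: measurable_pos_reals.
- move=> n; apply/measurable_EFinP; apply: measurable_funTS.
  by apply: continuous_measurable_fun; exact: continuous_ramp.
- by move=> n x _; rewrite lee_fin; case/andP: (ramp_itv a n x).
- move=> x _ m n mn; rewrite lee_fin /ramp.
  rewrite le_min ge_min lexx/= ge_min; apply/orP; right.
  by rewrite ler_wpM2r ?ler_nat// le_max lexx.
Qed.

(** Weak measurability gives the masses of half-lines, as limits of integrals of
    ramps; Dynkin's lemma extends it to Borel sets. *)
Lemma measurable_config_eval d (X : measurableType d) (N : X -> config R) :
  (forall f : R -> R, is_C f -> measurable_fun setT (fun x => pairing (N x) f)) ->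
  forall A : set (measurableTypeR R), measurable A ->
    measurable_fun setT (fun x => N x A).
Proof.
move=> mN.
have mray a : measurable_fun setT (fun x => N x `]a, +oo[%classic).
  apply: (@emeasurable_fun_cvg _ _ _ setT (fun n x => (pairing (N x) (ramp a n))%:E)).
    by move=> n; apply/measurable_EFinP; apply: mN; exact: is_C_ramp.
  move=> x _; apply: cvg_trans (integral_ramp_cvg (N x) a).
  apply: near_eq_cvg; apply: nearW => n.
  rewrite /pairing /Rintegral fineK// ge0_fin_numE; last first.
    by apply: integral_ge0 => y _; rewrite lee_fin; case/andP: (ramp_itv a n y).
  apply: (@le_lt_trans _ _ (\int[N x]_(y in pos_reals) (cst 1 y))).
    apply: ge0_le_integral_nomeas => y _; rewrite lee_fin;
    by case/andP: (ramp_itv a n y).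
  rewrite integral_cst ?mul1e//; last exact: measurable_pos_reals.
  by rewrite -ge0_fin_numE// fin_num_measure//; exact: measurable_pos_reals.
have mT : measurable_fun setT (fun x => N x setT).
  rewrite [X in measurable_fun _ X](_ : _ = fun x => N x `]0%R, +oo[%classic)//.
  by apply/funext => x; rewrite -(config_setI_pos (N x) setT)// setTI.
move=> A; rewrite -[X in X -> _]/((@ocitv R).-sigma.-measurable A).
rewrite RGenOInfty.measurableE; move: A.
apply: (@dynkin_induction _ (measurableTypeR R) (@RGenOInfty.G R)
  (fun A => measurable_fun setT (fun x => N x A))).
- exact: RGenOInfty.measurableE.
- move=> _ _ [a ->] [b ->]; exists (Num.max a b).
  by apply/seteqP; split => x /=; rewrite !in_itv/= !andbT gt_max => /andP.
- exact: mT.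
- by move=> _ [a ->]; exact: mray.
- move=> S mS PS.
  rewrite [X in measurable_fun _ X](_ : _ = fun x => N x setT - N x S).
    exact: emeasurable_funB.
  apply/funext => x; rewrite -setTD measureD// ?setTI//.
  by rewrite -ge0_fin_numE// config_mass_fin.
- move=> F mF tF PF.
  rewrite [X in measurable_fun _ X](_ : _ = fun x => \sum_(0 <= k <oo) N x (F k)).
    by apply: ge0_emeasurable_sum.
  by apply/funext => x; rewrite measure_semi_bigcup//; exact: bigcupT_measurable.
Qed.

End configurations.

Section random_measure.
Context {R : realType} {d e : measure_display}.
Context {X : measurableType d} {T : measurableType e}.
Variable N : X -> {finite_measure set T -> \bar R}.
Hypothesis mN : forall A : set T, measurable A ->
  measurable_fun setT (fun x => N x A).
Local Open Scope ereal_scope.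

Lemma measurable_random_section (U : set (X * T)) :
  measurable U -> measurable_fun setT (fun x => N x (xsection U x)).
Proof.
pose G : set (set (X * T)) :=
  [set A `*` B | A in measurable & B in measurable].
rewrite measurable_prod_measurableType.
apply: (@dynkin_induction _ _ G
  (fun U => measurable_fun setT (fun x => N x (xsection U x)))).
- exact: measurable_prod_measurableType.
- move=> _ _ [A mA [B mB <-]] [A' mA' [B' mB' <-]].
  exists (A `&` A'); first exact: measurableI.
  by exists (B `&` B'); [exact: measurableI|rewrite setXI].
- rewrite [Y in measurable_fun _ Y](_ : _ = fun x => N x setT); first exact: mN.
  by apply/funext => x; rewrite xsectionE preimage_setT.
- move=> _ [A mA [B mB <-]].
  rewrite [Y in measurable_fun _ Y](_ : _ = fun x => (\1_A x)%:E * N x B); last first.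
    apply/funext => x; rewrite indicE; have [xA|xA] := boolP (x \in A).
      by rewrite in_xsectionX// mul1e.
    by rewrite notin_xsectionX// measure0 mul0e.
  by apply: emeasurable_funM; [exact/measurable_EFinP|exact: mN].
- move=> S mS PS.
  rewrite [Y in measurable_fun _ Y](_ : _ = fun x => N x setT - N x (xsection S x)).
    by apply: emeasurable_funB => //; exact: mN.
  apply/funext => x; rewrite (_ : xsection (~` S) x = ~` xsection S x); last by rewrite !xsectionE preimage_setC.
  rewrite -setTD measureD// ?setTI//; first exact: measurable_xsection.
  by rewrite -ge0_fin_numE// fin_num_measure.
- move=> F mF tF PF.
  rewrite [Y in measurable_fun _ Y](_ : _ = fun x => \sum_(0 <= k <oo) N x (xsection (F k) x)).
    by apply: ge0_emeasurable_sum.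
  apply/funext => x; rewrite xsection_bigcup measure_semi_bigcup//.
  + by move=> i; exact: measurable_xsection.
  + exact: trivIset_xsection.
  + by apply: bigcupT_measurable => i; exact: measurable_xsection.
Qed.

(** Integrals against a measurable family of finite measures depend measurably
    on the parameter, even when the integrand depends on it too. *)
Lemma measurable_random_integral (h : X * T -> \bar R) :
  measurable_fun setT h -> (forall z, 0 <= h z) ->
  measurable_fun setT (fun x => \int[N x]_y h (x, y)).
Proof.
move=> mh h0.
have mp x : measurable_fun setT (pair x : T -> X * T).
  exact: measurable_pair1.
pose l x : {measure set (X * T) -> \bar R} :=
  pushforward (N x) (pair x : T -> X * T).
rewrite (_ : (fun x => _) = (fun x => \int[l mp x]_z h z)); last first.
  apply/funext => x; rewrite /l/=.
  by rewrite (ge0_integral_pushforward (mp x) (N x) measurableT mh).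
apply: measurable_fun_integral_kernel => // U mU.
rewrite (_ : (fun x => _) = (fun x => N x (xsection U x))).
  exact: measurable_random_section.
by apply/funext => x; rewrite /l/= /pushforward -xsectionE.
Qed.

End random_measure.

Section measurable_process.
Context {R : realType}.
Local Open Scope ereal_scope.

Lemma measurable_mass (A : set (measurableTypeR R)) : measurable A ->
  measurable_fun setT (fun nu : config R => nu A).
Proof.
exact: (@measurable_config_eval R _ (config R) id measurable_pairing_C).
Qed.

Lemma measurable_nonnull : measurable (@nonnull_config R).
Proof.
rewrite (_ : nonnull_config = setT `&` [set nu : config R | nu setT != 0]).
  apply: emeasurable_neq => //; exact: measurable_mass.
by rewrite setTI.
Qed.

Context {d : measure_display} {Omega : measurableType d}.

Lemma measurable_fun_countable_switch (k : R -> nat) (phi : nat -> Omega -> R) :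
  (forall n, measurable (k @^-1` [set n])) ->
  (forall n, measurable_fun setT (phi n)) ->
  measurable_fun setT (fun z : R * Omega => phi (k z.1) z.2).
Proof.
move=> mk mphi _ B mB; rewrite setTI.
rewrite (_ : _ @^-1` _ = \bigcup_n ((k @^-1` [set n]) `*` (phi n @^-1` B))).
  apply: bigcupT_measurable => n; apply: measurableX; first exact: mk.
  by rewrite -[X in measurable X]setTI; exact: mphi.
apply/seteqP; split => [[s w]/= h|[s w] [n _ [/= <-]]//].
by exists (k s).
Qed.

Variable Y : R -> Omega -> config R.
Hypothesis mY : forall t, (0 <= t)%R -> measurable_fun setT (Y t).
Hypothesis rY : forall w t, (0 <= t)%R -> Y s w @[s --> t^'+] --> Y t w.

Let pos (s : R) : R := Num.max 0%R s.

(** By right-continuity the process is the limit of processes that are constant on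
    cells of length [1 / (n + 1)], where they take the value at the right
    endpoint. Negative times are sent to 0. *)
Lemma measurable_process (A : set (measurableTypeR R)) : measurable A ->
  measurable_fun setT (fun z : R * Omega => Y (Num.max 0%R z.1) z.2 A).
Proof.
apply: (@measurable_config_eval _ _ _ (fun z : R * Omega => Y (Num.max 0%R z.1) z.2)).
move=> f Cf.
pose k n (s : R) : nat := Num.truncn (n.+1%:R * pos s)%R.
pose tn n (j : nat) : R := (j.+1%:R / n.+1%:R)%R.
apply: (@measurable_fun_cvg _ _ _ setT
  (fun n (z : R * Omega) => pairing (Y (tn n (k n z.1)) z.2) f)).
  move=> n.
  apply: (measurable_fun_countable_switch (k n) (fun j w => pairing (Y (tn n j) w) f)).
    move=> j; rewrite (_ : _ @^-1` _ =
      (fun s : R => n.+1%:R * pos s)%R @^-1` `[j%:R, j.+1%:R[%classic); last first.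
      apply/seteqP; split => s /=; rewrite in_itv/= /k.
        move=> <-; apply: truncn_itv.
        by rewrite mulr_ge0// le_max lexx.
      by move/truncn_def.
    rewrite -[X in measurable X]setTI.
    have mp : measurable_fun setT (fun s : R => n.+1%:R * pos s)%R.
      by apply: measurable_funM => //; exact: measurable_maxr.
    by apply: mp => //; exact: measurable_itv.
  move=> j; apply: (measurableT_comp (measurable_pairing_C f Cf)).
  by apply: mY; rewrite divr_ge0.
move=> [s w] _ /=.
have p0 : (0 <= pos s)%R by rewrite le_max lexx.
have cv : pairing (Y t w) f @[t --> (pos s)^'+] --> pairing (Y (pos s) w) f.
  exact: (cvg_comp _ _ (rY w (pos s) p0) (continuous_pairing f Cf (Y (pos s) w))).
move/cvg_at_rightP : cv; apply; split.
  move=> n; rewrite /tn ltr_pdivlMr// mulrC.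
  exact: truncnS_gt.
apply: (@squeeze_cvgr _ _ _ _ (cst (pos s)) (fun n => pos s + n.+1%:R^-1)%R).
- apply: nearW => n; apply/andP; split.
    by rewrite /= /tn ler_pdivlMr// mulrC ltW//; exact: truncnS_gt.
  rewrite /tn ler_pdivrMr// mulrDl mulVf// -natr1 lerD2r mulrC.
  by have /andP[] := truncn_itv (mulr_ge0 (ler0n R n.+1) p0).
- exact: cvg_cst.
- rewrite -[X in _ --> X]addr0; apply: cvgD; first exact: cvg_cst.
  exact: cvg_harmonic.
Qed.

End measurable_process.

(** * Occupation of a particle and of its lineage *)

Section life_career.
Context {R : realType}.
Local Notation mu := (@lebesgue_measure R).
Local Open Scope ereal_scope.

Lemma ge0_integral_reflect (f : R -> \bar R) (t : R) :
  measurable_fun setT f -> (forall x, 0 <= f x) ->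
  \int[mu]_s f (t - s)%R = \int[mu]_s f s.
Proof.
move=> mf f0.
have mN : measurable_fun setT (fun x : measurableTypeR R => (- x)%R : measurableTypeR R).
  exact: oppr_measurable.
have mg : measurable_fun setT (fun x : R => f (t + x)%R).
  by apply: (measurableT_comp mf); exact: measurable_funD.
transitivity (\int[mu]_s f (t + s)%R).
  have := @ge0_integral_pushforward _ _ _ _ _ _ mN mu setT _ measurableT mg
   (fun y _ => f0 _).
  rewrite preimage_setT => <-.
  by apply: eq_measure_integral => A mA _; exact: lebesgue_measureN.
rewrite -(ge0_integral_shift f (- t)%R)//; apply: eq_integral => s _.
by rewrite opprK addrC.
Qed.

(** A particle started at [x] has residual life [x - s] at time [s]. Births at
    time 0 are excluded, in accordance with integrals over [(0, t]]. *)
Definition kernel_of (b : R -> R) (x s : R) : \bar R :=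
  if (0 < s)%R then (b (x - s))%:E else 0.

Definition source_of (f : R -> R) (x t : R) : \bar R :=
  if (0 <= t)%R then (ext0 f (x - t))%:E else 0.

Lemma measurable_kernel_of b : measurable_fun setT b ->
  measurable_fun setT (fun z : R * R => kernel_of b z.1 z.2).
Proof.
move=> mb; apply: measurable_fun_ifT => //; first exact: measurable_fun_ltr.
apply/measurable_EFinP; apply: (measurableT_comp mb); exact: measurable_funB.
Qed.

Lemma measurable_source_of f : measurable_fun setT (ext0 f) ->
  measurable_fun setT (fun z : R * R => source_of f z.1 z.2).
Proof.
move=> mb; apply: measurable_fun_ifT => //; first exact: measurable_fun_ler.
apply/measurable_EFinP; apply: (measurableT_comp mb); exact: measurable_funB.
Qed.

Lemma kernel_of_ge0 b x s : (forall y, (0 <= b y)%R) -> 0 <= kernel_of b x s.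
Proof. by move=> b0; rewrite /kernel_of; case: ifP => // _; rewrite lee_fin. Qed.

Lemma kernel_of_le0 b x s : (s <= 0)%R -> kernel_of b x s = 0.
Proof. by move=> s0; rewrite /kernel_of ltNge s0. Qed.

Lemma source_of_ge0 f x t : nonneg_on_pos f -> 0 <= source_of f x t.
Proof.
by move=> f0; rewrite /source_of; case: ifP => // _; rewrite lee_fin ext0_ge0.
Qed.

Lemma source_ofZ (c : R) f x t :
  source_of (fun y => c * f y)%R x t = c%:E * source_of f x t.
Proof.
rewrite /source_of; case: ifP => _; last by rewrite mule0.
rewrite -EFinM; congr (_%:E); have [h|h] := ltP 0%R (x - t)%R.
  by rewrite !(ext0_pos _ (x - t))%R.
by rewrite !(ext0_le0 _ (x - t))%R// mulr0.
Qed.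

(** The integrand vanishes outside [0, x]: a particle lives for a time [x]. *)
Lemma integral_le_linear (k : R -> \bar R) (C x : R) : (0 <= C)%R ->
  (forall s, 0 <= k s <= C%:E) ->
  (forall s, (s < 0)%R || (x <= s)%R -> k s = 0) ->
  \int[mu]_s k s <= (C * `|x|)%:E.
Proof.
move=> C0 kC ks.
have sub s : k s <= ((cst C%:E) \_ (`[0%R, x]%classic : set (measurableTypeR R))) s.
  rewrite patchE mem_setE in_itv/=; case: ifP; first by case/andP: (kC s).
  move/negbT; rewrite negb_and -!ltNge => h; rewrite ks//.
  by case/orP: h => [->//|/ltW ->]; rewrite orbT.
apply: (@le_trans _ _ (\int[mu]_s ((cst C%:E) \_ (`[0%R, x]%classic : set (measurableTypeR R))) s)).
  by apply: ge0_le_integral_nomeas => s _; [case/andP: (kC s)|exact: sub].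
rewrite -integral_mkcond integral_cst//= lebesgue_measure_itv/= lte_fin.
case: ifPn => [x0|_]; last by rewrite mule0 lee_fin mulr_ge0.
by rewrite oppr0 adde0 -EFinM lee_fin ler_wpM2l// ler_norm.
Qed.

Section with_rates.
Variables (G : probability (measurableTypeR R) R).
Hypothesis Gpos : G `]-oo, 0%R]%classic = 0.
Hypothesis G1 : \int[G]_x `|x|%:E < +oo.

Lemma mean_linear_fin (H : R -> \bar R) (C : R) : (0 <= C)%R ->
  measurable_fun setT H ->
  (forall x, 0 <= H x <= (C * `|x|)%:E) -> exists2 m : R, (0 <= m)%R & \int[G]_x H x = m%:E.
Proof.
move=> C0 mH HC.
have H0 : 0 <= \int[G]_x H x by apply: integral_ge0 => x _; case/andP: (HC x).
have fH : \int[G]_x H x \is a fin_num.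
  rewrite ge0_fin_numE//; apply: (@le_lt_trans _ _ (\int[G]_x (C%:E * `|x|%:E))).
    by apply: ge0_le_integral_nomeas => x _; case/andP: (HC x).
  rewrite ge0_integralZl//.
  - by rewrite lte_mul_pinfty.
  - by apply/measurable_EFinP; apply: measurableT_comp => //; exact: normr_measurable.
by exists (fine (\int[G]_x H x)); [rewrite fine_ge0|rewrite fineK].
Qed.

End with_rates.
End life_career.

Section occupation_functions.
Context {R : realType}.
Local Notation mu := (@lebesgue_measure R).
Local Open Scope ereal_scope.

Definition own_occupation (f : R -> R) (x : R) : \bar R :=
  \int[mu]_t source_of f x t.

Definition mean_offspring (b : R -> R) (x : R) : \bar R :=
  \int[mu]_s kernel_of b x s.

Lemma own_occupation_ge0 f x : nonneg_on_pos f -> 0 <= own_occupation f x.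
Proof. by move=> f0; apply: integral_ge0 => t _; exact: source_of_ge0. Qed.

Lemma mean_offspring_ge0 (b : R -> R) x : (forall y, (0 <= b y)%R) ->
  0 <= mean_offspring b x.
Proof. by move=> b0; apply: integral_ge0 => t _; exact: kernel_of_ge0. Qed.

Lemma measurable_own_occupation f : nonneg_on_pos f ->
  measurable_fun setT (ext0 f) -> measurable_fun setT (own_occupation f).
Proof.
move=> f0 mf; apply: measurable_total; first exact: measurable_source_of.
by move=> x t; exact: source_of_ge0.
Qed.

Lemma measurable_mean_offspring (b : R -> R) : (forall y, (0 <= b y)%R) ->
  measurable_fun setT b -> measurable_fun setT (mean_offspring b).
Proof.
move=> b0 mb; apply: measurable_total; first exact: measurable_kernel_of.
by move=> x t; exact: kernel_of_ge0.
Qed.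

Lemma own_occupation_bound f (C x : R) : (0 <= C)%R -> nonneg_on_pos f ->
  (forall y, (0 < y)%R -> (f y <= C)%R) ->
  0 <= own_occupation f x <= (C * `|x|)%:E.
Proof.
move=> C0 f0 fC; rewrite integral_ge0/=; last by move=> t _; exact: source_of_ge0.
apply: integral_le_linear => // t.
  rewrite source_of_ge0//= /source_of; case: ifP => _; rewrite lee_fin//.
  by have [y0|y0] := ltP 0%R (x - t)%R; [rewrite ext0_pos// fC|rewrite ext0_le0].
rewrite /source_of => /orP[t0|xt]; first by rewrite leNgt t0.
by case: ifP => // _; rewrite ext0_le0// subr_le0.
Qed.

Lemma own_occupation_linear f : nonneg_on_pos f -> bounded_on_pos f ->
  exists2 C : R, (0 <= C)%R & forall x, 0 <= own_occupation f x <= (C * `|x|)%:E.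
Proof.
move=> f0 [M fM]; have C0 : (0 <= Num.max 0 M)%R by rewrite le_max lexx.
exists (Num.max 0 M)%R => // x; apply: own_occupation_bound => // y y0.
by apply: le_trans (ler_norm _) (le_trans (fM y y0) _); rewrite le_max lexx orbT.
Qed.

Lemma mean_offspring_bound (b : R -> R) (C x : R) : (0 <= C)%R ->
  (forall y, (0 <= b y <= C)%R) -> (forall y, (y <= 0)%R -> b y = 0%R) ->
  0 <= mean_offspring b x <= (C * `|x|)%:E.
Proof.
move=> C0 bC b0; have b_ge0 y : (0 <= b y)%R by case/andP: (bC y).
rewrite integral_ge0/=; last by move=> t _; exact: kernel_of_ge0.
apply: integral_le_linear => // t.
  rewrite kernel_of_ge0//= /kernel_of; case: ifP => _; rewrite lee_fin//.
  by case/andP: (bC (x - t)%R).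
rewrite /kernel_of => /orP[t0|xt]; first by rewrite ltNge ltW.
by case: ifP => // _; rewrite b0// subr_le0.
Qed.

Lemma own_occupationZ (c : R) f x : (0 <= c)%R -> nonneg_on_pos f ->
  measurable_fun setT (ext0 f) ->
  own_occupation (fun y => c * f y)%R x = c%:E * own_occupation f x.
Proof.
move=> c0 f0 mf; rewrite -ge0_integralZl//.
- by apply: eq_integral => t _; exact: source_ofZ.
- exact: measurable_section2 (measurable_source_of f mf).
- by move=> t _; exact: source_of_ge0.
Qed.

(** The sum over generations [F + K (1 + r + r^2 + ...) <G,F>] in closed form,
    where [r] is the mean number of children of a particle distributed as [G]. *)
Definition lineage_occupation (b : R -> R)
    (G : probability (measurableTypeR R) R) (f : R -> R) (x : R) : \bar R :=
  own_occupation f x + mean_offspring b x *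
    ((fine (\int[G]_y own_occupation f y)) /
     (1 - fine (\int[G]_y mean_offspring b y)))%:E.

Lemma own_occupation_le0 (f : R -> R) x : (x <= 0)%R ->
  own_occupation f x = 0.
Proof.
move=> x0; apply: integral0_eq => t _; rewrite /source_of; case: ifP => // t0.
by rewrite ext0_le0// subr_le0 (le_trans x0).
Qed.

Lemma mean_offspring_le0 (b : R -> R) x :
  (forall y, (y <= 0)%R -> b y = 0%R) -> (x <= 0)%R -> mean_offspring b x = 0.
Proof.
move=> b0 x0; apply: integral0_eq => s _; rewrite /kernel_of; case: ifP => // s0.
by rewrite b0// subr_le0 (le_trans x0)// ltW.
Qed.

End occupation_functions.

Lemma ler_div_one_sub {R : realType} (m a c : R) : 0 <= m -> a <= c -> c < 1 ->
  m / (1 - a) <= m / (1 - c).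
Proof.
move=> m0 ac c1; rewrite ler_wpM2l// lef_pV2 ?posrE ?lerD2l ?lerN2//; lra.
Qed.

(** A lower approximation of the birth rate: the chord slope accounts for
    replacing [1 - g(y,z)] by a linear function of [1 - z], and the extra factor
    for replacing [1 - exp(-v)] by [v]. *)
Definition thinned_rate {R : realType} (alpha : R -> R) (p : R -> nat -> R)
  (n : nat) (y : R) : R :=
  (1 - n.+1%:R^-1) * birth_rate_slope alpha p n.+1%:R^-1 y.

Section thinned_rate_lemmas.
Context {R : realType}.
Variables (alpha : R -> R) (p : R -> nat -> R).
Hypotheses (halpha : is_C1plus alpha) (hp : is_offspring_law p).
Local Notation bn := (thinned_rate alpha p).

Lemma one_sub_inv_itv n : 0 <= 1 - n.+1%:R^-1 :> R /\ 1 - n.+1%:R^-1 <= 1 :> R.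
Proof. by have /andP[h1 h2] := @inv_nat_itv R n; split; [rewrite subr_ge0|rewrite gerBl ltW]. Qed.

Lemma thinned_rate_ge0 n y : 0 <= bn n y.
Proof.
have [h1 _] := one_sub_inv_itv n.
by rewrite mulr_ge0// birth_rate_slope_ge0//; exact: inv_nat_itv.
Qed.

Lemma thinned_rate_le0 n y : y <= 0 -> bn n y = 0.
Proof. by move=> y0; rewrite /thinned_rate birth_rate_slope_le0// mulr0. Qed.

Lemma thinned_rateE n y : 0 < y ->
  bn n y = (1 - n.+1%:R^-1) * (alpha y * offspring_slope p n.+1%:R^-1 y).
Proof. by move=> y0; rewrite /thinned_rate /birth_rate_slope ext0_pos. Qed.

Lemma measurable_thinned_rate n : measurable_fun setT (bn n).
Proof.
apply: measurable_funM => //.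
by apply: measurable_birth_rate_slope => //; exact: inv_nat_itv.
Qed.

Lemma thinned_rate_nd y : nondecreasing_seq (bn ^~ y).
Proof.
move=> m n mn; have [h1 _] := one_sub_inv_itv m.
have mn' : n.+1%:R^-1 <= m.+1%:R^-1 :> R by rewrite lef_pV2 ?posrE// ler_nat.
rewrite /thinned_rate ler_pM//.
- by rewrite birth_rate_slope_ge0//; exact: inv_nat_itv.
- by rewrite lerD2l lerN2.
- apply: birth_rate_slope_anti => //; first by rewrite mn' invr_gt0 ltr0Sn.
  by case/andP: (@inv_nat_itv R m).
Qed.

Lemma thinned_rate_cvg y : bn n y @[n --> \oo] --> birth_rate alpha p y.
Proof.
rewrite -[X in _ --> X]mul1r; apply: cvgM; last exact: birth_rate_slope_cvg.
rewrite -[X in _ --> X]subr0; apply: cvgB; first exact: cvg_cst.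
exact: cvg_harmonic.
Qed.

End thinned_rate_lemmas.

Section branching_data.
Context {R : realType}.
Local Notation mu := (@lebesgue_measure R).
Local Open Scope ereal_scope.
Variables (alpha : R -> R) (p : R -> nat -> R).
Hypotheses (halpha : is_C1plus alpha) (hp : is_offspring_law p).
Variable G : probability (measurableTypeR R) R.
Hypothesis Gpos : G `]-oo, 0%R]%classic = 0.
Hypothesis G1 : \int[G]_x `|x|%:E < +oo.
Hypothesis hi : \int[mu]_(s in pos_reals) renewal_density alpha p G s < 1.

Local Notation b := (birth_rate alpha p).
Local Notation bn := (thinned_rate alpha p).

Let b0 y : (0 <= b y)%R. Proof. exact: birth_rate_ge0. Qed.
Let mb : measurable_fun setT b. Proof. exact: measurable_birth_rate. Qed.
Let bn0 n y : (0 <= bn n y)%R. Proof. exact: thinned_rate_ge0. Qed.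
Let mbn n : measurable_fun setT (bn n). Proof. exact: measurable_thinned_rate. Qed.
Let bn_nd y : nondecreasing_seq (bn ^~ y). Proof. exact: thinned_rate_nd. Qed.
Let bn_cvg y : bn n y @[n --> \oo] --> b y. Proof. exact: thinned_rate_cvg. Qed.

Let rateP : exists2 C : R, (0 <= C)%R & forall y, (0 <= b y <= C)%R.
Proof.
have [C C0 bC] := birth_rate_bounded alpha p halpha hp.
by exists C => // y; rewrite b0 bC.
Qed.

Local Opaque birth_rate thinned_rate.

Definition mean_offspring_total := \int[G]_x mean_offspring b x.

(** Tonelli identifies this number with the integral of the renewal density. *)
Lemma mean_offspring_total_lt1 :
  exists2 r : R, (0 <= r < 1)%R & mean_offspring_total = r%:E.
Proof.
have E : mean_offspring_total = \int[mu]_(s in pos_reals) renewal_density alpha p G s.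
  rewrite /mean_offspring_total /mean_offspring.
  transitivity (\int[mu]_s \int[G]_x kernel_of b x s).
    apply: (fubini_tonelli (m1 := G) (m2 := mu) (fun z : R * R => kernel_of b z.1 z.2)).
      exact: measurable_kernel_of.
    by move=> z; exact: kernel_of_ge0.
  rewrite [RHS]integral_mkcond; apply: eq_integral => s _.
  rewrite patchE mem_setE in_itv/= andbT; case: ifPn => s0; last first.
    by rewrite integral0_eq// => x _; rewrite kernel_of_le0// leNgt.
  rewrite /renewal_density [RHS]integral_mkcond; apply: eq_integral => x _.
  rewrite patchE mem_setE in_itv/= andbT /kernel_of s0.
  case: ifPn => sx; first by rewrite birth_rate_pos// subr_gt0.
  by rewrite birth_rate_le0// subr_le0 leNgt.
have r0 : 0 <= mean_offspring_total.
  by apply: integral_ge0 => x _; exact: mean_offspring_ge0.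
have fr : mean_offspring_total \is a fin_num.
  by rewrite ge0_fin_numE// E (lt_trans hi)// ltry.
exists (fine mean_offspring_total); last by rewrite fineK.
rewrite fine_ge0//= -lte_fin fineK// E; exact: hi.
Qed.

Lemma mean_offspring_slope_cvg x :
  mean_offspring (bn n) x @[n --> \oo] --> mean_offspring b x.
Proof.
have -> : mean_offspring b x = \int[mu]_s limn (fun n => kernel_of (bn n) x s).
  apply: eq_integral => s _; apply/esym/cvg_lim => //; rewrite /kernel_of.
  case: ifP => _; last exact: cvg_cst.
  apply: cvg_EFin; first exact: nearW.
  exact: bn_cvg.
apply: cvg_monotone_convergence => //.
- by move=> n; exact: measurable_section2 (measurable_kernel_of _ (mbn n)).
- by move=> n s _; exact: kernel_of_ge0.
- by move=> s _ m n mn; rewrite /kernel_of; case: ifP => // _; rewrite lee_fin bn_nd.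
Qed.

Lemma mean_offspring_slope_nd x : nondecreasing_seq (fun n => mean_offspring (bn n) x).
Proof.
move=> m n mn; apply: ge0_le_integral_nomeas => s _; first exact: kernel_of_ge0.
by rewrite /kernel_of; case: ifP => // _; rewrite lee_fin bn_nd.
Qed.

Lemma mean_offspring_slope_total_cvg :
  \int[G]_x mean_offspring (bn n) x @[n --> \oo] --> mean_offspring_total.
Proof.
rewrite [X in _ --> X](_ : _ = \int[G]_x limn (fun n => mean_offspring (bn n) x)).
  apply: cvg_monotone_convergence => //.
  - by move=> n; exact: measurable_mean_offspring.
  - by move=> n x _; apply: integral_ge0 => s _; exact: kernel_of_ge0.
  - by move=> x _; exact: mean_offspring_slope_nd.
by apply: eq_integral => x _; apply/esym/cvg_lim => //; exact: mean_offspring_slope_cvg.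
Qed.

Let bn_le n y : (bn n y <= b y)%R.
Proof.
rewrite -(cvg_lim _ (bn_cvg y))//; apply: nondecreasing_cvgn_le; first exact: bn_nd.
exact: cvgP (bn_cvg y).
Qed.

Local Notation rn n := (fine (\int[G]_y mean_offspring (bn n) y)).

Lemma thinned_totalE n : \int[G]_y mean_offspring (bn n) y = (rn n)%:E.
Proof.
have [r r01 rE] := mean_offspring_total_lt1.
rewrite fineK// ge0_fin_numE; last first.
  by apply: integral_ge0 => y _; exact: mean_offspring_ge0.
apply: (@le_lt_trans _ _ mean_offspring_total); last by rewrite rE ltry.
apply: ge0_le_integral_nomeas => y _.
  exact: mean_offspring_ge0.
apply: ge0_le_integral_nomeas => s _; first exact: kernel_of_ge0.
by rewrite /kernel_of; case: ifP => // _; rewrite lee_fin.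
Qed.

Let rn_nd : nondecreasing_seq (fun n => rn n).
Proof.
move=> m n mn.
have : \int[G]_y mean_offspring (bn m) y <= \int[G]_y mean_offspring (bn n) y.
  apply: ge0_le_integral_nomeas => y _; first exact: mean_offspring_ge0.
  exact: mean_offspring_slope_nd.
by rewrite (thinned_totalE m) (thinned_totalE n) lee_fin.
Qed.

Let rn_cvg : rn n @[n --> \oo] --> fine mean_offspring_total.
Proof.
have [r r01 rE] := mean_offspring_total_lt1.
have := mean_offspring_slope_total_cvg; rewrite rE => h.
by have /fine_cvgP[_] := h.
Qed.

Lemma slope_total_lt1 n : (0 <= rn n < 1)%R.
Proof.
have [r r01 rE] := mean_offspring_total_lt1.
rewrite -lee_fin -thinned_totalE integral_ge0/=; last first.
  by move=> y _; exact: mean_offspring_ge0.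
apply: (@le_lt_trans _ _ r); last by case/andP: r01.
have := nondecreasing_cvgn_le rn_nd (cvgP _ rn_cvg) n.
by rewrite (cvg_lim _ rn_cvg)// rE.
Qed.

Section occupied.
Variable f : R -> R.
Hypotheses (f0 : nonneg_on_pos f) (fB : bounded_on_pos f)
  (mf : measurable_fun setT (ext0 f)).

Lemma own_occupation_total :
  exists2 m : R, (0 <= m)%R & \int[G]_x own_occupation f x = m%:E.
Proof.
have [C C0 hC] := own_occupation_linear f f0 fB.
by apply: (mean_linear_fin G G1 _ C C0) => //; exact: measurable_own_occupation.
Qed.

Lemma lineage_occupation_bound : exists2 C : R, (0 <= C)%R &
  forall x, 0 <= lineage_occupation b G f x <= (C * `|x|)%:E.
Proof.
have [C C0 hC] := own_occupation_linear f f0 fB.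
have [C' C'0 bC'] := rateP.
have [m m0 mE] := own_occupation_total.
have [r r01 rE] := mean_offspring_total_lt1.
rewrite /lineage_occupation mE -/mean_offspring_total rE/=.
have c0 : (0 <= m / (1 - r))%R by rewrite divr_ge0//; lra.
exists (C + C' * (m / (1 - r)))%R; first by rewrite addr_ge0// mulr_ge0.
move=> x.
have /andP[F0 FC] := hC x.
have /andP[K0 KC] : 0 <= mean_offspring b x <= (C' * `|x|)%:E.
  by apply: mean_offspring_bound => // y y0; exact: birth_rate_le0.
apply/andP; split; first by rewrite adde_ge0// mule_ge0// lee_fin.
rewrite mulrDl EFinD leeD// -mulrA (mulrC (m / _)%R) mulrA [leRHS]EFinM.
by rewrite lee_wpmul2r// lee_fin.
Qed.

Lemma lineage_occupation_slope_ge0 n x : 0 <= lineage_occupation (bn n) G f x.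
Proof.
have [m m0 mE] := own_occupation_total.
rewrite /lineage_occupation mE (thinned_totalE n)/= adde_ge0//; first exact: own_occupation_ge0.
rewrite mule_ge0//; first exact: mean_offspring_ge0.
rewrite lee_fin; apply: (divr_ge0 m0); rewrite subr_ge0.
by case/andP: (slope_total_lt1 n) => _ /ltW.
Qed.

Lemma lineage_occupation_slope_nd x :
  nondecreasing_seq (fun n => lineage_occupation (bn n) G f x).
Proof.
move=> n k nk; have [m m0 mE] := own_occupation_total.
have h := slope_total_lt1 n; have h' := slope_total_lt1 k.
rewrite /lineage_occupation mE (thinned_totalE n) (thinned_totalE k)/=; apply: leeD2l; apply: lee_pmul.
- exact: mean_offspring_ge0.
- rewrite lee_fin; apply: (divr_ge0 m0); rewrite subr_ge0.
  by case/andP: h => _ /ltW.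
- exact: mean_offspring_slope_nd.
- rewrite lee_fin; apply: (ler_div_one_sub m _ _ m0 (rn_nd n k nk)).
  by case/andP: h'.
Qed.

(** Monotone convergence in the numerator and in the geometric factor. *)
Lemma lineage_occupation_slope_cvg x :
  lineage_occupation (bn n) G f x @[n --> \oo] --> lineage_occupation b G f x.
Proof.
have [m m0 mE] := own_occupation_total.
have [r r01 rE] := mean_offspring_total_lt1.
rewrite /lineage_occupation mE/=.
have cst_cvg : (m / (1 - rn n))%:E @[n --> \oo] --> (m / (1 - r))%:E.
  apply: cvg_EFin; first exact: nearW.
  apply: cvgMr; apply: cvgV; first by lra.
  apply: cvgB; first exact: cvg_cst.
  by have := rn_cvg; rewrite rE.
have [C' C'0 bC'] := rateP.
have /andP[K0 KC] : 0 <= mean_offspring b x <= (C' * `|x|)%:E.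
  by apply: mean_offspring_bound => // y y0; exact: birth_rate_le0.
have fK : mean_offspring b x \is a fin_num.
  by rewrite ge0_fin_numE// (le_lt_trans KC)// ltry.
have fF : own_occupation f x \is a fin_num.
  have [C C0 hC] := own_occupation_linear f f0 fB; have /andP[F0 FC] := hC x.
  by rewrite ge0_fin_numE// (le_lt_trans FC)// ltry.
rewrite -/mean_offspring_total rE/=; apply: cvgeD.
- by rewrite fin_num_adde_defr.
- exact: cvg_cst.
- apply: cvgeM => //; last exact: mean_offspring_slope_cvg.
  by rewrite mule_def_fin.
Qed.

Lemma measurable_lineage_occupation (a : R -> R) : (forall y, (0 <= a y)%R) ->
  measurable_fun setT a -> measurable_fun setT (lineage_occupation a G f).
Proof.
move=> a0 ma; apply: emeasurable_funD; first exact: measurable_own_occupation.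
apply: emeasurable_funM => //; exact: measurable_mean_offspring.
Qed.

End occupied.
End branching_data.

(** * Bounds on cumulants *)

Section one_minus_exp.
Context {R : realType}.
Implicit Types y : R.

Lemma one_sub_expRN_le y : 1 - expR (- y) <= y.
Proof. by have := expR_ge1Dx (- y); lra. Qed.

Lemma one_sub_expRN_ge0 y : 0 <= y -> 0 <= 1 - expR (- y).
Proof. by move=> y0; rewrite subr_ge0 -expR0 ler_expR oppr_le0. Qed.

(** From [exp(-y) <= 1 / (1 + y)]. *)
Lemma one_sub_expRN_ge y : 0 <= y -> (1 - y) * y <= 1 - expR (- y).
Proof.
move=> y0; have h1 : 1 + y <= expR y by exact: expR_ge1Dx.
have y1 : 0 < 1 + y by lra.
have h2 : expR (- y) <= (1 + y)^-1 by rewrite expRN lef_pV2 ?posrE ?expR_gt0.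
have h3 : (1 - y) * (1 + y) * (1 + y)^-1 = 1 - y by rewrite mulfK// gt_eqF.
have h4 : (1 + y) * (1 + y)^-1 = 1 by rewrite mulfV// gt_eqF.
have h5 : 0 <= (1 + y)^-1 by rewrite invr_ge0 ltW.
have h6 : 0 <= (1 + y)^-1 * y ^+ 3 by rewrite mulr_ge0// exprn_ge0.
move: h2 h3 h4 h6; set e := expR (- y); set i := (1 + y)^-1 => h2 h3 h4 h6.
have : (1 - y) * y + i <= 1; last by lra.
have : i = 1 - y + y ^+ 2 * i by nra.
nra.
Qed.

End one_minus_exp.

Section one_cumulant.
Context {R : realType}.
Local Notation mu := (@lebesgue_measure R).
Local Open Scope ereal_scope.
Variables (alpha : R -> R) (p : R -> nat -> R).
Hypotheses (halpha : is_C1plus alpha) (hp : is_offspring_law p).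
Variable G : probability (measurableTypeR R) R.
Hypothesis Gpos : G `]-oo, 0%R]%classic = 0.
Hypothesis G1 : \int[G]_x `|x|%:E < +oo.
Hypothesis hi : \int[mu]_(s in pos_reals) renewal_density alpha p G s < 1.
Local Notation b := (birth_rate alpha p).
Local Notation bn := (thinned_rate alpha p).

(** A solution extended by 0 to negative times and negative positions, so that
    convolutions can be written over the whole line. *)
Definition clip (u : R -> R -> R) (t x : R) : R :=
  if (0 <= t)%R && (0 < x)%R then u t x else 0%R.

Lemma clipE u t x : (0 <= t)%R -> (0 < x)%R -> clip u t x = u t x.
Proof. by rewrite /clip => -> ->. Qed.

Lemma clip_lt0 u t x : (t < 0)%R -> clip u t x = 0%R.
Proof. by rewrite /clip ltNge => /negbTE ->. Qed.

Lemma clip_le0 u t x : (x <= 0)%R -> clip u t x = 0%R.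
Proof. by rewrite /clip leNgt => /negbTE ->; rewrite andbF. Qed.

Lemma measurable_clip u : locally_bounded u ->
  measurable_fun setT (fun z : R * R => clip u z.1 z.2).
Proof.
case=> mu' _.
have mD : measurable (([set` `[0%R, +oo[] `*` pos_reals) : set (R * R)).
  by apply: measurableX; exact: measurable_itv.
move/(measurable_restrictT _ mD): mu'; congr measurable_fun.
apply/funext => -[t x]; rewrite patchE /clip/=.
rewrite (_ : ((t, x) \in _) = (0 <= t)%R && (0 < x)%R)//.
by rewrite in_setX/= !mem_setE !in_itv/= !andbT.
Qed.

Variable u : R -> R -> R.
Hypothesis ulb : locally_bounded u.
Hypothesis u0 : forall t, (0 <= t)%R -> nonneg_on_pos (u t).

Local Notation v := (clip u).
Local Notation vE := (fun t x : R => (clip u t x)%:E).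

Let v0 t x : (0 <= v t x)%R.
Proof.
have [t0|t0] := ltP t 0%R; first by rewrite clip_lt0.
have [x0|x0] := ltP 0%R x; last by rewrite clip_le0.
by rewrite clipE// u0.
Qed.

Let mv : measurable_fun setT (fun z : R * R => v z.1 z.2).
Proof. exact: measurable_clip. Qed.

Let mvt t : measurable_fun setT (v t).
Proof. exact: (measurableT_comp mv (measurable_pair1 t)). Qed.

Local Notation z t := (mean_G G (fun y => expR (- u t y))).

Let zE t : (0 <= t)%R -> (1 - z t)%:E = \int[G]_x (1 - expR (- v t x))%:E.
Proof.
move=> t0.
have me : measurable_fun setT (fun x => expR (- v t x)).
  by apply: measurableT_comp => //; exact: measurableT_comp.
have I1 : \int[G]_x (expR (- v t x))%:E + \int[G]_x (1 - expR (- v t x))%:E = 1.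
  rewrite -ge0_integralD//.
  - under eq_integral do rewrite -EFinD addrC subrK.
    exact: (integral_probability_cst _ _ G).
  - exact/measurable_EFinP.
  - by move=> x _; rewrite lee_fin one_sub_expRN_ge0.
  - by apply/measurable_EFinP; apply: measurable_funB.
have I0 : 0 <= \int[G]_x (1 - expR (- v t x))%:E.
  by apply: integral_ge0 => x _; rewrite lee_fin one_sub_expRN_ge0.
have J0 : 0 <= \int[G]_x (expR (- v t x))%:E.
  by apply: integral_ge0 => x _; rewrite lee_fin expR_ge0.
have EI : \int[G]_(x in pos_reals) (expR (- u t x))%:E = \int[G]_x (expR (- v t x))%:E.
  rewrite -(integral_supported_pos G (fun x => (expR (- v t x))%:E) Gpos).
  - by apply: eq_integral => x; rewrite inE /pos_reals/= in_itv/= andbT => x0; rewrite clipE.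
  - exact/measurable_EFinP.
  - by move=> x; rewrite lee_fin expR_ge0.
have J1 : \int[G]_x (expR (- v t x))%:E <= 1 by rewrite -[leRHS]I1; apply: leeDl.
have zJ : (z t)%:E = \int[G]_x (expR (- v t x))%:E.
  rewrite /mean_G /Rintegral EI fineK// ge0_fin_numE//.
  by apply: le_lt_trans J1 _; rewrite ltry.
rewrite EFinB zJ -[X in X - _]I1 addeC addeK// -zJ//.
Qed.

Let z01 t : (0 <= t)%R -> (0 <= z t <= 1)%R.
Proof.
move=> t0; have h := zE t t0.
have h1 : (0 <= 1 - z t)%R.
  rewrite -lee_fin h; apply: integral_ge0 => x _.
  by rewrite lee_fin one_sub_expRN_ge0.
have h2 : (1 - z t <= 1)%R.
  rewrite -lee_fin h; apply: (@le_trans _ _ (\int[G]_x (cst 1%:E x))).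
    apply: ge0_le_integral_nomeas => x _; rewrite lee_fin; first exact: one_sub_expRN_ge0.
    by rewrite /= gerBl expR_ge0.
  by rewrite (integral_probability_cst _ _ G).
by move: h1 h2; rewrite subr_ge0 gerBl => -> ->.
Qed.

Let one_sub_z_le t : (0 <= t)%R -> (1 - z t)%:E <= mean_of G vE t.
Proof.
move=> t0; rewrite zE//; apply: ge0_le_integral_nomeas => x _; rewrite lee_fin.
  exact: one_sub_expRN_ge0.
exact: one_sub_expRN_le.
Qed.

Let one_sub_z_ge (d t : R) : (0 <= t)%R -> (forall x, (v t x <= d)%R) -> (d <= 1)%R ->
  (1 - d)%:E * mean_of G vE t <= (1 - z t)%:E.
Proof.
move=> t0 vd d1; rewrite zE// /mean_of -ge0_integralZl_EFin//.
- apply: ge0_le_integral_nomeas => x _.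
    by rewrite -EFinM lee_fin mulr_ge0// subr_ge0.
  rewrite -EFinM lee_fin; apply: le_trans (one_sub_expRN_ge _ (v0 t x)).
  by rewrite ler_wpM2r// lerD2l lerN2.
- by move=> x _; rewrite lee_fin.
- by apply/measurable_EFinP; exact: mvt.
- by rewrite subr_ge0.
Qed.

Let mean_of0 t : (t < 0)%R -> mean_of G vE t = 0.
Proof. by move=> t0; rewrite /mean_of integral0_eq// => x _; rewrite clip_lt0. Qed.

Let vE0 t x : 0 <= vE t x. Proof. by rewrite lee_fin. Qed.

Let b0 y : (0 <= b y)%R. Proof. exact: birth_rate_ge0. Qed.

Let bn0 n y : (0 <= bn n y)%R. Proof. exact: thinned_rate_ge0. Qed.

Local Opaque birth_rate thinned_rate.

Section equation.
Variables (f : R -> R) (la : R).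
Hypotheses (f0 : nonneg_on_pos f) (fB : bounded_on_pos f)
  (mf : measurable_fun setT (ext0 f)) (la0 : (0 <= la)%R).
Hypothesis ueq : forall t x, (0 <= t)%R -> (0 < x)%R ->
  (u t x = ext0 (fun y => la * f y) (x - t) +
    \int[lebesgue_measure]_(s in `]0, t])
      (ext0 alpha (x - s) * (1 - gen_fun p (x - s)
        (mean_G G (fun y => expR (- u (t - s) y))))))%R.

Local Notation src := (source_of (fun y => la * f y)%R).

Let laf0 : nonneg_on_pos (fun y => la * f y)%R.
Proof. by move=> y y0; rewrite mulr_ge0// f0. Qed.

Let birth (t x s : R) : R :=
  (ext0 alpha (x - s) * (1 - gen_fun p (x - s) (z (t - s))))%R.

Let birth_ge0 t x s : (s <= t)%R -> (0 <= birth t x s)%R.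
Proof.
move=> st; rewrite /birth; have [y0|y0] := ltP 0%R (x - s)%R; last by rewrite ext0_le0// mul0r.
rewrite mulr_ge0//; first by apply: ext0_ge0; case: halpha.
by apply: (one_sub_gen_fun_ge0 p) => //; apply: z01; rewrite subr_ge0.
Qed.

Let birth_le t x s : (s <= t)%R -> (birth t x s <= b (x - s) * (1 - z (t - s)))%R.
Proof.
move=> st; rewrite /birth; have [y0|y0] := ltP 0%R (x - s)%R; last first.
  by rewrite ext0_le0// mul0r birth_rate_le0// mul0r.
rewrite birth_rate_pos// ext0_pos// -mulrA ler_wpM2l//; first by case: halpha => _; apply.
by apply: (one_sub_gen_fun_le p) => //; apply: z01; rewrite subr_ge0.
Qed.

Let integral_birth_ge0 t x : 0 <= \int[mu]_(s in `]0%R, t]) (birth t x s)%:E.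
Proof.
apply: integral_ge0 => s /=; rewrite in_itv/= => /andP[_ st].
by rewrite lee_fin birth_ge0.
Qed.

Let convolution_ge0 (a : R -> R) x t : (forall y, (0 <= a y)%R) ->
  0 <= \int[mu]_s (kernel_of a x s * mean_of G vE (t - s)).
Proof.
move=> a0; apply: integral_ge0 => s _; apply: mule_ge0; first exact: kernel_of_ge0.
exact: mean_of_ge0.
Qed.

Let forcing_ge0 x t : 0 <= forcing G (kernel_of b) src vE x t.
Proof.
by apply: adde_ge0; [exact: source_of_ge0|exact: convolution_ge0].
Qed.

(** Linearisation from above of both nonlinearities of the cumulant equation. *)
Lemma clip_le_forcing x t : vE t x <= forcing G (kernel_of b) src vE x t.
Proof.
have [t0|t0] := ltP t 0%R; first by rewrite clip_lt0.
have [x0|x0] := ltP 0%R x; last by rewrite clip_le0.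
rewrite clipE// ueq// EFinD /forcing /source_of t0; apply: leeD2l.
apply: (@le_trans _ _ (\int[mu]_(s in `]0%R, t]) (birth t x s)%:E)).
  rewrite /Rintegral -[leLHS]/(fine _)%:E.
  have := integral_birth_ge0 t x; by case: (\int[mu]_(s in _) _) => [r||].
rewrite integral_mkcond; apply: ge0_le_integral_nomeas => s _.
  rewrite patchE mem_setE in_itv/=; case: ifP => // /andP[_ st].
  by rewrite lee_fin birth_ge0.
rewrite patchE mem_setE in_itv/=; case: ifP => [/andP[s0 st]|_]; last first.
  by apply: mule_ge0; [exact: kernel_of_ge0|exact: mean_of_ge0].
rewrite /kernel_of s0; apply: (@le_trans _ _ ((b (x - s))%:E * (1 - z (t - s))%:E)).
  by rewrite -EFinM lee_fin; exact: birth_le.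
apply: lee_wpmul2l; first by rewrite lee_fin; exact: b0.
by apply: one_sub_z_le; rewrite subr_ge0.
Qed.

(** When the solution is below [1 / (n + 1)], so is [1 - <G, exp(-u)>], and the
    chord slope at that scale is a lower bound in the linearisation. *)
Lemma forcing_le_clip n : (forall t x, (v t x <= n.+1%:R^-1)%R) ->
  forall x t, forcing G (kernel_of (bn n)) src vE x t <= vE t x.
Proof.
move=> vn x t; have /andP[d0 d1] := @inv_nat_itv R n.
have [t0|t0] := ltP t 0%R.
  rewrite clip_lt0// /forcing /source_of (lt_geF t0) add0e integral0_eq// => s _.
  have [s0|s0] := leP s 0%R; first by rewrite kernel_of_le0// mul0e.
  by rewrite mean_of0 ?mule0// subr_lt0 (lt_trans t0).
have [x0|x0] := ltP 0%R x; last first.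
  rewrite clip_le0// /forcing /source_of t0 ext0_le0; last by rewrite subr_le0 (le_trans x0).
  rewrite add0e integral0_eq// => s _.
  have [s0|s0] := leP s 0%R; first by rewrite kernel_of_le0// mul0e.
  by rewrite /kernel_of s0 thinned_rate_le0 ?mul0e// subr_le0 (le_trans x0)// ltW.
rewrite clipE// ueq// EFinD /forcing /source_of t0; apply: leeD2l.
have [C C0 bC] := birth_rate_bounded alpha p halpha hp.
have Ifin : \int[mu]_(s in `]0%R, t]) (birth t x s)%:E \is a fin_num.
  rewrite ge0_fin_numE//.
  apply: (@le_lt_trans _ _ (\int[mu]_(s in `]0%R, t]) (cst C%:E s))).
    apply: ge0_le_integral_nomeas => s /=; rewrite in_itv/= => /andP[s0 st].
      by rewrite lee_fin birth_ge0.
    rewrite lee_fin; apply: le_trans (birth_le t x s st) _.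
    rewrite -[leRHS]mulr1 ler_pM//.
      by rewrite subr_ge0; case/andP: (z01 (t - s)%R (etrans (subr_ge0 _ _) st)).
    by rewrite gerBl; case/andP: (z01 (t - s)%R (etrans (subr_ge0 _ _) st)).
  rewrite integral_cst//= lebesgue_measure_itv/=; case: ifP => _.
    by rewrite -EFinB -EFinM ltry.
  by rewrite mule0 ltry.
rewrite /Rintegral fineK//.
rewrite [leRHS]integral_mkcond; apply: ge0_le_integral_nomeas => s _.
  by apply: mule_ge0; [exact: kernel_of_ge0|exact: mean_of_ge0].
rewrite patchE mem_setE in_itv/=.
have [s0|s0] := ltP 0%R s; last by rewrite kernel_of_le0// mul0e.
have [st|st] /= := leP s t; last by rewrite mean_of0 ?mule0// subr_lt0.
rewrite /kernel_of s0; have [y0|y0] := ltP 0%R (x - s)%R; last first.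
  by rewrite thinned_rate_le0// mul0e lee_fin -/(birth t x s) birth_ge0.
have ts0 : (0 <= t - s)%R by rewrite subr_ge0.
have zts := one_sub_z_ge n.+1%:R^-1 (t - s)%R ts0 (vn (t - s)%R) d1.
rewrite thinned_rateE// mulrC EFinM -muleA.
apply: (@le_trans _ _ ((alpha (x - s) * offspring_slope p n.+1%:R^-1 (x - s))%:E *
   (1 - z (t - s))%:E)).
  apply: lee_wpmul2l => //; rewrite lee_fin mulr_ge0//.
    by case: halpha => _; apply.
  by apply: offspring_slope_ge0 => //; rewrite d0.
rewrite -EFinM lee_fin ext0_pos// -mulrA ler_wpM2l//; first by case: halpha => _; apply.
apply: one_sub_gen_fun_ge => //; first by rewrite d0.
have /andP[_ ->] := z01 _ ts0; rewrite andbT.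
suff : (1 - z (t - s) <= n.+1%:R^-1)%R by rewrite lerBlDr lerBlDl addrC.
rewrite -lee_fin zE//; apply: (@le_trans _ _ (\int[G]_x (n.+1%:R^-1%:E * cst 1%:E x))).
  apply: ge0_le_integral_nomeas => y _; rewrite ?mule1 lee_fin ?one_sub_expRN_ge0//.
  by apply: le_trans (vn (t - s)%R y); exact: one_sub_expRN_le.
by rewrite ge0_integralZl_EFin// ?(integral_probability_cst _ _ G) ?mule1// ltW.
Qed.

End equation.
End one_cumulant.

Section cumulant_bounds.
Context {R : realType}.
Local Notation mu := (@lebesgue_measure R).
Local Open Scope ereal_scope.
Variables (alpha : R -> R) (p : R -> nat -> R).
Hypotheses (halpha : is_C1plus alpha) (hp : is_offspring_law p).
Variable G : probability (measurableTypeR R) R.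
Hypothesis Gpos : G `]-oo, 0%R]%classic = 0.
Hypothesis G1 : \int[G]_x `|x|%:E < +oo.
Hypothesis hi : \int[mu]_(s in pos_reals) renewal_density alpha p G s < 1.
Local Notation b := (birth_rate alpha p).
Local Notation bn := (thinned_rate alpha p).
Variables (f : R -> R).
Hypotheses (f0 : nonneg_on_pos f) (fB : bounded_on_pos f)
  (mf : measurable_fun setT (ext0 f)).

Let b0 y : (0 <= b y)%R. Proof. exact: birth_rate_ge0. Qed.
Let bn0 n y : (0 <= bn n y)%R. Proof. exact: thinned_rate_ge0. Qed.
Let mb : measurable_fun setT b. Proof. exact: measurable_birth_rate. Qed.
Let mbn n : measurable_fun setT (bn n). Proof. exact: measurable_thinned_rate. Qed.

Local Opaque birth_rate thinned_rate.

Section scaled.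
Variables (la : R) (u : R -> R -> R).
Hypothesis la0 : (0 <= la)%R.
Hypothesis hu : is_cumulant alpha p G (fun y => la * f y)%R u.

Local Notation src := (source_of (fun y => la * f y)%R).
Local Notation vE := (fun t x : R => (clip u t x)%:E).

Let ulb : locally_bounded u. Proof. by case: hu. Qed.
Let u0 t : (0 <= t)%R -> nonneg_on_pos (u t). Proof. by case: hu => _ + _; apply. Qed.

Lemma clip_ge0 t x : (0 <= clip u t x)%R.
Proof.
have [t0|t0] := ltP t 0%R; first by rewrite clip_lt0.
have [x0|x0] := ltP 0%R x; last by rewrite clip_le0.
by rewrite clipE// u0.
Qed.

Let vE0 t x : 0 <= vE t x. Proof. by rewrite lee_fin clip_ge0. Qed.

Let mvE : measurable_fun setT (fun z : R * R => vE z.1 z.2).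
Proof. by apply/measurable_EFinP; exact: measurable_clip. Qed.

Let laf0 : nonneg_on_pos (fun y => la * f y)%R.
Proof. by move=> y y0; rewrite mulr_ge0// f0. Qed.

Let mlaf : measurable_fun setT (ext0 (fun y => la * f y)%R).
Proof.
rewrite (_ : ext0 _ = (cst la \* ext0 f)%R); first exact: measurable_funM.
apply/funext => y /=; have [y0|y0] := ltP 0%R y.
  by rewrite !(ext0_pos _ y).
by rewrite !(ext0_le0 _ y)// mulr0.
Qed.

Let vle := clip_le_forcing alpha p halpha hp G Gpos u ulb u0 f la f0 la0
  (let: And3 _ _ h := hu in h).

Let mk := measurable_kernel_of b mb.
Let ms := measurable_source_of (fun y => la * f y)%R mlaf.
Let k0 x s : 0 <= kernel_of b x s. Proof. exact: kernel_of_ge0. Qed.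
Let s0 x t : 0 <= src x t. Proof. exact: source_of_ge0. Qed.

Let source_total x : \int[mu]_t src x t = la%:E * own_occupation f x.
Proof. exact: own_occupationZ. Qed.

Let source_mean : \int[G]_x \int[mu]_t src x t =
  (la * fine (\int[G]_x own_occupation f x))%:E.
Proof.
have [m m0 mE] := own_occupation_total G G1 f f0 fB mf.
under eq_integral do rewrite source_total.
rewrite ge0_integralZl_EFin//; first by rewrite mE.
  by move=> x _; exact: own_occupation_ge0.
exact: measurable_own_occupation.
Qed.

Lemma integral_mean_clip_le : \int[mu]_t mean_of G vE t <=
  la%:E * ((fine (\int[G]_x own_occupation f x)) /
    (1 - fine (\int[G]_x mean_offspring b x)))%:E.
Proof.
have [r r01 rE] := mean_offspring_total_lt1 alpha p halpha hp G hi.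
rewrite -EFinM mulrA; apply: (renewal_mean_le G _ _ vE mk ms mvE k0 s0 vE0).
- by move=> x s; exact: kernel_of_le0.
- by move=> t x t0; rewrite clip_lt0.
- move=> T; case: ulb => _ /(_ T)[C hC]; exists (Num.max 0 C)%R => t x tT.
  rewrite lee_fin le_max; have [t0|t0] := ltP t 0%R; first by rewrite clip_lt0// lexx.
  have [x0|x0] := ltP 0%R x; last by rewrite clip_le0// lexx.
  by rewrite clipE// (le_trans (ler_norm _) (hC t x _ x0)) ?orbT// t0.
- exact: source_mean.
- by rewrite fineK// -/(mean_offspring_total alpha p G) rE.
- by rewrite -/(mean_offspring_total alpha p G) rE; case/andP: r01.
- exact: vle.
Qed.

Lemma total_clip_le x :
  \int[mu]_t (clip u t x)%:E <= la%:E * lineage_occupation b G f x.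
Proof.
have [+ _] := total_le_forcing G _ _ vE mk ms mvE k0 s0 vE0 vle.
move=> /(_ x) /le_trans; apply; rewrite source_total /lineage_occupation.
have [m m0 mE] := own_occupation_total G G1 f f0 fB mf.
have [r r01 rE] := mean_offspring_total_lt1 alpha p halpha hp G hi.
rewrite [leRHS]ge0_muleDr; first last.
- apply: mule_ge0; first exact: mean_offspring_ge0.
  rewrite mE -/(mean_offspring_total alpha p G) rE lee_fin divr_ge0//= subr_ge0.
  by case/andP: r01 => _ /ltW.
- exact: own_occupation_ge0.
apply: leeD2l; rewrite muleCA; apply: lee_wpmul2l; first exact: mean_offspring_ge0.
exact: integral_mean_clip_le.
Qed.

Lemma total_clip_ge n x : (forall t x, (clip u t x <= n.+1%:R^-1)%R) ->
  la%:E * lineage_occupation (bn n) G f x <= \int[mu]_t (clip u t x)%:E.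
Proof.
move=> vn.
have vge := forcing_le_clip alpha p halpha hp G Gpos u ulb u0 f la
  (let: And3 _ _ h := hu in h) n vn.
have mkn := measurable_kernel_of (bn n) (mbn n).
have kn0 y s : 0 <= kernel_of (bn n) y s by exact: kernel_of_ge0.
have [m m0 mE] := own_occupation_total G G1 f f0 fB mf.
have [r r01 rE] := mean_offspring_total_lt1 alpha p halpha hp G hi.
have /andP[rn0 rn1] := slope_total_lt1 alpha p halpha hp G hi n.
have [+ _] := total_ge_forcing G _ _ vE mkn ms mvE kn0 s0 vE0 vge.
move=> /(_ x); apply: le_trans; rewrite source_total /lineage_occupation.
rewrite [leLHS]ge0_muleDr; first last.
- apply: mule_ge0; first exact: mean_offspring_ge0.
  by rewrite mE lee_fin divr_ge0//= subr_ge0 ltW.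
- exact: own_occupation_ge0.
apply: leeD2l; rewrite muleCA; apply: lee_wpmul2l; first exact: mean_offspring_ge0.
rewrite -EFinM mulrA.
apply: (renewal_mean_ge G _ _ vE mkn ms mvE kn0 s0 vE0 _ _ source_mean
  (thinned_totalE alpha p halpha hp G hi n) rn1) => //.
rewrite ge0_fin_numE; last by apply: integral_ge0 => t _; exact: mean_of_ge0.
by apply: le_lt_trans integral_mean_clip_le _; rewrite -EFinM ltry.
Qed.

End scaled.

(** One more use of the equation: the convolution with a bounded kernel is at
    most that bound times the total mass, which is of order [la]. *)
Lemma clip_uniform_bound : exists2 C : R, (0 <= C)%R &
  forall la u, (0 <= la)%R -> is_cumulant alpha p G (fun y => la * f y)%R u ->
  forall t x, (clip u t x <= la * C)%R.
Proof.
have [M fM] := fB; have [C C0 bC] := birth_rate_bounded alpha p halpha hp.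
have [m m0 mE] := own_occupation_total G G1 f f0 fB mf.
have [r r01 rE] := mean_offspring_total_lt1 alpha p halpha hp G hi.
have c0 : (0 <= m / (1 - r))%R.
  by rewrite divr_ge0//= subr_ge0; case/andP: r01 => _ /ltW.
exists (Num.max 0 M + C * (m / (1 - r)))%R.
  by rewrite addr_ge0 ?le_max ?lexx// mulr_ge0.
move=> la u la0 hu t x.
have [ulb u0 ueq] := hu.
have vle := clip_le_forcing alpha p halpha hp G Gpos u ulb u0 f la f0 la0 ueq x t.
have mm : measurable_fun setT (mean_of G (fun t x : R => (clip u t x)%:E)).
  apply: (measurable_mean_of G (fun t x : R => (clip u t x)%:E)).
    by apply/measurable_EFinP; exact: measurable_clip.
  by move=> t' x'; rewrite lee_fin (clip_ge0 la u hu).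
have mm0 t' : 0 <= mean_of G (fun t x : R => (clip u t x)%:E) t'.
  by apply: mean_of_ge0 => t'' x'; rewrite lee_fin (clip_ge0 la u hu).
rewrite -lee_fin; apply: le_trans vle _; rewrite mulrDr EFinD; apply: leeD.
  rewrite source_ofZ EFinM; apply: lee_wpmul2l; first by rewrite lee_fin.
  rewrite /source_of; case: ifP => _; rewrite lee_fin; last by rewrite le_max lexx.
  have [y0|y0] := ltP 0%R (x - t)%R; last by rewrite ext0_le0// le_max lexx.
  by rewrite ext0_pos// le_max (le_trans (ler_norm _) (fM _ y0)) orbT.
apply: (@le_trans _ _ (\int[mu]_s (C%:E * mean_of G (fun t x : R => (clip u t x)%:E) (t - s)%R))).
  apply: ge0_le_integral_nomeas => s _; first by apply: mule_ge0 => //; exact: kernel_of_ge0.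
  apply: lee_wpmul2r => //; rewrite /kernel_of; case: ifP => _; rewrite lee_fin//.
rewrite ge0_integralZl_EFin//; last first.
  by apply: (measurableT_comp mm); exact: measurable_funB.
rewrite (ge0_integral_reflect _ t mm mm0) mulrCA EFinM.
apply: lee_wpmul2l; first by rewrite lee_fin.
apply: le_trans (integral_mean_clip_le la u la0 hu) _.
by rewrite mE -/(mean_offspring_total alpha p G) rE EFinM.
Qed.

End cumulant_bounds.

(** * The total immigration exponent *)

Section immigration.
Context {R : realType}.
Local Notation mu := (@lebesgue_measure R).
Local Open Scope ereal_scope.
Implicit Types nu : config R.

Lemma integral_null_config nu (g : R -> \bar R) : nu setT = 0 ->
  (forall x, 0 <= g x) -> \int[nu]_x g x = 0.
Proof.
move=> nu0 g0; have nu_zero (A : set (measurableTypeR R)) : measurable A -> A `<=` setT -> nu A = mzero A.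
  by move=> mA _; rewrite (@subset_measure0 _ _ _ nu A setT).
by rewrite (eq_measure_integral mzero)// integral_measure_zero.
Qed.

Lemma integral_nonnull (L : {finite_measure set (config R) -> \bar R})
    (g : config R -> \bar R) :
  (forall nu, nu setT = 0 -> g nu = 0) ->
  \int[L]_(nu in nonnull_config) g nu = \int[L]_nu g nu.
Proof.
move=> g0; rewrite integral_mkcond; apply: eq_integral => nu _.
rewrite patchE; case: ifPn => // /negP h; rewrite g0//.
by apply/eqP/negP => /negP h'; apply: h; rewrite inE.
Qed.

Section one_field.
Variable L : {finite_measure set (config R) -> \bar R}.
Variable v : R -> R -> R.
Hypotheses (v0 : forall t x, (0 <= v t x)%R)
  (mv : measurable_fun setT (fun z : R * R => v z.1 z.2)).

Definition config_integral (t : R) (nu : config R) : \bar R :=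
  \int[nu]_x (v t x)%:E.

Lemma config_integral_ge0 t nu : 0 <= config_integral t nu.
Proof. by apply: integral_ge0 => x _; rewrite lee_fin. Qed.

Lemma measurable_config_integral :
  measurable_fun setT (fun z : R * config R => config_integral z.1 z.2).
Proof.
pose h (z : (R * config R) * measurableTypeR R) : \bar R := (v z.1.1 z.2)%:E.
have := @measurable_random_integral R _ _ (R * config R)%type (measurableTypeR R)
    (fun z => config_measure z.2) _ h.
apply.
- by move=> A mA; exact: (measurableT_comp (measurable_mass A mA)).
- apply/measurable_EFinP.
  apply: (measurableT_comp mv (_ : measurable_fun setT
    (fun z : (R * config R) * measurableTypeR R => (z.1.1, z.2 : R)))).
  apply: measurable_fun_pair => //.
  by apply: measurableT_comp => //; exact: measurable_fst.
- by move=> z; rewrite lee_fin.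
Qed.

Definition immigration_exponent (t : R) : \bar R :=
  \int[L]_nu (1 - expR (- fine (config_integral t nu)))%:E.

Let jump_itv t nu : (0 <= 1 - expR (- fine (config_integral t nu)) <= 1)%R.
Proof.
have y0 : (0 <= fine (config_integral t nu))%R by rewrite fine_ge0// config_integral_ge0.
by rewrite (one_sub_expRN_ge0 _ y0)/= gerBl expR_ge0.
Qed.

Let mjump : measurable_fun setT
  (fun z : R * config R => (1 - expR (- fine (config_integral z.1 z.2)))%:E).
Proof.
apply/measurable_EFinP; apply: measurable_funB => //.
apply: (measurableT_comp (@measurable_expR R)).
apply: measurableT_comp => //.
exact: (measurableT_comp (@fine_measurable R _ measurableT) measurable_config_integral).
Qed.

Lemma immigration_exponent_ge0 t : 0 <= immigration_exponent t.
Proof.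
by apply: integral_ge0 => nu _; rewrite lee_fin; case/andP: (jump_itv t nu).
Qed.

Lemma measurable_immigration_exponent : measurable_fun setT immigration_exponent.
Proof.
apply: (measurable_fun_fubini_tonelli_F (m2 := L)
  (fun z : R * config R => (1 - expR (- fine (config_integral z.1 z.2)))%:E)) => //.
by move=> z; rewrite lee_fin; case/andP: (jump_itv z.1 z.2).
Qed.

Lemma immigration_exponent_le_mass t : immigration_exponent t <= L setT.
Proof.
apply: (@le_trans _ _ (\int[L]_nu cst 1 nu)); last by rewrite integral_cst// mul1e.
by apply: ge0_le_integral_nomeas => nu _; rewrite lee_fin; case/andP: (jump_itv t nu).
Qed.

Lemma integral_config_integral nu :
  \int[mu]_t config_integral t nu = \int[nu]_x \int[mu]_t (v t x)%:E.
Proof.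
apply: (fubini_tonelli (m1 := mu) (m2 := nu) (fun z : R * R => (v z.1 z.2)%:E)).
  exact/measurable_EFinP.
by move=> z; rewrite lee_fin.
Qed.

(** The exponent is below its linearisation, and Tonelli exchanges time and
    immigration. *)
Lemma integral_exponent_le (c : config R -> \bar R) :
  (forall nu, \int[mu]_t config_integral t nu <= c nu) ->
  \int[mu]_t immigration_exponent t <= \int[L]_nu c nu.
Proof.
move=> hc; apply: (@le_trans _ _ (\int[mu]_t \int[L]_nu config_integral t nu)).
  apply: ge0_le_integral_nomeas => t _; first exact: immigration_exponent_ge0.
  apply: ge0_le_integral_nomeas => nu _.
    by rewrite lee_fin; case/andP: (jump_itv t nu).
  have := config_integral_ge0 t nu; case: (config_integral t nu) => [r||]//= r0.
    by rewrite lee_fin one_sub_expRN_le.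
  by rewrite leey.
rewrite (fubini_tonelli (m1 := mu) (m2 := L) (fun z => config_integral z.1 z.2))//.
- apply: ge0_le_integral_nomeas => nu _; last exact: hc.
  by apply: integral_ge0 => t _; exact: config_integral_ge0.
- exact: measurable_config_integral.
- by move=> z; exact: config_integral_ge0.
Qed.

(** For a configuration of mass [M] with all weights at most [d], the exponent
    [y] is at most [d * M], and [1 - exp(-y) >= (1 - y) y]. *)
Definition linear_fraction (d : R) (nu : config R) : \bar R :=
  (Num.max 0 (1 - d * fine (nu setT)))%:E.

Lemma integral_exponent_ge (d : R) : (forall t x, (v t x <= d)%R) ->
  \int[L]_nu (linear_fraction d nu * \int[mu]_t config_integral t nu) <=
  \int[mu]_t immigration_exponent t.
Proof.
move=> vd.
have lf0 nu : 0 <= linear_fraction d nu by rewrite lee_fin le_max lexx.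
have mc := measurable_config_integral.
rewrite (_ : \int[mu]_t immigration_exponent t = \int[L]_nu \int[mu]_t
  (1 - expR (- fine (config_integral t nu)))%:E); last first.
  apply: (fubini_tonelli (m1 := mu) (m2 := L)
   (fun z => (1 - expR (- fine (config_integral z.1 z.2)))%:E)) => //.
  by move=> z; rewrite lee_fin; case/andP: (jump_itv z.1 z.2).
apply: ge0_le_integral_nomeas => nu _.
  apply: mule_ge0 => //; apply: integral_ge0 => t _; exact: config_integral_ge0.
rewrite -ge0_integralZl_EFin//; last 3 first.
- by move=> t _; exact: config_integral_ge0.
- exact: (measurableT_comp mc (measurable_pair2 nu)).
- by rewrite le_max lexx.
apply: ge0_le_integral_nomeas => t _.
  by apply: mule_ge0; [exact: lf0|exact: config_integral_ge0].
have cd : config_integral t nu <= (d * fine (nu setT))%:E.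
  rewrite EFinM fineK ?config_mass_fin// -[d%:E * _]integral_cst//.
  by apply: ge0_le_integral_nomeas => x _; rewrite lee_fin.
have := config_integral_ge0 t nu; move: cd; rewrite /linear_fraction.
case: (config_integral t nu) => [y||]//=.
rewrite -EFinM !lee_fin => yd y0.
have [h|h] := leP (1 - d * fine (nu setT))%R 0%R.
  by rewrite mul0r one_sub_expRN_ge0.
apply: le_trans (one_sub_expRN_ge y y0).
by rewrite ler_wpM2r// lerD2l lerN2.
Qed.

End one_field.
End immigration.

Section immigration_rate.
Context {R : realType}.
Local Notation mu := (@lebesgue_measure R).
Local Open Scope ereal_scope.
Variables (alpha : R -> R) (p : R -> nat -> R).
Hypotheses (halpha : is_C1plus alpha) (hp : is_offspring_law p).
Variable G : probability (measurableTypeR R) R.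
Hypothesis Gpos : G `]-oo, 0%R]%classic = 0.
Hypothesis G1 : \int[G]_x `|x|%:E < +oo.
Hypothesis hi : \int[mu]_(s in pos_reals) renewal_density alpha p G s < 1.
Variable L : {finite_measure set (config R) -> \bar R}.
Hypothesis L1 : \int[L]_nu \int[nu]_x `|x|%:E < +oo.
Local Notation b := (birth_rate alpha p).
Local Notation bn := (thinned_rate alpha p).
Variables (f : R -> R).
Hypotheses (f0 : nonneg_on_pos f) (fB : bounded_on_pos f)
  (mf : measurable_fun setT (ext0 f)).

Let b0 y : (0 <= b y)%R. Proof. exact: birth_rate_ge0. Qed.
Let bn0 n y : (0 <= bn n y)%R. Proof. exact: thinned_rate_ge0. Qed.
Let mb : measurable_fun setT b. Proof. exact: measurable_birth_rate. Qed.
Let mbn n : measurable_fun setT (bn n). Proof. exact: measurable_thinned_rate. Qed.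

Local Opaque birth_rate thinned_rate lineage_occupation.

Definition occupation_rate : \bar R :=
  \int[L]_nu \int[nu]_x lineage_occupation b G f x.

Let lineage_ge0 x : 0 <= lineage_occupation b G f x.
Proof.
have [C C0 hC] := lineage_occupation_bound alpha p halpha hp G G1 hi f f0 fB mf.
by case/andP: (hC x).
Qed.

Let mlineage : measurable_fun setT (lineage_occupation b G f).
Proof. exact: measurable_lineage_occupation. Qed.

Let mnorm : measurable_fun setT (fun x : R => `|x|%:E).
Proof. by apply/measurable_EFinP; exact: normr_measurable. Qed.

Lemma config_lineage_fin (nu : config R) :
  \int[nu]_x lineage_occupation b G f x < +oo.
Proof.
have [C C0 hC] := lineage_occupation_bound alpha p halpha hp G G1 hi f f0 fB mf.
apply: (@le_lt_trans _ _ (C%:E * \int[nu]_x `|x|%:E)).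
  rewrite -ge0_integralZl_EFin//.
  by apply: ge0_le_integral_nomeas => x _; case/andP: (hC x).
by rewrite lte_mul_pinfty// ?lee_fin// config_first_moment.
Qed.

Lemma config_lineage_ge0 (nu : config R) : 0 <= \int[nu]_x lineage_occupation b G f x.
Proof. exact: integral_ge0. Qed.

Lemma occupation_rate_ge0 : 0 <= occupation_rate.
Proof. by apply: integral_ge0 => nu _; exact: config_lineage_ge0. Qed.

Lemma measurable_config_lineage (g : R -> \bar R) : (forall x, 0 <= g x) ->
  measurable_fun setT g -> measurable_fun setT (fun nu : config R => \int[nu]_x g x).
Proof.
move=> g0 mg; apply: measurable_fun_integral_kernel => // U mU.
exact: measurable_mass.
Qed.

Lemma occupation_rate_fin : occupation_rate \is a fin_num.
Proof.
rewrite (ge0_fin_numE occupation_rate_ge0).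
have [C C0 hC] := lineage_occupation_bound alpha p halpha hp G G1 hi f f0 fB mf.
apply: (@le_lt_trans _ _ (C%:E * \int[L]_nu \int[nu]_x `|x|%:E)).
  rewrite -ge0_integralZl_EFin//; last 2 first.
  - by move=> nu _; exact: integral_ge0.
  - exact: measurable_config_lineage.
  apply: ge0_le_integral_nomeas => nu _; first exact: config_lineage_ge0.
  rewrite -ge0_integralZl_EFin//.
  by apply: ge0_le_integral_nomeas => x _; case/andP: (hC x).
by rewrite lte_mul_pinfty// lee_fin.
Qed.

Section scaled.
Variables (la : R) (u : R -> R -> R).
Hypothesis la0 : (0 <= la)%R.
Hypothesis hu : is_cumulant alpha p G (fun y => la * f y)%R u.

Let v0 t x : (0 <= clip u t x)%R. Proof. exact: (clip_ge0 alpha p G f la u hu). Qed.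
Let mv : measurable_fun setT (fun z : R * R => clip u z.1 z.2).
Proof. by apply: measurable_clip; case: hu. Qed.

Lemma pairing_clip t (nu : config R) : (0 <= t)%R ->
  pairing nu (u t) = fine (config_integral (clip u) t nu).
Proof.
move=> t0; rewrite pairing_mkcond; congr fine; apply: eq_integral => x _.
have [x0|x0] := ltP 0%R x; first by rewrite ext0_pos// clipE.
by rewrite ext0_le0// clip_le0.
Qed.

Lemma integral_config_clip_le (nu : config R) :
  \int[mu]_t config_integral (clip u) t nu <=
  la%:E * \int[nu]_x lineage_occupation b G f x.
Proof.
rewrite integral_config_integral//.
rewrite -ge0_integralZl_EFin//; apply: ge0_le_integral_nomeas => x _.
  by apply: integral_ge0 => t _; rewrite lee_fin.
exact: total_clip_le.
Qed.

Definition total_exponent : \bar R := \int[mu]_t immigration_exponent L (clip u) t.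

Lemma total_exponent_ge0 : 0 <= total_exponent.
Proof. by apply: integral_ge0 => t _; exact: immigration_exponent_ge0. Qed.

Lemma total_exponent_le : total_exponent <= la%:E * occupation_rate.
Proof.
rewrite /occupation_rate -ge0_integralZl_EFin//; last 2 first.
- by move=> nu _; exact: config_lineage_ge0.
- exact: measurable_config_lineage.
by apply: integral_exponent_le => //; exact: integral_config_clip_le.
Qed.

Lemma total_exponent_fin : total_exponent \is a fin_num.
Proof.
rewrite ge0_fin_numE ?total_exponent_ge0//; apply: le_lt_trans total_exponent_le _.
by rewrite -(fineK occupation_rate_fin) -EFinM ltry.
Qed.

Lemma psi_clip t : (0 <= t)%R ->
  (psi L (u t))%:E = immigration_exponent L (clip u) t.
Proof.
move=> t0; rewrite /psi /Rintegral.
rewrite (eq_integral (fun nu => (1 - expR (- fine (config_integral (clip u) t nu)))%:E)); last first.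
  by move=> nu _; rewrite pairing_clip.
rewrite integral_nonnull; last first.
  move=> nu nu0; rewrite /config_integral integral_null_config//=.
    by rewrite oppr0 expR0 subrr.
  by move=> x; rewrite lee_fin.
rewrite fineK// ge0_fin_numE; last exact: immigration_exponent_ge0.
apply: le_lt_trans (immigration_exponent_le_mass L (clip u) v0 t) _.
by rewrite -ge0_fin_numE// fin_num_measure.
Qed.

Lemma integral_psi t :
  (\int[mu]_(s in `]0%R, t]) psi L (u s))%R%:E =
  \int[mu]_(s in `]0%R, t]) immigration_exponent L (clip u) s.
Proof.
rewrite /Rintegral.
have -> : \int[mu]_(s in `]0%R, t]) (psi L (u s))%:E =
    \int[mu]_(s in `]0%R, t]) immigration_exponent L (clip u) s.
  apply: eq_integral => s; rewrite inE/= in_itv/= => /andP[s0 _].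
  by rewrite psi_clip// ltW.
rewrite fineK// ge0_fin_numE; last first.
  by apply: integral_ge0 => s _; exact: immigration_exponent_ge0.
apply: (@le_lt_trans _ _ total_exponent).
  apply: ge0_subset_integral => //.
  - exact: measurable_immigration_exponent.
  - by move=> s _; exact: immigration_exponent_ge0.
by rewrite -ge0_fin_numE ?total_exponent_fin// total_exponent_ge0.
Qed.

Lemma integral_psi_le t :
  (0 <= \int[mu]_(s in `]0%R, t]) psi L (u s) <= fine total_exponent)%R.
Proof.
rewrite -!lee_fin integral_psi fineK ?total_exponent_fin//.
rewrite integral_ge0/=; last by move=> s _; exact: immigration_exponent_ge0.
apply: ge0_subset_integral => //.
- exact: measurable_immigration_exponent.
- by move=> s _; exact: immigration_exponent_ge0.
Qed.

Lemma total_exponent_pos :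
  total_exponent = \int[mu]_(s in `]0%R, +oo[) immigration_exponent L (clip u) s.
Proof.
have mi := measurable_immigration_exponent L (clip u) v0 mv.
rewrite integral_itv_obnd_cbnd; last exact: measurable_funTS.
rewrite integral_mkcond; apply: eq_integral => t _.
rewrite patchE mem_setE in_itv/= andbT; case: ltP => // t0.
rewrite /immigration_exponent integral0_eq// => nu _.
rewrite /config_integral integral0_eq ?oppr0 ?expR0 ?subrr// => x _.
by rewrite clip_lt0.
Qed.

(** The truncated exponents increase to the total exponent. *)
Lemma integral_psi_ge (e : R) : (0 < e)%R -> exists T : R, (0 <= T)%R /\
  forall t, (T <= t)%R ->
  (fine total_exponent - e <= \int[mu]_(s in `]0%R, t]) psi L (u s))%R.
Proof.
move=> e0; have mi := measurable_immigration_exponent L (clip u) v0 mv.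
pose F (n : nat) : set (measurableTypeR R) := `]0%R, n%:R]%classic.
have FT : \bigcup_n F n = `]0%R, +oo[%classic.
  apply/seteqP; split => x; rewrite /= in_itv/= ?andbT.
    by case=> n _; rewrite /F/= in_itv/= => /andP[].
  move=> x0; exists (Num.truncn x).+1 => //.
  by rewrite /F/= in_itv/= x0/= ltW// truncnS_gt.
have := @ge0_nondecreasing_set_cvg_integral _ (measurableTypeR R) R F
  (immigration_exponent L (clip u)) mu.
rewrite FT => cv.
have {}cv : \int[mu]_(x in F i) immigration_exponent L (clip u) x @[i --> \oo] --> total_exponent.
  rewrite total_exponent_pos; apply: cv => //.
  - move=> m n mn; rewrite subsetEset => x; rewrite /F/= !in_itv/= => /andP[-> /=].
    by move=> /le_trans; apply; rewrite ler_nat.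
  - by move=> i; exact: measurable_itv.
  - by move=> i; exact: measurable_funTS.
  - by move=> i x _; exact: immigration_exponent_ge0.
rewrite -(fineK total_exponent_fin) in cv.
have /fine_cvgP[_ /cvgrPdist_lt/(_ _ e0)] := cv.
case=> N _ /(_ N (leqnn N)) /= h; exists N%:R; split => // t Nt.
apply: (@le_trans _ _ (fine (\int[mu]_(x in F N) immigration_exponent L (clip u) x))).
  by move: h => /ltr_normlP[_ h]; rewrite lerBlDr -lerBlDl ltW.
have := integral_psi t; rewrite -[X in _ = X]fineK; last first.
  by rewrite -integral_psi.
move=> [->]; apply: fine_le.
- by rewrite -integral_psi.
- by rewrite -integral_psi.
apply: ge0_subset_integral => //.
- exact: measurable_itv.
- exact: measurable_funTS.
- by move=> s _; exact: immigration_exponent_ge0.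
- move=> x; rewrite /F/= !in_itv/= => /andP[-> /=] xN; exact: le_trans xN Nt.
Qed.

End scaled.

Let thinned_integrand n (nu : config R) : \bar R :=
  linear_fraction n.+1%:R^-1 nu * \int[nu]_x lineage_occupation (bn n) G f x.

Let lineage_n_ge0 n x : 0 <= lineage_occupation (bn n) G f x.
Proof. exact: lineage_occupation_slope_ge0. Qed.

Let mlineage_n n : measurable_fun setT (lineage_occupation (bn n) G f).
Proof. exact: measurable_lineage_occupation. Qed.

Let lineage_n_cvg (nu : config R) :
  \int[nu]_x lineage_occupation (bn n) G f x @[n --> \oo] -->
  \int[nu]_x lineage_occupation b G f x.
Proof.
rewrite [X in _ --> X](_ : _ = \int[nu]_x limn (fun n => lineage_occupation (bn n) G f x)).
  apply: cvg_monotone_convergence => //.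
  by move=> x _; exact: lineage_occupation_slope_nd.
apply: eq_integral => x _; apply/esym/cvg_lim => //.
exact: lineage_occupation_slope_cvg.
Qed.

Let thinned_integrand_cvg (nu : config R) : thinned_integrand n nu @[n --> \oo] -->
  \int[nu]_x lineage_occupation b G f x.
Proof.
rewrite -[X in _ --> X]mul1e; apply: cvgeM; last exact: lineage_n_cvg.
- rewrite mule_def_fin// ge0_fin_numE ?config_lineage_ge0//.
  exact: config_lineage_fin.
- apply: cvg_EFin; first exact: nearW.
  rewrite [X in _ --> X](_ : _ = Num.max 0%R (1 - 0 * fine (nu setT))%R); last first.
    by rewrite mul0r subr0 max_r.
  have ca : (1 - n.+1%:R^-1 * fine (nu setT))%R @[n --> \oo] --> (1 - 0 * fine (nu setT))%R.
    by apply: cvgB; [exact: cvg_cst|apply: cvgMl; exact: cvg_harmonic].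
  have cm : continuous (fun y : R => Num.max 0%R y).
    move=> y; apply: (@continuous_max R R (cst 0%R) id); first exact: cvg_cst.
    exact: cvg_id.
  exact: (cvg_comp _ _ ca (cm _)).
Qed.

Let mthinned n : measurable_fun setT (thinned_integrand n).
Proof.
have m2 := measurable_config_lineage _ (lineage_n_ge0 n) (mlineage_n n).
apply: (emeasurable_funM _ m2).
apply/measurable_EFinP; apply: measurable_maxr; first exact: measurable_cst.
apply: measurable_funB; first exact: measurable_cst.
apply: measurable_funM; first exact: measurable_cst.
exact: (measurableT_comp (@fine_measurable R _ measurableT) (measurable_mass setT measurableT)).
Qed.

Let thinned_ge0 n nu : 0 <= thinned_integrand n nu.
Proof.
apply: mule_ge0; first by rewrite lee_fin le_max lexx.
exact: integral_ge0.
Qed.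

Let thinned_nd nu : nondecreasing_seq (thinned_integrand ^~ nu).
Proof.
move=> m n mn; apply: lee_pmul.
- by rewrite lee_fin le_max lexx.
- exact: integral_ge0.
- have M0 : (0 <= fine (nu setT))%R by exact: fine_ge0.
  rewrite lee_fin ge_max le_max lexx/= le_max; apply/orP; right.
  rewrite lerD2l lerN2; apply: (ler_wpM2r M0).
  by rewrite lef_pV2 ?posrE ?ltr0Sn// ler_nat.
- apply: ge0_le_integral_nomeas => x _; first exact: lineage_n_ge0.
  exact: lineage_occupation_slope_nd.
Qed.

Let thinned_total_cvg : \int[L]_nu thinned_integrand n nu @[n --> \oo] --> occupation_rate.
Proof.
rewrite [X in _ --> X](_ : _ = \int[L]_nu limn (thinned_integrand ^~ nu)).
  apply: (cvg_monotone_convergence measurableT mthinned).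
    by move=> n nu _; exact: thinned_ge0.
  by move=> nu _; exact: thinned_nd.
by apply: eq_integral => nu _; apply/esym/cvg_lim => //; exact: thinned_integrand_cvg.
Qed.

(** For a level [n] the lower bounds on cumulants and on exponents hold as soon as
    [u <= 1 / (n + 1)], which a small [la] ensures; they increase to the
    linearised value by monotone convergence. *)
Lemma total_exponent_ge (e : R) : (0 < e)%R -> exists2 la : R, (0 < la <= e)%R &
  forall u, is_cumulant alpha p G (fun y => la * f y)%R u ->
  (la * (fine occupation_rate - e) <= fine (total_exponent u))%R.
Proof.
move=> e0.
have [C C0 hC] := clip_uniform_bound alpha p halpha hp G Gpos G1 hi f f0 fB mf.
have cv := thinned_total_cvg; rewrite -(fineK occupation_rate_fin) in cv.
have /fine_cvgP[fin /cvgrPdist_lt/(_ _ e0) near_e] := cv.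
have near_inv : \forall n \near \oo, (n.+1%:R^-1 < e)%R.
  have /cvgrPdist_lt/(_ _ e0) := @cvg_harmonic R.
  by apply: filterS => n; rewrite /= sub0r normrN ger0_norm.
have [N _ /(_ N (leqnn N))/= [[finN hN] invN]] :
  \forall n \near \oo, (\int[L]_nu thinned_integrand n nu \is a fin_num /\
    (`|fine occupation_rate - fine (\int[L]_nu thinned_integrand n nu)| < e)%R) /\
    (n.+1%:R^-1 < e)%R.
  near=> n; split; last by near: n.
  by split; near: n.
have d0 : (0 < N.+1%:R^-1 :> R)%R by rewrite invr_gt0.
have C1 : (0 < C + 1)%R by rewrite ltr_wpDl.
pose la : R := (N.+1%:R^-1 / (C + 1))%R.
have la0 : (0 < la)%R by rewrite divr_gt0.
exists la.
  rewrite la0/= (le_trans _ (ltW invN))// ler_pdivrMr// ler_peMr ?(ltW d0)//.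
  by rewrite lerDr.
move=> u hu.
have vd t x : (clip u t x <= N.+1%:R^-1)%R.
  apply: le_trans (hC la u (ltW la0) hu t x) _.
  by rewrite /la mulrAC ler_pdivrMr// ler_wpM2l ?(ltW d0)// lerDl.
have v0 t x : (0 <= clip u t x)%R by exact: (clip_ge0 alpha p G f la u hu).
have mv : measurable_fun setT (fun z : R * R => clip u z.1 z.2).
  by apply: measurable_clip; case: hu.
have h1 : (la * fine (\int[L]_nu thinned_integrand N nu) <= fine (total_exponent u))%R.
  rewrite -lee_fin EFinM !fineK ?(total_exponent_fin la u (ltW la0) hu)//.
  apply: le_trans (integral_exponent_ge L (clip u) v0 mv _ vd).
  rewrite -(ge0_integralZl_EFin _ measurableT (fun nu _ => thinned_ge0 N nu) (mthinned N) (ltW la0)).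
  apply: ge0_le_integral_nomeas => nu _.
    by apply: mule_ge0; [rewrite lee_fin ltW|exact: thinned_ge0].
  rewrite /thinned_integrand muleCA; apply: lee_wpmul2l; first by rewrite lee_fin le_max lexx.
  rewrite (integral_config_integral (clip u) v0 mv nu).
  rewrite -(ge0_integralZl_EFin nu measurableT (fun x _ => lineage_n_ge0 N x) (mlineage_n N) (ltW la0)).
  apply: ge0_le_integral_nomeas => x _; first by apply: mule_ge0; [rewrite lee_fin ltW|exact: lineage_n_ge0].
  by apply: (total_clip_ge alpha p halpha hp G Gpos G1 hi f f0 fB mf la u (ltW la0) hu N x).
apply: le_trans h1; rewrite ler_wpM2l ?(ltW la0)//.
by move: hN => /ltr_normlP[_]; lra.
Unshelve. all: by end_near. Qed.

End immigration_rate.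

(** * The Markov property for Laplace functionals *)

Section layer_cake.
Context {R : realType}.
Local Notation mu := (@lebesgue_measure R).
Local Open Scope ereal_scope.

Lemma measurable_lt_set {d} {T : measurableType d} (f g : T -> R) :
  measurable_fun setT f -> measurable_fun setT g ->
  measurable [set x | (f x < g x)%R].
Proof.
move=> mf mg; rewrite -[X in measurable X]setTI.
exact: (measurable_fun_ltr mf mg measurableT (Y := [set true])).
Qed.

(** Slicing a nonnegative weight by its superlevel sets turns a relation
    between the values of measures on sets into one between integrals. *)
Lemma integral_superlevel {d} {T : measurableType d} (m : {finite_measure set T -> \bar R})
    (phi q : T -> R) : measurable_fun setT phi -> measurable_fun setT q ->
  (forall x, (0 <= phi x)%R) -> (forall x, (0 <= q x)%R) ->
  \int[m]_x (phi x * q x)%:E =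
  \int[mu]_(th in pos_reals) \int[m]_(x in [set x | (th < phi x)%R]) (q x)%:E.
Proof.
move=> mphi mq phi0 q0.
pose U : set (T * measurableTypeR R) := [set z | (0 < z.2)%R /\ (z.2 < phi z.1)%R].
have mU : measurable U.
  apply: (@measurableI _ _ [set z : T * measurableTypeR R | (0 < z.2)%R]
    [set z : T * measurableTypeR R | (z.2 < phi z.1)%R]); apply: measurable_lt_set => //;
    exact: measurableT_comp.
pose h (z : T * measurableTypeR R) : \bar R := (\1_U z * q z.1)%:E.
have mh : measurable_fun setT h.
  apply/measurable_EFinP; apply: measurable_funM; first exact: measurable_indic.
  exact: measurableT_comp.
have h0 z : 0 <= h z by rewrite lee_fin mulr_ge0.
have hU x y : U (x, y) -> h (x, y) = (q x)%:E by move=> Uxy; rewrite /h indicE mem_set// mul1r.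
have hUn x y : ~ U (x, y) -> h (x, y) = 0 by move=> Uxy; rewrite /h indicE memNset// mul0r.
transitivity (\int[m]_x \int[mu]_y h (x, y)).
  apply: eq_integral => x _.
  rewrite (_ : \int[mu]_y h (x, y) = \int[mu]_(y in `]0%R, phi x[) (cst (q x)%:E y)).
    rewrite integral_cst; last exact: measurable_itv.
    rewrite [X in _ * X](lebesgue_measure_itv `]0%R, phi x[)/= lte_fin.
    case: ltP => [_|pl]; first by rewrite -EFinB subr0 -EFinM mulrC.
    by rewrite mule0 (_ : phi x = 0%R) ?mul0r//; apply/eqP; rewrite eq_le pl phi0.
  rewrite [RHS]integral_mkcond; apply: eq_integral => y _.
  rewrite patchE mem_setE in_itv/=; case: ifPn => [/andP[y0 y1]|Ny]; first by rewrite hU.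
  by rewrite hUn// => -[y0 y1]; rewrite y0 y1 in Ny.
rewrite (fubini_tonelli (m1 := m) (m2 := mu) h mh h0).
rewrite [RHS]integral_mkcond; apply: eq_integral => y _.
rewrite patchE mem_setE in_itv/= andbT; case: ifPn => y0.
  rewrite integral_mkcond [RHS]integral_mkcond; apply: eq_integral => x _.
  rewrite !patchE in_setT; case: ifPn => [/set_mem xy|/negP xy]; first by rewrite hU.
  by rewrite hUn// => -[_ y1]; apply: xy; rewrite inE.
by rewrite [LHS]integral0_eq// => x _; rewrite hUn// => -[/= y1]; rewrite y1 in y0.
Qed.

(** Bounds on superlevel sets of the weight add up to a bound on the weighted
    integral. *)
Lemma integral_weighted_le {d} {T : measurableType d}
    (m : {finite_measure set T -> \bar R}) (b : R)
    (phi q : T -> R) : (0 <= b)%R ->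
  measurable_fun setT phi -> measurable_fun setT q ->
  (forall w, (0 <= phi w)%R) -> (forall w, (0 <= q w)%R) ->
  (forall th, \int[m]_(w in [set w | (th < phi w)%R]) (q w)%:E <=
     b%:E * m [set w | (th < phi w)%R]) ->
  \int[m]_w (phi w * q w)%:E <= b%:E * \int[m]_w (phi w)%:E.
Proof.
move=> b0 mphi mq phi0 q0 hb.
rewrite -ge0_integralZl_EFin//; last 2 first.
- by move=> x _; rewrite lee_fin.
- exact/measurable_EFinP.
under [leRHS]eq_integral do rewrite -EFinM mulrC.
rewrite (integral_superlevel m phi q)// (integral_superlevel m phi (cst b))//.
apply: ge0_le_integral_nomeas => th _.
  by apply: integral_ge0 => x _; rewrite lee_fin.
apply: (le_trans (hb th)).
have := integral_cst m (measurable_lt_set (cst th) phi (@measurable_cst _ _ _ _ _ th) mphi) b%:E.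
by move=> <-.
Qed.

(** Both sides are computed slice by slice from the assumption on sets. *)
Lemma integral_mixture {d e} {T : measurableType d} {S : measurableType e}
    (P : {finite_measure set T -> \bar R}) (X : T -> S)
    (k : T -> {finite_measure set S -> \bar R}) (A : set T) (phi : S -> R) :
  measurable A -> measurable_fun setT X ->
  (forall B, measurable B -> measurable_fun setT (fun w => k w B)) ->
  (forall B, measurable B -> P (A `&` X @^-1` B) = \int[P]_(w in A) k w B) ->
  measurable_fun setT phi -> (forall x, (0 <= phi x)%R) ->
  \int[P]_(w in A) (phi (X w))%:E = \int[P]_(w in A) \int[k w]_x (phi x)%:E.
Proof.
move=> mA mX mk hk mphi phi0.
have mB th : measurable [set x | (th < phi x)%R] by exact: measurable_lt_set.
have mphiX : measurable_fun setT (phi \o X) by exact: measurableT_comp.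
rewrite (_ : \int[P]_(w in A) (phi (X w))%:E = \int[P]_w ((phi \o X) w * \1_A w)%:E); last first.
  rewrite integral_mkcond; apply: eq_integral => w _; rewrite patchE indicE.
  by case: ifPn; rewrite ?mulr1// mulr0.
rewrite (integral_superlevel P (phi \o X) \1_A)//; last by move=> x; exact: phi0.
transitivity (\int[mu]_(th in pos_reals) \int[P]_(w in A) k w [set x | (th < phi x)%R]).
  apply: eq_integral => th _; rewrite -hk//.
  rewrite integral_indic//; exact: measurable_lt_set.
pose U : set ((T * R) * S) := [set z | (z.1.2 < phi z.2)%R].
have mU : measurable U.
  apply: measurable_lt_set; last exact: measurableT_comp.
  by apply: measurableT_comp.
pose h (z : T * measurableTypeR R) : \bar R :=
  (\1_(A `*` pos_reals) z)%:E * k z.1 (xsection U z).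
have mh : measurable_fun setT h.
  apply: emeasurable_funM.
    by apply/measurable_EFinP; apply: measurable_indic; apply: measurableX => //; exact: measurable_itv.
  apply: (@measurable_random_section R _ _ (T * R)%type S (fun z => k z.1)) => // B mB'.
  exact: (measurableT_comp (mk B mB')).
have h0 z : 0 <= h z by apply: mule_ge0 => //; rewrite lee_fin.
have sU w th : xsection U (w, th) = [set x | (th < phi x)%R].
  by apply/seteqP; split => x; rewrite /xsection/= inE.
have := fubini_tonelli (m1 := P) (m2 := mu) h mh h0 => fb.
transitivity (\int[mu]_th \int[P]_w h (w, th)).
  rewrite integral_mkcond; apply: eq_integral => th _.
  rewrite patchE; case: ifPn => th0.
    rewrite integral_mkcond; apply: eq_integral => w _.
    rewrite patchE /h sU indicE; case: ifPn => wA.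
      by rewrite mem_set ?mul1e//; split; apply/set_mem.
    by rewrite memNset ?mul0e// => -[/= wA' _]; move: wA; rewrite notin_setE; apply.
  rewrite [RHS]integral0_eq// => w _; rewrite /h indicE memNset ?mul0e// => -[/= _].
  by move: th0; rewrite notin_setE; apply.
rewrite -fb [RHS]integral_mkcond; apply: eq_integral => w _.
rewrite patchE; case: ifPn => wA.
  under [RHS]eq_integral do rewrite -[phi _]mulr1.
  rewrite (integral_superlevel (k w) phi (cst 1%R))//.
  rewrite [RHS]integral_mkcond; apply: eq_integral => th _.
  rewrite patchE /h sU indicE; case: ifPn => th0.
    rewrite mem_set; last by split; apply/set_mem.
    rewrite mul1e -[LHS]mul1e; apply/esym; exact: (integral_cst (k w) (mB th) 1).
  by rewrite memNset ?mul0e// => -[/= _]; move: th0; rewrite notin_setE; apply.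
rewrite [LHS]integral0_eq// => th _; rewrite /h indicE memNset ?mul0e// => -[/= wA' _].
by move: wA; rewrite notin_setE; apply.
Qed.
End layer_cake.

Section kernel_law.
Context {d e : measure_display} {S : measurableType d} {T : measurableType e} {R : realType}.
Variables (K : R.-pker S ~> T) (x : S).

(** The value of a probability kernel, packaged as a probability measure. *)
Definition kernel_law : set T -> \bar R := K x.

HB.instance Definition _ := Measure.on kernel_law.

HB.instance Definition _ :=
  Measure_isProbability.Build _ _ _ kernel_law (prob_kernel x).

End kernel_law.

Section markov_laplace.
Context {R : realType}.
Local Notation mu := (@lebesgue_measure R).
Local Open Scope ereal_scope.
Context {d : measure_display} {Omega : measurableType d}.
Variables (P : probability Omega R) (Y : R -> Omega -> config R)
  (K : R -> R.-pker (config R) ~> (config R)) (sigma : config R).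
Hypothesis hM : is_markov P Y K sigma.

Lemma measurable_state t : (0 <= t)%R -> measurable_fun setT (Y t).
Proof. by case: hM => + _ _; apply. Qed.

Lemma markov_integral r t (A : set (config R)) (phi : config R -> R) :
  (0 <= r)%R -> (0 <= t)%R -> measurable A -> measurable_fun setT phi ->
  (forall nu, (0 <= phi nu)%R) ->
  \int[P]_(w in Y r @^-1` A) (phi (Y (r + t)%R w))%:E =
  \int[P]_(w in Y r @^-1` A) \int[K t (Y r w)]_nu (phi nu)%:E.
Proof.
move=> r0 t0 mA mphi phi0; have mYr := measurable_state r r0.
have mYA : measurable (Y r @^-1` A) by rewrite -[X in measurable X]setTI; exact: mYr.
apply: (integral_mixture P (Y (r + t)%R) (fun w => kernel_law (K t) (Y r w))) => //.
- by apply: measurable_state; exact: addr_ge0.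
- move=> B mB.
  exact: (measurableT_comp (measurable_kernel (K t) B mB) mYr).
- move=> B mB; case: hM => _ _ h; apply: (h r t (Y r @^-1` A) B r0 t0 _ mB).
  by apply: sub_sigma_algebra; exists r, A; split => //; rewrite r0 lexx.
Qed.

Lemma initial_integral (phi : config R -> R) :
  measurable_fun setT phi -> (forall nu, (0 <= phi nu)%R) ->
  \int[P]_w (phi (Y 0%R w))%:E = (phi sigma)%:E.
Proof.
move=> mphi phi0; have mY0 := measurable_state 0%R (lexx _).
rewrite (integral_mixture P (Y 0%R) (fun=> dirac sigma) setT phi)//; last first.
  move=> B mB; rewrite integral_cst// [X in _ * X](probability_setT P) mule1 setTI.
  by case: hM => _ h _; exact: h.
have hd : \int[dirac sigma]_x (phi x)%:E = (phi sigma)%:E.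
  rewrite integral_dirac//; first by rewrite diracT mul1e.
  exact/measurable_EFinP.
rewrite (eq_integral (fun=> (phi sigma)%:E)); last by move=> w _; exact: hd.
by rewrite integral_cst// [X in _ * X](probability_setT P) mule1.
Qed.

Variables (g : R -> R) (u : R -> R -> R) (beta : R -> R).
Hypothesis mg : measurable_fun setT (fun nu : config R => pairing nu g).
Hypothesis mut : forall t, (0 <= t)%R -> measurable_fun setT (fun nu : config R => pairing nu (u t)).
Hypothesis u0 : forall t (nu : config R), (0 <= t)%R -> (0 <= pairing nu (u t))%R.
Hypothesis hlap : forall t (nu : config R), (0 <= t)%R ->
  \int[K t nu]_eta (expR (- pairing eta g))%:E =
  (expR (- pairing nu (u t) - beta t))%:E.

Let mexp (t : R -> R) (c : R) : measurable_fun setT (fun nu : config R => pairing nu t) ->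
  measurable_fun setT (fun nu : config R => expR (- pairing nu t - c)).
Proof.
move=> mt; apply: (measurableT_comp (@measurable_expR R)).
apply: measurable_funB => //; exact: measurableT_comp mt.
Qed.

Let mexp0 : measurable_fun setT (fun nu : config R => expR (- pairing nu g)).
Proof.
by apply: (measurableT_comp (@measurable_expR R)); exact: measurableT_comp mg.
Qed.

Lemma integral_laplace t : (0 <= t)%R ->
  \int[P]_w (expR (- pairing (Y t w) g))%:E =
  (expR (- pairing sigma (u t) - beta t))%:E.
Proof.
move=> t0.
have := markov_integral 0%R t setT (fun nu => expR (- pairing nu g)) (lexx _) t0 measurableT.
rewrite preimage_setT add0r => /(_ mexp0 (fun nu => expR_ge0 _)) ->.
rewrite (eq_integral (fun w => (expR (- pairing (Y 0%R w) (u t) - beta t))%:E)); last first.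
  by move=> w _; rewrite hlap.
apply: (initial_integral (fun nu => expR (- pairing nu (u t) - beta t))).
  by apply: mexp; exact: mut.
by move=> nu; exact: expR_ge0.
Qed.

(** On an event of the past at time [r], the Markov property and the Laplace
    formula give [exp(- <Y_r, u_t> - beta t)], and the first term in the exponent
    is nonpositive. *)
Lemma integral_laplace2_le r t : (0 <= r)%R -> (0 <= t)%R ->
  \int[P]_w (expR (- pairing (Y r w) g) * expR (- pairing (Y (r + t)%R w) g))%:E <=
  (expR (- beta t))%:E * \int[P]_w (expR (- pairing (Y r w) g))%:E.
Proof.
move=> r0 t0; have mYr := measurable_state r r0.
have mYt : measurable_fun setT (Y (r + t)%R) by apply: measurable_state; exact: addr_ge0.
apply: integral_weighted_le.
- exact: expR_ge0.
- exact: (measurableT_comp mexp0 mYr).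
- exact: (measurableT_comp mexp0 mYt).
- by move=> w; exact: expR_ge0.
- by move=> w; exact: expR_ge0.
move=> th; pose A : set (config R) := [set nu | (th < expR (- pairing nu g))%R].
have mA : measurable A by apply: measurable_lt_set.
rewrite (markov_integral r t A (fun nu => expR (- pairing nu g)) r0 t0 mA)//.
have mYA : measurable (Y r @^-1` A) by rewrite -[X in measurable X]setTI; exact: mYr.
have <- := integral_cst P mYA (expR (- beta t))%:E.
apply: ge0_le_integral_nomeas => w _.
  by apply: integral_ge0 => nu _; rewrite lee_fin expR_ge0.
by rewrite hlap//= lee_fin ler_expR gerDr oppr_le0 u0.
Qed.

End markov_laplace.

(** * Second moments of time averages *)

Section interval_weights.
Context {R : realType}.
Local Notation mu := (@lebesgue_measure R).
Local Open Scope ereal_scope.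

Lemma integral_itv_weight (c x y : R) : (0 <= c)%R -> (x <= y)%R ->
  \int[mu]_s (c * \1_(`]x, y] : set (measurableTypeR R)) s)%:E = (c * (y - x))%:E.
Proof.
move=> c0 xy.
under eq_integral do rewrite EFinM.
rewrite ge0_integralZl_EFin//; last first.
  by apply/measurable_EFinP; exact: measurable_indic.
rewrite integral_indic ?setIT; [|exact: measurableT|exact: measurable_itv].
rewrite [X in _ * X](lebesgue_measure_itv `]x, y])/= lte_fin EFinM.
case: ltP => [_|yx]; first by rewrite EFinB.
by congr (_ * _); rewrite (_ : y = x) ?subrr//; apply/eqP; rewrite eq_le xy yx.
Qed.

Lemma measurable_itv_weight (c x y : R) :
  measurable_fun setT (fun s => (c * \1_(`]x, y] : set (measurableTypeR R)) s)%:E).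
Proof.
by apply/measurable_EFinP; apply: measurable_funM => //; exact: measurable_indic.
Qed.

Lemma integral_4_itv_weights (c1 c2 c3 c4 x1 y1 x2 y2 x3 y3 x4 y4 : R) :
  (0 <= c1)%R -> (0 <= c2)%R -> (0 <= c3)%R -> (0 <= c4)%R ->
  (x1 <= y1)%R -> (x2 <= y2)%R -> (x3 <= y3)%R -> (x4 <= y4)%R ->
  \int[mu]_s ((c1 * \1_(`]x1, y1] : set (measurableTypeR R)) s)%:E +
    (c2 * \1_(`]x2, y2] : set (measurableTypeR R)) s)%:E +
    (c3 * \1_(`]x3, y3] : set (measurableTypeR R)) s)%:E +
    (c4 * \1_(`]x4, y4] : set (measurableTypeR R)) s)%:E) =
  (c1 * (y1 - x1) + c2 * (y2 - x2) + c3 * (y3 - x3) + c4 * (y4 - x4))%:E.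
Proof.
move=> c10 c20 c30 c40 xy1 xy2 xy3 xy4.
have w0 (c x y : R) s : (0 <= c)%R ->
    0 <= (c * \1_(`]x, y] : set (measurableTypeR R)) s)%:E.
  by move=> c0; rewrite lee_fin mulr_ge0.
rewrite ge0_integralD//; last 4 first.
- by move=> s _; rewrite !adde_ge0// w0.
- by apply: emeasurable_funD; [apply: emeasurable_funD|]; exact: measurable_itv_weight.
- by move=> s _; exact: w0.
- exact: measurable_itv_weight.
rewrite ge0_integralD//; last 4 first.
- by move=> s _; rewrite !adde_ge0// w0.
- by apply: emeasurable_funD; exact: measurable_itv_weight.
- by move=> s _; exact: w0.
- exact: measurable_itv_weight.
rewrite ge0_integralD//; last 4 first.
- by move=> s _; exact: w0.
- exact: measurable_itv_weight.
- by move=> s _; exact: w0.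
- exact: measurable_itv_weight.
by rewrite !integral_itv_weight.
Qed.

End interval_weights.

Lemma second_moment_arith {R : realFieldType} (x y m1 a' a t T0 Q : R) :
  0 < t -> 0 <= a -> y <= a' ^+ 2 * t ^+ 2 + 4 * T0 * t -> a * t <= m1 + Q ->
  x + 2 * a / t * m1 = t ^- 2 * y + a ^+ 2 ->
  x <= a' ^+ 2 - a ^+ 2 + (4 * T0 + 2 * a * Q) / t.
Proof.
move=> t0 a0 hy hm hx.
have -> : x = t ^- 2 * y + a ^+ 2 - 2 * a / t * m1 by rewrite -hx addrK.
have h1 : t ^- 2 * y <= a' ^+ 2 + 4 * T0 / t.
  rewrite (_ : a' ^+ 2 + _ = t ^- 2 * (a' ^+ 2 * t ^+ 2 + 4 * T0 * t)).
    by rewrite ler_wpM2l// invr_ge0 exprn_ge0// ltW.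
  by field; rewrite gt_eqF.
have h2 : 2 * a ^+ 2 - 2 * a * Q / t <= 2 * a / t * m1.
  rewrite (_ : 2 * a ^+ 2 - _ = 2 * a / t * (a * t - Q)).
    by rewrite ler_wpM2l ?lerBlDr// divr_ge0 ?mulr_ge0// ltW.
  by field; rewrite gt_eqF.
rewrite (_ : (4 * T0 + 2 * a * Q) / t = 4 * T0 / t + 2 * a * Q / t); last by rewrite mulrDl.
lra.
Qed.

Lemma le_sum4 {R : realDomainType} (x1 x2 x3 x4 : R) :
  0 <= x1 -> 0 <= x2 -> 0 <= x3 -> 0 <= x4 ->
  [/\ x1 <= x1 + x2 + x3 + x4, x2 <= x1 + x2 + x3 + x4,
      x3 <= x1 + x2 + x3 + x4 & x4 <= x1 + x2 + x3 + x4].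
Proof. by move=> *; split; lra. Qed.

Section time_average.
Context {R : realType}.
Local Notation mu := (@lebesgue_measure R).
Local Open Scope ereal_scope.
Context {d : measure_display} {Omega : measurableType d}.
Variables (P : probability Omega R) (E : R -> Omega -> R).
Hypothesis mE : measurable_fun setT (fun z : R * Omega => E z.1 z.2).
Hypothesis E01 : forall s w, (0 <= E s w <= 1)%R.
Variables (b : R -> R) (T0 a' : R).
Hypothesis b1 : forall t, (0 <= t)%R -> (0 <= b t <= 1)%R.
Hypothesis T00 : (0 <= T0)%R.
Hypothesis ba : forall t, (T0 <= t)%R -> (b t <= a')%R.
Hypothesis mean_le : forall t, (0 <= t)%R -> \int[P]_w (E t w)%:E <= (b t)%:E.
Hypothesis corr_le : forall r t, (0 <= r)%R -> (0 <= t)%R ->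
  \int[P]_w (E r w * E (r + t)%R w)%:E <= (b t)%:E * \int[P]_w (E r w)%:E.

Let E0 s w : (0 <= E s w)%R. Proof. by case/andP: (E01 s w). Qed.
Let E1 s w : (E s w <= 1)%R. Proof. by case/andP: (E01 s w). Qed.

Local Notation ind x y := (\1_(`]x%R, y%R] : set (measurableTypeR R)) : measurableTypeR R -> R).

Definition time_integral t w : \bar R := \int[mu]_(s in `]0%R, t]) (E s w)%:E.

Let J t s w : R := (ind 0 t s * E s w)%R.

Let J0 t s w : (0 <= J t s w)%R. Proof. by rewrite mulr_ge0. Qed.

Let mJ t : measurable_fun setT (fun z : measurableTypeR R * Omega => J t z.1 z.2).
Proof.
by apply: measurable_funM => //; apply: measurableT_comp.
Qed.

Let time_integralE t w : time_integral t w = \int[mu]_s (J t s w)%:E.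
Proof.
rewrite /time_integral integral_mkcond; apply: eq_integral => s _.
by rewrite patchE /J indicE; case: ifPn; rewrite ?mul1r ?mul0r.
Qed.

Lemma time_integral_ge0 t w : 0 <= time_integral t w.
Proof. by apply: integral_ge0 => s _; rewrite lee_fin. Qed.

Lemma time_integral_le t w : (0 <= t)%R -> time_integral t w <= t%:E.
Proof.
move=> t0; rewrite time_integralE -[leRHS]/(t%:E).
have <- : \int[mu]_s (1 * ind 0 t s)%:E = t%:E by rewrite integral_itv_weight// subr0 mul1r.
apply: ge0_le_integral_nomeas => s _; rewrite lee_fin//.
by rewrite mul1r ler_piMr.
Qed.

Lemma measurable_time_integral t : measurable_fun setT (time_integral t).
Proof.
rewrite (_ : time_integral t = fun w => \int[mu]_s (J t s w)%:E); last first.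
  by apply/funext => w; exact: time_integralE.
apply: (measurable_fun_fubini_tonelli_G (m1 := mu)
  (fun z : measurableTypeR R * Omega => (J t z.1 z.2)%:E)) => //.
- exact/measurable_EFinP.
- by move=> z; rewrite lee_fin.
Qed.

Let EJ (t r s : R) := \int[P]_w (J t r w * J t s w)%:E.

Let pair_mean_le1 t r s : EJ t r s <= (ind 0 t r * ind 0 t s)%:E.
Proof.
apply: (@le_trans _ _ (\int[P]_w (cst (ind 0 t r * ind 0 t s)%:E w))).
  apply: ge0_le_integral_nomeas => w _; rewrite lee_fin ?mulr_ge0//.
  by rewrite ler_pM// ler_piMr.
by rewrite integral_probability_cst.
Qed.

Let pair_mean_le r t : (T0 <= r)%R -> (T0 <= t)%R ->
  \int[P]_w (E r w * E (r + t)%R w)%:E <= (a' ^+ 2)%:E.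
Proof.
move=> Tr Tt; have r0 := le_trans T00 Tr; have t0 := le_trans T00 Tt.
apply: (le_trans (corr_le _ _ r0 t0)).
have bt0 : (0 <= b t)%R by case/andP: (b1 t t0).
apply: (@le_trans _ _ ((b t)%:E * (b r)%:E)).
  by apply: lee_wpmul2l; rewrite ?lee_fin// mean_le.
by rewrite -EFinM lee_fin expr2 ler_pM ?ba//; case/andP: (b1 r r0).
Qed.

Let pair_mean_bound t r s : (0 <= t)%R ->
  EJ t r s <= (ind 0 t r * a' ^+ 2 * ind 0 t s)%:E + (ind 0 T0 r * ind 0 t s)%:E +
    (ind 0 t r * ind 0 T0 s)%:E + (ind 0 t r * ind (r - T0) (r + T0) s)%:E.
Proof.
move=> t0; rewrite -!EFinD.
have w0 (x y z v : R) : (0 <= ind x y r * ind z v s)%R by rewrite mulr_ge0.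
have aw0 : (0 <= ind 0 t r * a' ^+ 2 * ind 0 t s)%R.
  by rewrite mulr_ge0// mulr_ge0// sqr_ge0.
have [p1 p2 p3 p4] := le_sum4 _ _ _ _ aw0 (w0 0%R T0 0%R t) (w0 0%R t 0%R T0)
  (w0 0%R t (r - T0)%R (r + T0)%R).
have [rt|rt] := boolP (r \in (`]0%R, t]%classic : set (measurableTypeR R))); last first.
  apply: le_trans (pair_mean_le1 t r s) _; rewrite lee_fin; apply: le_trans p1.
  by rewrite [leLHS](_ : _ = 0%R)// indicE (negPf rt) mul0r.
have [st|st] := boolP (s \in (`]0%R, t]%classic : set (measurableTypeR R))); last first.
  apply: le_trans (pair_mean_le1 t r s) _; rewrite lee_fin; apply: le_trans p1.
  by rewrite [leLHS](_ : _ = 0%R)// [X in (_ * X)%R]indicE (negPf st) mulr0.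
move: (rt) (st); rewrite !inE/= !in_itv/= => /andP[r0 rlt] /andP[s0 slt].
have i1 : ind 0 t r = 1%R by rewrite indicE rt.
have i2 : ind 0 t s = 1%R by rewrite indicE st.
have le1 : EJ t r s <= 1%:E by have := pair_mean_le1 t r s; rewrite i1 i2 mulr1.
have EJE : EJ t r s = \int[P]_w (E r w * E s w)%:E.
  by apply: eq_integral => w _; rewrite /J i1 i2 !mul1r.
have [rT|rT] := leP r T0.
  apply: le_trans le1 _; rewrite lee_fin; apply: le_trans p2.
  by rewrite i2 mulr1 indicE mem_set//= in_itv/= r0 rT.
have [sT|sT] := leP s T0.
  apply: le_trans le1 _; rewrite lee_fin; apply: le_trans p3.
  by rewrite i1 mul1r indicE mem_set//= in_itv/= s0 sT.
have [rsT|rsT] := boolP (s \in (`](r - T0)%R, (r + T0)%R]%classic : set (measurableTypeR R))).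
  apply: le_trans le1 _; rewrite lee_fin; apply: le_trans p4.
  by rewrite i1 mul1r indicE rsT.
apply: (@le_trans _ _ (a' ^+ 2)%:E); last first.
  by rewrite lee_fin; apply: le_trans p1; rewrite i1 i2 mul1r mulr1.
rewrite EJE.
move: rsT; rewrite notin_setE/= in_itv/= => /negP; rewrite negb_and -leNgt -ltNge.
case/orP => [h|h].
  under eq_integral do rewrite mulrC.
  rewrite (_ : r = s + (r - s))%R; last by rewrite addrC subrK.
  by apply: pair_mean_le; [exact: ltW|rewrite lerBrDl -lerBrDr].
rewrite (_ : s = r + (s - r))%R; last by rewrite addrC subrK.
by apply: pair_mean_le; [exact: ltW|rewrite lerBrDl ltW].
Qed.

(** The double time integral of the correlations: outside the strips where
    [r <= T0], [s <= T0] or [|r - s| <= T0] a correlation is at most [a'^2], and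
    inside it is at most 1. The strips have area of order [t]. *)
Lemma second_moment_le t : (0 <= t)%R ->
  \int[P]_w (time_integral t w * time_integral t w) <= (a' ^+ 2 * t ^+ 2 + 4 * T0 * t)%:E.
Proof.
move=> t0.
pose H w := \int[mu]_s (J t s w)%:E.
have H0 w : 0 <= H w by apply: integral_ge0 => s _; rewrite lee_fin.
have mH : measurable_fun setT H.
  rewrite (_ : H = time_integral t); first exact: measurable_time_integral.
  by apply/funext => w; rewrite time_integralE.
have mJE : measurable_fun setT (fun z : measurableTypeR R * Omega => (J t z.1 z.2)%:E).
  exact/measurable_EFinP.
have mJs w : measurable_fun setT (fun s : measurableTypeR R => (J t s w)%:E).
  exact: (measurableT_comp mJE (measurable_pair2 w)).
have mJr r : measurable_fun setT (fun w => (J t r w)%:E).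
  exact: (measurableT_comp mJE (measurable_pair1 r)).
have step1 : \int[P]_w (time_integral t w * time_integral t w) =
    \int[mu]_r \int[P]_w ((J t r w)%:E * H w).
  rewrite (fubini_tonelli (m1 := mu) (m2 := P) (fun z => (J t z.1 z.2)%:E * H z.2)).
  - apply: eq_integral => w _; rewrite !time_integralE -/(H w).
    by rewrite -ge0_integralZr// => s _; rewrite lee_fin.
  - by apply: emeasurable_funM => //; exact: measurableT_comp.
  - by move=> z; rewrite mule_ge0 ?lee_fin.
have step2 r : \int[P]_w ((J t r w)%:E * H w) = \int[mu]_s EJ t r s.
  rewrite /EJ (fubini_tonelli (m1 := mu) (m2 := P) (fun z => (J t r z.2 * J t z.1 z.2)%:E)).
  - apply: eq_integral => w _; rewrite -ge0_integralZl_EFin//.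
    by move=> s _; rewrite lee_fin.
  - under eq_fun do rewrite EFinM.
    apply: (@emeasurable_funM _ _ _ setT (fun z => (J t r z.2)%:E)); last exact: mJE.
    by apply: (measurableT_comp (mJr r)).
  - by move=> z; rewrite lee_fin mulr_ge0.
rewrite step1.
under eq_integral do rewrite step2.
have a20 : (0 <= a' ^+ 2)%R by exact: sqr_ge0.
have i0 x y r : (0 <= ind x y r)%R by [].
apply: (@le_trans _ _ (\int[mu]_r (((a' ^+ 2 * t) * ind 0 t r)%:E + (t * ind 0 T0 r)%:E +
    (T0 * ind 0 t r)%:E + (2 * T0 * ind 0 t r)%:E))).
  apply: ge0_le_integral_nomeas => r _.
    apply: integral_ge0 => s _; apply: integral_ge0 => w _.
    by rewrite lee_fin mulr_ge0.
  apply: (@le_trans _ _ (\int[mu]_s ((ind 0 t r * a' ^+ 2 * ind 0 t s)%:E + (ind 0 T0 r * ind 0 t s)%:E +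
    (ind 0 t r * ind 0 T0 s)%:E + (ind 0 t r * ind (r - T0) (r + T0) s)%:E))).
    apply: ge0_le_integral_nomeas => s _; last exact: pair_mean_bound.
    by apply: integral_ge0 => w _; rewrite lee_fin mulr_ge0.
  rewrite integral_4_itv_weights//; last 2 first.
  - by rewrite mulr_ge0.
  - by rewrite lerD2l ge0_cp.
  rewrite -!EFinD lee_fin !subr0.
  move: (i0 0%R t r) (i0 0%R T0 r).
  set x := ind 0 t r; set y := ind 0 T0 r => x0 y0.
  rewrite (_ : r + T0 - (r - T0) = 2 * T0)%R; last by ring.
  by rewrite le_eqVlt; apply/orP; left; apply/eqP; ring.
have c1 : (0 <= a' ^+ 2 * t)%R by exact: mulr_ge0.
have c4 : (0 <= 2 * T0)%R by exact: mulr_ge0.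
rewrite (integral_4_itv_weights (a' ^+ 2 * t) t T0 (2 * T0))//.
rewrite lee_fin !subr0.
by rewrite le_eqVlt; apply/orP; left; apply/eqP; ring.
Qed.

Section deviation.
Variables (a Q : R) (q : R -> \bar R).
Hypotheses (a0 : (0 <= a)%R) (q0 : forall s, 0 <= q s) (mq : measurable_fun setT q).
Hypothesis qQ : \int[mu]_s q s <= Q%:E.
Hypothesis mean_ge : forall s, (0 <= s)%R -> a%:E <= \int[P]_w (E s w)%:E + q s.

Lemma first_moment_ge t : (0 <= t)%R ->
  (a * t)%:E <= \int[P]_w time_integral t w + Q%:E.
Proof.
move=> t0.
have mJE : measurable_fun setT (fun z : measurableTypeR R * Omega => (J t z.1 z.2)%:E).
  exact/measurable_EFinP.
have JE0 (z : measurableTypeR R * Omega) : 0 <= (J t z.1 z.2)%:E by rewrite lee_fin.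
have -> : \int[P]_w time_integral t w = \int[mu]_s \int[P]_w (J t s w)%:E.
  rewrite (fubini_tonelli (m1 := mu) (m2 := P) (fun z => (J t z.1 z.2)%:E))//.
  by apply: eq_integral => w _; exact: time_integralE.
apply: (@le_trans _ _ (\int[mu]_s (\int[P]_w (J t s w)%:E + q s))); last first.
  rewrite ge0_integralD//; first by rewrite leeD2l.
  - by move=> s _; apply: integral_ge0 => w _; rewrite lee_fin.
  - exact: (measurable_fun_fubini_tonelli_F (m2 := P) (fun z => (J t z.1 z.2)%:E)).
have -> : (a * t)%:E = \int[mu]_s (a * ind 0 t s)%:E.
  by rewrite integral_itv_weight// subr0.
apply: ge0_le_integral_nomeas => s _; first by rewrite lee_fin mulr_ge0.
have [st|st] := boolP (s \in (`]0%R, t]%classic : set (measurableTypeR R))); last first.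
  rewrite [leLHS](_ : _ = 0); last by rewrite indicE (negPf st) mulr0.
  by apply: adde_ge0 => //; apply: integral_ge0 => w _; rewrite lee_fin.
have i1 : ind 0 t s = 1%R by rewrite indicE st.
rewrite i1 mulr1 (eq_integral (fun w => (E s w)%:E)); last first.
  by move=> w _; rewrite /J i1 mul1r.
by apply: mean_ge; move: st; rewrite inE/= in_itv/= => /andP[/ltW].
Qed.

(** Expand the square; the mean enters with a negative sign, whence the need of a
    lower bound on it. *)
Lemma square_deviation_le t : (0 < t)%R ->
  \int[P]_w ((fine (time_integral t w) / t - a) ^+ 2)%:E <=
  (a' ^+ 2 - a ^+ 2 + (4 * T0 + 2 * a * Q) / t)%:E.
Proof.
move=> t0; have t0' := ltW t0.
have Hfin w : time_integral t w \is a fin_num.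
  rewrite ge0_fin_numE ?time_integral_ge0//.
  by apply: le_lt_trans (time_integral_le t w t0') _; rewrite ltry.
pose h w := fine (time_integral t w).
have mh : measurable_fun setT h.
  exact: (measurableT_comp (@fine_measurable R _ measurableT) (measurable_time_integral t)).
have h0 w : (0 <= h w)%R by exact: fine_ge0 (time_integral_ge0 t w).
have hE w : time_integral t w = (h w)%:E by rewrite fineK.
have EH1 : \int[P]_w time_integral t w = \int[P]_w (h w)%:E by apply: eq_integral => w _.
have := first_moment_ge t t0'; have := second_moment_le t t0'.
rewrite EH1; under eq_integral do rewrite hE -EFinM.
have m1fin : \int[P]_w (h w)%:E \is a fin_num.
  rewrite ge0_fin_numE; last by apply: integral_ge0 => w _; rewrite lee_fin.
  apply: (@le_lt_trans _ _ (\int[P]_w (cst t%:E w))).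
    apply: ge0_le_integral_nomeas => w _; first by rewrite lee_fin.
    by rewrite -hE; exact: time_integral_le.
  by rewrite integral_cst// [X in _ * X](probability_setT P) mule1 ltry.
set m2 := \int[P]_w (h w * h w)%:E; move=> m2le m1ge.
have split_mean : \int[P]_w ((h w / t - a) ^+ 2)%:E + (2 * a / t)%:E * \int[P]_w (h w)%:E =
    (t ^- 2)%:E * m2 + (a ^+ 2)%:E.
  rewrite -ge0_integralZl_EFin//; last 3 first.
  - by move=> w _; rewrite lee_fin.
  - exact/measurable_EFinP.
  - by rewrite divr_ge0// mulr_ge0.
  rewrite -ge0_integralD//; last 4 first.
  - by move=> w _; rewrite lee_fin sqr_ge0.
  - apply/measurable_EFinP; apply: measurable_funX; apply: measurable_funB => //.
    exact: measurable_funM.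
  - by move=> w _; rewrite -EFinM lee_fin mulr_ge0// divr_ge0// mulr_ge0.
  - by apply: emeasurable_funM => //; exact/measurable_EFinP.
  rewrite /m2 -ge0_integralZl_EFin//; last 3 first.
  - by move=> w _; rewrite lee_fin mulr_ge0.
  - by apply/measurable_EFinP; exact: measurable_funM.
  - by rewrite invr_ge0 exprn_ge0.
  have <- : \int[P]_w (cst (a ^+ 2)%:E w) = (a ^+ 2)%:E.
    exact: integral_probability_cst.
  rewrite -ge0_integralD//; last 3 first.
  - by move=> w _; rewrite -EFinM lee_fin mulr_ge0 ?mulr_ge0// invr_ge0 exprn_ge0.
  - apply: emeasurable_funM => //; apply/measurable_EFinP; exact: measurable_funM.
  - by move=> w _; rewrite lee_fin sqr_ge0.
  apply: eq_integral => w _; rewrite -!EFinM -!EFinD; congr EFin.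
  by field; rewrite gt_eqF.
have dev0 : 0 <= \int[P]_w ((h w / t - a) ^+ 2)%:E.
  by apply: integral_ge0 => w _; rewrite lee_fin sqr_ge0.
move: m1ge split_mean; rewrite -(fineK m1fin); set m1 := fine _.
have m20 : 0 <= m2 by apply: integral_ge0 => w _; rewrite lee_fin mulr_ge0.
move: dev0 m20 m2le; rewrite /h; case: (\int[P]_w _) => [x||]//; case: m2 => [y||]//.
rewrite -!EFinM -!EFinD !lee_fin => x0 y0 yle m1ge [E1'].
exact: (second_moment_arith x y m1 a' a t T0 Q).
Qed.

End deviation.
End time_average.

(** * From damped paths to occupation times *)

Section laplace_estimates.
Context {R : realType}.
Local Notation mu := (@lebesgue_measure R).
Local Open Scope ereal_scope.
Context {d : measure_display} {Omega : measurableType d}.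
Variables (P : probability Omega R) (X : R -> Omega -> R).
Hypothesis mX : measurable_fun setT (fun z : R * Omega => X z.1 z.2).
Hypothesis X0 : forall s w, (0 <= X s w)%R.

Definition damped (la : R) s w : R := expR (- (la * X s w)).

(** What the branching process provides at scale [la]: [A] is the total exponent,
    [b] the immigration factor and [q] the contribution of the initial state. *)
Record laplace_estimate (c C la A : R) (b : R -> R) (q : R -> \bar R) : Prop := {
  le_A : (0 <= A <= la * c)%R ;
  le_b01 : forall t, (0 <= t)%R -> (expR (- A) <= b t <= 1)%R ;
  le_b_cvg : forall e : R, (0 < e)%R -> exists2 T0 : R, (0 <= T0)%R &
    forall t, (T0 <= t)%R -> (b t <= expR (e - A))%R ;
  le_q0 : forall s, 0 <= q s ;
  le_mq : measurable_fun setT q ;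
  le_q : \int[mu]_s q s <= (la * C)%:E ;
  le_mean : forall s, (0 <= s)%R ->
    \int[P]_w (damped la s w)%:E = (expR (- fine (q s)) * b s)%:E ;
  le_corr : forall r t, (0 <= r)%R -> (0 <= t)%R ->
    \int[P]_w (damped la r w * damped la (r + t)%R w)%:E <=
    (b t)%:E * \int[P]_w (damped la r w)%:E }.

Lemma damped_itv la s w : (0 <= la)%R -> (0 <= damped la s w <= 1)%R.
Proof.
by move=> la0; rewrite expR_ge0/= -expR0 ler_expR oppr_le0 mulr_ge0.
Qed.

Lemma measurable_damped la : measurable_fun setT (fun z : R * Omega => damped la z.1 z.2).
Proof.
apply: (measurableT_comp (@measurable_expR R)).
by apply: measurableT_comp => //; exact: measurable_funM.
Qed.

Section one_scale.
Variables (c C la A : R) (b : R -> R) (q : R -> \bar R).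
Hypotheses (la0 : (0 < la)%R) (H : laplace_estimate c C la A b q).

Lemma mean_damped_le s : (0 <= s)%R -> \int[P]_w (damped la s w)%:E <= (b s)%:E.
Proof.
move=> s0; rewrite (le_mean _ _ _ _ _ _ H s s0) lee_fin ler_piMl//.
  have /andP[+ _] := le_b01 _ _ _ _ _ _ H s s0.
  by apply: le_trans; exact: expR_ge0.
by rewrite -expR0 ler_expR oppr_le0 fine_ge0// (le_q0 _ _ _ _ _ _ H).
Qed.

Lemma mean_damped_ge s : (0 <= s)%R ->
  (expR (- A))%:E <= \int[P]_w (damped la s w)%:E + q s.
Proof.
move=> s0; rewrite (le_mean _ _ _ _ _ _ H s s0).
have := le_q0 _ _ _ _ _ _ H s; have /andP[b0 b1] := le_b01 _ _ _ _ _ _ H s s0.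
have Aa : (expR (- A) <= 1)%R by exact: le_trans b1.
have := expR_ge0 (- A); set a := expR (- A) in b0 Aa *; move: (b s) b0 b1 => x x0 x1 a0.
case: (q s) => [y||]//=; last by move=> _; rewrite leey.
rewrite -EFinD !lee_fin => y0.
have := one_sub_expRN_le y; have := expR_ge0 (- y); set z := expR (- y) => z0 z1.
have h : (z * a <= z * x)%R by exact: ler_wpM2l.
have h2 : ((1 - z) * a <= 1 - z)%R by rewrite ler_piMr// one_sub_expRN_ge0.
apply: (@le_trans _ _ (z * a + (1 - z) * a)%R); first by lra.
by rewrite lerD//; exact: le_trans h2 z1.
Qed.

(** At time [s] the mean of [1 - exp(- la X)] is at most [q s + A], and [q] has
    integral at most [la C]. *)
Lemma mean_undamped_le t : (0 <= t)%R ->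
  \int[P]_w \int[mu]_(s in `]0%R, t]) (la^-1 * (1 - damped la s w))%:E <=
  (c * t + C)%:E.
Proof.
move=> t0; have la0' := ltW la0.
have d01 s w := damped_itv la s w la0'.
have g0 s w : (0 <= la^-1 * (1 - damped la s w))%R.
  by rewrite mulr_ge0 ?invr_ge0// subr_ge0; case/andP: (d01 s w).
pose D : set (measurableTypeR R) := `]0%R, t]%classic.
pose k (z : measurableTypeR R * Omega) := (\1_D z.1 * (la^-1 * (1 - damped la z.1 z.2)))%R.
have k0 z : (0 <= k z)%R by exact: mulr_ge0.
have mD : measurable D by exact: measurable_itv.
have mk : measurable_fun setT k.
  apply: measurable_funM; first exact: (measurableT_comp (@measurable_indic _ _ R _ D mD)).
  apply: measurable_funM => //; apply: measurable_funB => //.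
  exact: measurable_damped.
have -> : \int[P]_w \int[mu]_(s in D) (la^-1 * (1 - damped la s w))%:E =
    \int[mu]_s \int[P]_w (k (s, w))%:E.
  rewrite (fubini_tonelli (m1 := mu) (m2 := P) (fun z => (k z)%:E)).
  - apply: eq_integral => w _; rewrite integral_mkcond; apply: eq_integral => s _.
    by rewrite patchE /k indicE; case: ifPn; rewrite ?mul1r ?mul0r.
  - exact/measurable_EFinP.
  - by move=> z; rewrite lee_fin.
have mq := le_mq _ _ _ _ _ _ H; have q0 := le_q0 _ _ _ _ _ _ H.
have /andP[A0 Ac] := le_A _ _ _ _ _ _ H.
have c0 : (0 <= c)%R by rewrite -(pmulr_rge0 _ la0); exact: le_trans A0 Ac.
have li0 : (0 <= la^-1)%R by rewrite invr_ge0.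
apply: (@le_trans _ _ (\int[mu]_s ((c * (\1_D : measurableTypeR R -> R) s)%:E + (la^-1)%:E * q s))); last first.
  rewrite ge0_integralD//; last 4 first.
  - by move=> s _; rewrite lee_fin mulr_ge0.
  - exact: measurable_itv_weight.
  - by move=> s _; rewrite mule_ge0// lee_fin.
  - exact: emeasurable_funM.
  rewrite integral_itv_weight// subr0 EFinD leeD2l//.
  rewrite ge0_integralZl_EFin//.
  apply: (@le_trans _ _ ((la^-1)%:E * (la * C)%:E)).
    by apply: lee_wpmul2l; rewrite ?lee_fin//; exact: (le_q _ _ _ _ _ _ H).
  by rewrite -EFinM mulKf// gt_eqF.
apply: ge0_le_integral_nomeas => s _; first by apply: integral_ge0 => w _; rewrite lee_fin.
have [sD|sD] := boolP (s \in D); last first.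
  rewrite integral0_eq => [|w _]; last by rewrite /k indicE (negPf sD) mul0r.
  by rewrite adde_ge0// ?lee_fin ?mulr_ge0// mule_ge0// lee_fin.
have s0 : (0 <= s)%R by move: sD; rewrite inE /D/= in_itv/= => /andP[/ltW].
have kE w : k (s, w) = (la^-1 * (1 - damped la s w))%R by rewrite /k indicE sD mul1r.
under eq_integral do rewrite kE EFinM.
have md : measurable_fun setT (damped la s).
  exact: (measurableT_comp (measurable_damped la) (measurable_pair1 s)).
rewrite ge0_integralZl_EFin//; last 2 first.
- by move=> w _; rewrite lee_fin subr_ge0; case/andP: (d01 s w).
- by apply/measurable_EFinP; exact: measurable_funB.
have one : \int[P]_w (1 - damped la s w)%:E + \int[P]_w (damped la s w)%:E = 1.
  rewrite -ge0_integralD//; last 4 first.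
  - by move=> w _; rewrite lee_fin subr_ge0; case/andP: (d01 s w).
  - by apply/measurable_EFinP; exact: measurable_funB.
  - by move=> w _; rewrite lee_fin; case/andP: (d01 s w).
  - exact/measurable_EFinP.
  under eq_integral do rewrite -EFinD subrK.
  exact: integral_probability_cst.
have := mean_damped_ge s s0; move: one.
have i0 : 0 <= \int[P]_w (1 - damped la s w)%:E.
  by apply: integral_ge0 => w _; rewrite lee_fin subr_ge0; case/andP: (d01 s w).
move: i0; rewrite (le_mean _ _ _ _ _ _ H s s0) indicE sD mulr1.
set m := (expR _ * b s)%R; move: (q0 s).
case: (\int[P]_w _) => [x||]//; case: (q s) => [y||]//; last first.
  by move=> _ _ _ _; rewrite gt0_muley ?lte_fin ?invr_gt0// addey// leey.
rewrite -!EFinM -!EFinD !lee_fin => y0 x0 [xm] h.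
have hA : (A <= la * c)%R by [].
have := expR_ge1Dx (- A); move=> h1.
rewrite ler_pdivrMl// [leRHS]mulrDr mulVKf ?gt_eqF//.
lra.
Qed.

End one_scale.
End laplace_estimates.

Section undamping.
Context {R : realType}.
Local Notation mu := (@lebesgue_measure R).
Local Open Scope ereal_scope.

Lemma damping_slope_cvg (x : R) : (0 <= x)%R ->
  ((n.+1%:R^-1)^-1 * (1 - expR (- (n.+1%:R^-1 * x))))%R @[n --> \oo] --> x.
Proof.
move=> x0.
have lo n : ((1 - n.+1%:R^-1 * x) * x <= (n.+1%:R^-1)^-1 * (1 - expR (- (n.+1%:R^-1 * x))) :> R)%R.
  have l0 : (0 < n.+1%:R^-1 :> R)%R by rewrite invr_gt0.
  rewrite ler_pdivlMl// mulrCA; apply: one_sub_expRN_ge.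
  by rewrite mulr_ge0// ltW.
have hi n : ((n.+1%:R^-1)^-1 * (1 - expR (- (n.+1%:R^-1 * x))) <= x :> R)%R.
  have l0 : (0 < n.+1%:R^-1 :> R)%R by rewrite invr_gt0.
  by rewrite ler_pdivrMl// one_sub_expRN_le.
apply: (@squeeze_cvgr _ _ _ _ (fun n => (1 - n.+1%:R^-1 * x) * x)%R (cst x)).
- by apply: nearW => n; rewrite lo hi.
- rewrite [X in _ --> X](_ : _ = (1 - 0 * x) * x)%R; last by rewrite mul0r subr0 mul1r.
  apply: cvgM; last exact: cvg_cst.
  apply: cvgB; first exact: cvg_cst.
  by apply: cvgM; [exact: cvg_harmonic|exact: cvg_cst].
- exact: cvg_cst.
Qed.

Context {d : measure_display} {Omega : measurableType d}.

(** As [la] tends to 0 the function [(1 - exp(- la x)) / la] tends to [x]; Fatou's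
    lemma is applied in time and then in probability. *)
Lemma mean_time_integral_le (P : probability Omega R) (X : R -> Omega -> R) (B : \bar R) (t : R) :
  measurable_fun setT (fun z : R * Omega => X z.1 z.2) ->
  (forall s w, (0 <= X s w)%R) ->
  (forall la : R, (0 < la)%R ->
    \int[P]_w \int[mu]_(s in `]0%R, t]) (la^-1 * (1 - damped X la s w))%:E <= B) ->
  \int[P]_w time_integral X t w <= B.
Proof.
move=> mX X0 hB.
pose D : set (measurableTypeR R) := `]0%R, t]%classic.
have mD : measurable D by exact: measurable_itv.
have l0 n : (0 < n.+1%:R^-1 :> R)%R by rewrite invr_gt0.
pose k (n : nat) (z : measurableTypeR R * Omega) : \bar R :=
  ((n.+1%:R^-1)^-1 * (1 - damped X n.+1%:R^-1 z.1 z.2))%:E.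
have k0 n z : 0 <= k n z.
  rewrite lee_fin mulr_ge0 ?invr_ge0// subr_ge0.
  by have /andP[] := damped_itv X X0 (n.+1%:R^-1)%R z.1 z.2 (ltW (l0 n)).
have mk n : measurable_fun setT (k n).
  apply/measurable_EFinP; apply: measurable_funM => //; apply: measurable_funB => //.
  exact: measurable_damped.
have mI n : measurable_fun setT (fun w => \int[mu]_(s in D) k n (s, w)).
  rewrite (_ : (fun w => _) = fun w => \int[mu]_s ((\1_D s)%:E * k n (s, w))).
    apply: (measurable_fun_fubini_tonelli_G (m1 := mu) (fun z => (\1_D z.1)%:E * k n z)).
    - apply: emeasurable_funM; last exact: mk.
      apply/measurable_EFinP; exact: (measurableT_comp (@measurable_indic _ _ R _ D mD)).
    - by move=> z; rewrite mule_ge0// lee_fin.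
  apply/funext => w; rewrite integral_mkcond; apply: eq_integral => s _.
  by rewrite patchE indicE; case: ifPn; rewrite ?mul1e ?mul0e.
have hX s w : limn_einf (fun n => k n (s, w)) = (X s w)%:E.
  apply: (cvg_limn_einf_sup _).1; apply: cvg_EFin; first exact: nearW.
  exact: damping_slope_cvg.
apply: (@le_trans _ _ (\int[P]_w limn_einf (fun n => \int[mu]_(s in D) k n (s, w)))).
  apply: ge0_le_integral_nomeas => w _.
    by apply: integral_ge0 => s _; rewrite lee_fin.
  rewrite /time_integral (eq_integral (fun s => limn_einf (fun n => k n (s, w)))).
    apply: (fatou mu mD (f := fun n s => k n (s, w))) => // n.
    apply: measurable_funTS; exact: (measurableT_comp (mk n) (measurable_pair2 w)).
  by move=> s _; rewrite hX.
apply: le_trans (fatou P measurableT (f := fun n w => \int[mu]_(s in D) k n (s, w)) mI _) _.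
  by move=> n w _; apply: integral_ge0 => s _.
rewrite limn_einf_lim; apply: lime_le; first exact: is_cvg_einfs.
apply: nearW => n; apply: le_trans (hB (n.+1%:R^-1)%R (l0 n)).
apply: ereal_inf_lbound; exists n => //=.
Qed.

End undamping.

Section deviation_arithmetic.
Context {R : realType}.

Lemma two_normr_le (x th : R) : 0 < th -> 2 * `|x| <= th + x ^+ 2 / th.
Proof.
move=> th0; rewrite -subr_ge0.
have -> : th + x ^+ 2 / th - 2 * `|x| = (th - `|x|) ^+ 2 / th.
  by rewrite sqrrB real_normK ?num_real//; field; rewrite gt_eqF.
by rewrite divr_ge0 ?sqr_ge0// ltW.
Qed.

(** The gap between [z / t] and the smaller quantity [(1 - h / t) / la] is
    nonnegative, so it enters without an absolute value and its mean is a
    difference of means. *)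
Lemma deviation_split (z h t la th a c : R) : 0 < t -> 0 < la -> 0 < th ->
  t <= h + la * z ->
  `|z / t - c| + (1 - a) / la <=
  z / t + ((th + (h / t - a) ^+ 2 / th) / la + `|(1 - a) / la - c|).
Proof.
move=> t0 la0 th0 hz.
have h1 : (1 - h / t) / la <= z / t.
  rewrite ler_pdivrMr// mulrAC ler_pdivlMr// mulrBl mul1r divfK ?gt_eqF//.
  by rewrite lerBlDl mulrC.
have := two_normr_le (h / t - a) th th0; set x := h / t - a => h2.
have h3 : 2 * (`|x| / la) <= (th + x ^+ 2 / th) / la.
  by rewrite mulrA ler_pM2r// invr_gt0.
have h4 : (1 - h / t) / la = (1 - a) / la - x / la by rewrite -mulrBl /x; congr (_ / _); ring.
have h5 : `|x / la| = `|x| / la by rewrite normrM [X in _ * X]gtr0_norm// invr_gt0.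
rewrite h4 in h1; have := ler_norm (x / la); rewrite h5 => h6.
set k := (1 - a) / la in h1 *; set y := x / la in h1 h5 h6 *; rewrite -h5 in h3 h6.
set v := z / t in h1 *.
have : `|v - c| <= `|v - k + y| + `|y| + `|k - c|.
  rewrite (_ : v - c = (v - k + y) + (- y) + (k - c)); last by ring.
  by apply: le_trans (ler_normD _ _) _; rewrite lerD2r -[`|y|]normrN ler_normD.
rewrite [`|v - k + y|]ger0_norm; last by lra.
lra.
Qed.

(** From [(1 - A) A <= 1 - exp(-A) <= A]. *)
Lemma discount_rate_bounds (A la c e : R) : 0 < la <= e -> 0 <= A <= la * c ->
  la * (c - e) <= A ->
  c - e * (1 + c ^+ 2) <= (1 - expR (- A)) / la <= c.
Proof.
move=> /andP[la0 lae] /andP[A0 Ac] hA.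
rewrite ler_pdivlMr// ler_pdivrMr//; apply/andP; split; last first.
  by apply: le_trans (one_sub_expRN_le A) _; rewrite mulrC.
apply: le_trans (one_sub_expRN_ge A A0).
have c0 : 0 <= la * c := le_trans A0 Ac.
have AA : A * A <= la * c * (la * c) by exact: ler_pM.
have : la * c * (la * c) <= la * (e * c ^+ 2).
  rewrite -mulrA ler_pM2l// mulrCA expr2 ler_wpM2r//.
  by rewrite -expr2 sqr_ge0.
move=> hc.
have -> : (c - e * (1 + c ^+ 2)) * la = la * (c - e) - la * (e * c ^+ 2) by ring.
by rewrite mulrBl mul1r; apply: lerB => //; exact: le_trans AA hc.
Qed.

End deviation_arithmetic.

Section mean_ergodic.
Context {R : realType}.
Local Notation mu := (@lebesgue_measure R).
Local Open Scope ereal_scope.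
Context {d : measure_display} {Omega : measurableType d}.
Variables (P : probability Omega R) (X : R -> Omega -> R).
Hypothesis mX : measurable_fun setT (fun z : R * Omega => X z.1 z.2).
Hypothesis X0 : forall s w, (0 <= X s w)%R.
Variables c C : R.
Hypothesis C0 : (0 <= C)%R.
Hypothesis estimates : forall la : R, (0 < la)%R ->
  exists A b q, laplace_estimate P X c C la A b q.
Hypothesis sharp_estimates : forall e : R, (0 < e)%R ->
  exists la A b q, [/\ (0 < la <= e)%R, laplace_estimate P X c C la A b q &
    (la * (c - e) <= A)%R].

Lemma mean_occupation_le t : (0 <= t)%R ->
  \int[P]_w time_integral X t w <= (c * t + C)%:E.
Proof.
move=> t0; apply: mean_time_integral_le => // la la0.
have [A [b [q H]]] := estimates la la0.
exact: (mean_undamped_le P X mX X0 c C la A b q la0 H t t0).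
Qed.

Lemma measurable_occupation t : measurable_fun setT (time_integral X t).
Proof.
pose D : set (measurableTypeR R) := `]0%R, t]%classic.
have mD : measurable D by exact: measurable_itv.
rewrite (_ : time_integral X t = fun w => \int[mu]_s ((\1_D s)%:E * (X s w)%:E)).
  apply: (measurable_fun_fubini_tonelli_G (m1 := mu) (fun z : measurableTypeR R * Omega =>
    (\1_D z.1)%:E * (X z.1 z.2)%:E)).
  - apply: emeasurable_funM; last exact/measurable_EFinP.
    apply/measurable_EFinP; exact: (measurableT_comp (@measurable_indic _ _ R _ D mD)).
  - by move=> z; rewrite mule_ge0// lee_fin.
apply/funext => w; rewrite /time_integral integral_mkcond; apply: eq_integral => s _.
by rewrite patchE indicE; case: ifPn; rewrite ?mul1e ?mul0e.
Qed.

Lemma occupation_ge0 t w : 0 <= time_integral X t w.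
Proof. by apply: integral_ge0 => s _; rewrite lee_fin. Qed.

Lemma damped_occupation_ge la t w : (0 < la)%R -> (0 <= t)%R ->
  t%:E <= time_integral (damped X la) t w + la%:E * time_integral X t w.
Proof.
move=> la0 t0; have la0' := ltW la0.
pose D : set (measurableTypeR R) := `]0%R, t]%classic.
have mD : measurable D by exact: measurable_itv.
have mXw : measurable_fun D (fun s : measurableTypeR R => X s w).
  apply: measurable_funTS; exact: (measurableT_comp mX (measurable_pair2 w)).
have mdw : measurable_fun D (fun s : measurableTypeR R => damped X la s w).
  apply: measurable_funTS; exact: (measurableT_comp (measurable_damped X mX la) (measurable_pair2 w)).
rewrite /time_integral -/D -ge0_integralZl_EFin//; last 2 first.
- by move=> s _; rewrite lee_fin.
- exact/measurable_EFinP.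
rewrite -ge0_integralD//; last 4 first.
- by move=> s _; rewrite lee_fin expR_ge0.
- exact/measurable_EFinP.
- by move=> s _; rewrite mule_ge0// lee_fin.
- by apply: emeasurable_funM => //; exact/measurable_EFinP.
have tE : t%:E = mu D.
  rewrite [RHS](lebesgue_measure_itv `]0%R, t])/= lte_fin.
  case: ltP => [_|t0']; first by rewrite -EFinB subr0.
  by congr EFin; apply/eqP; rewrite eq_le t0 t0'.
rewrite tE -[leLHS]mul1e -(integral_cst mu mD 1).
apply: ge0_le_integral_nomeas => s _ //=.
rewrite -EFinM -EFinD lee_fin.
by have := one_sub_expRN_le (la * X s w); rewrite lerBlDl addrC.
Qed.

(** The integrated form of [deviation_split]. The scales are chosen as follows:
    [la <= e] makes [(1 - a) / la] close to [c]; [th = e la] in the inequality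
    [2 |x| <= th + x^2 / th] makes the contribution of [th] equal to [e]; and
    [eta] is such that [a'^2 - a^2 <= e^2 la^2], so that the second moment
    contributes [e] as well. The remaining terms are of order [1 / t]. *)
Lemma mean_deviation_cvg (eps : R) : (0 < eps)%R -> exists2 T : R, (0 < T)%R &
  forall t, (T <= t)%R ->
  \int[P]_w `|fine (time_integral X t w) / t - c|%:E <= eps%:E.
Proof.
move=> eps0.
pose e := (eps / (5 + 2 * c ^+ 2))%R.
have den0 : (0 < 5 + 2 * c ^+ 2)%R by have := sqr_ge0 c; lra.
have e0 : (0 < e)%R by rewrite divr_gt0.
have [la [A [b [q [/[dup] laI /andP[la0 lae] H hA]]]]] := sharp_estimates e e0.
have la0' := ltW la0.
pose a := expR (- A); pose dl := (e ^+ 2 * la ^+ 2)%R; pose eta := (ln (1 + dl) / 2)%R.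
have dl0 : (0 < dl)%R by rewrite mulr_gt0// exprn_gt0.
have eta0 : (0 < eta)%R by rewrite divr_gt0// ln_gt0// ltrDl.
have [T0 T00 hT0] := le_b_cvg _ _ _ _ _ _ _ _ H eta eta0.
pose a' := expR (eta - A).
have a01 : (0 <= a <= 1)%R.
  rewrite expR_ge0/= -expR0 ler_expR oppr_le0.
  by have /andP[] := le_A _ _ _ _ _ _ _ _ H.
have aa' : (a' ^+ 2 - a ^+ 2 <= dl)%R.
  have -> : (a' = expR eta * a)%R by rewrite /a' expRD.
  have e2 : (expR eta ^+ 2 = 1 + dl)%R.
    rewrite -expRM_natl /eta mulrC divfK// lnK// posrE; lra.
  rewrite exprMn e2 mulrDl mul1r addrC addKr.
  apply: ler_piMr; first exact: ltW.
  by case/andP: a01 => a0 a1; rewrite expr_le1.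
pose K := (4 * T0 + 2 * a * (la * C))%R.
have K0 : (0 <= K)%R.
  rewrite addr_ge0// ?mulr_ge0//; first by case/andP: a01.
pose Kt := ((C + K / (e * la ^+ 2)) / e)%R.
have Kt0 : (0 <= Kt)%R.
  have e0' := ltW e0.
  by rewrite divr_ge0// addr_ge0// divr_ge0// mulr_ge0// sqr_ge0.
exists (Kt + 1)%R => [|t Tt]; first by rewrite ltr_wpDl.
have t0 : (0 < t)%R by apply: lt_le_trans Tt; rewrite ltr_wpDl.
have t0' := ltW t0.
pose th := (e * la)%R.
have th0 : (0 < th)%R by exact: mulr_gt0.
pose h w := fine (time_integral (damped X la) t w).
have d01 s w := damped_itv X X0 la s w la0'.
have md := measurable_damped X mX la.
have hfin w : time_integral (damped X la) t w = (h w)%:E.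
  rewrite fineK// ge0_fin_numE; last exact: time_integral_ge0.
  apply: le_lt_trans (time_integral_le (damped X la) d01 t w t0') _.
  by rewrite ltry.
have dev : \int[P]_w ((h w / t - a) ^+ 2)%:E <= (a' ^+ 2 - a ^+ 2 + K / t)%:E.
  apply: (square_deviation_le P (damped X la) md d01 b T0 a' _ T00 _ _ _ a (la * C)%R q) => //.
  - move=> s s0; have /andP[b0 ->] := le_b01 _ _ _ _ _ _ _ _ H s s0.
    by rewrite andbT; apply: le_trans b0; exact: expR_ge0.
  - by move=> s s0; exact: (mean_damped_le P X c C la A b q H).
  - exact: (le_corr _ _ _ _ _ _ _ _ H).
  - by case/andP: a01.
  - exact: (le_q0 _ _ _ _ _ _ _ _ H).
  - exact: (le_mq _ _ _ _ _ _ _ _ H).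
  - exact: (le_q _ _ _ _ _ _ _ _ H).
  - by move=> s s0; exact: (mean_damped_ge P X c C la A b q H).
pose V w := (fine (time_integral X t w) / t)%R.
pose ka : R := `|(1 - a) / la - c|%R.
have ka0 : (0 <= ka)%R by exact: normr_ge0.
have mh : measurable_fun setT h.
  exact: (measurableT_comp (@fine_measurable R _ measurableT)
    (measurable_time_integral (damped X la) md d01 t)).
have mV : measurable_fun setT V.
  apply: measurable_funM => //.
  exact: (measurableT_comp (@fine_measurable R _ measurableT) (measurable_occupation t)).
have pathwise w : `|V w - c|%:E + ((1 - a) / la)%:E <=
    (t^-1)%:E * time_integral X t w +
    (((th + ka * la) / la)%:E + (th^-1 / la)%:E * ((h w / t - a) ^+ 2)%:E).
  have := occupation_ge0 t w; have := damped_occupation_ge la t w la0 t0'.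
  rewrite hfin /V; case: (time_integral X t w) => [z||]//=; last first.
    by move=> _ _; rewrite -EFinM -EFinD gt0_muley ?lte_fin ?invr_gt0// leey.
  rewrite -!EFinM -!EFinD !lee_fin => hz z0.
  apply: le_trans (deviation_split z (h w) t la th a c t0 la0 th0 hz) _.
  rewrite mulrC lerD2l le_eqVlt; apply/orP; left; apply/eqP.
  by rewrite -/ka; field; rewrite !gt_eqF.
have intdev : \int[P]_w `|V w - c|%:E + ((1 - a) / la)%:E <=
   ((c + C / t) + ((th + ka * la) / la + th^-1 / la * (dl + K / t)))%:E.
  have <- : \int[P]_w (cst ((1 - a) / la)%:E w) = ((1 - a) / la)%:E.
    exact: integral_probability_cst.
  rewrite -ge0_integralD//; last 2 first.
  - apply/measurable_EFinP; apply: (measurableT_comp (@normr_measurable R setT)).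
    exact: measurable_funB.
  - by move=> w _; rewrite lee_fin divr_ge0// subr_ge0; case/andP: a01.
  have sq0 w : 0 <= ((h w / t - a) ^+ 2)%:E by rewrite lee_fin sqr_ge0.
  have msq : measurable_fun setT (fun w => ((h w / t - a) ^+ 2)%:E).
    apply/measurable_EFinP; apply: measurable_funX; apply: measurable_funB => //.
    exact: measurable_funM.
  have c10 : (0 <= (th + ka * la) / la)%R.
    exact: (divr_ge0 (addr_ge0 (ltW th0) (mulr_ge0 ka0 la0')) la0').
  have c20 : (0 <= th^-1 / la)%R by rewrite divr_ge0// invr_ge0 (ltW th0).
  apply: (@le_trans _ _ (\int[P]_w ((t^-1)%:E * time_integral X t w +
    (((th + ka * la) / la)%:E + (th^-1 / la)%:E * ((h w / t - a) ^+ 2)%:E)))).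
    apply: ge0_le_integral_nomeas => w _; last exact: pathwise.
    by rewrite adde_ge0// lee_fin// divr_ge0// subr_ge0; case/andP: a01.
  rewrite ge0_integralD//; last 4 first.
  - by move=> w _; rewrite mule_ge0 ?occupation_ge0// lee_fin invr_ge0.
  - by apply: emeasurable_funM => //; exact: measurable_occupation.
  - by move=> w _; apply: adde_ge0; [|apply: mule_ge0 (sq0 w)]; rewrite lee_fin.
  - by apply: emeasurable_funD => //; exact: emeasurable_funM.
  rewrite EFinD; apply: leeD.
    rewrite ge0_integralZl_EFin ?invr_ge0//; last 2 first.
    - by move=> w _; exact: occupation_ge0.
    - exact: measurable_occupation.
    apply: (@le_trans _ _ ((t^-1)%:E * (c * t + C)%:E)).
      by apply: lee_wpmul2l; rewrite ?lee_fin ?invr_ge0// mean_occupation_le.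
    by rewrite -EFinM lee_fin mulrDr mulrCA mulVf ?gt_eqF// mulr1 [(C / t)%R]mulrC.
  rewrite ge0_integralD//; last 2 first.
  - by move=> w _; rewrite mule_ge0.
  - exact: emeasurable_funM.
  rewrite EFinD integral_cst// [X in _ * X](probability_setT P) mule1 leeD2l//.
  rewrite ge0_integralZl_EFin// [leRHS]EFinM.
  apply: lee_wpmul2l; first by rewrite lee_fin.
  by apply: (le_trans dev); rewrite lee_fin lerD2r.
have AI := le_A _ _ _ _ _ _ _ _ H.
have /andP[blo bhi] := discount_rate_bounds A la c e laI AI hA.
have kaE : ka = (c - (1 - a) / la)%R.
  by rewrite /ka distrC ger0_norm// subr_ge0.
have i0 : 0 <= \int[P]_w `|V w - c|%:E by apply: integral_ge0 => w _; rewrite lee_fin.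
move: intdev i0; case: (\int[P]_w _) => [x||]//.
rewrite -EFinD !lee_fin => hx _.
have hK : ((C + K / (e * la ^+ 2)) / t <= e)%R.
  rewrite ler_pdivrMr// -ler_pdivrMl// [leLHS]mulrC.
  by apply: le_trans Tt; rewrite lerDl.
have expand : ((th + ka * la) / la + th^-1 / la * (dl + K / t) =
    e + ka + e + K / (e * la ^+ 2) / t)%R.
  by rewrite /th /dl; field; rewrite !gt_eqF.
rewrite expand kaE in hx.
move: hK; rewrite mulrDl => hK.
have epsE : eps = (e * (5 + 2 * c ^+ 2))%R by rewrite /e divfK// gt_eqF.
rewrite epsE; move: hx blo; rewrite -/a.
set y := ((1 - a) / la)%R; set v := (K / (e * la ^+ 2) / t)%R in hK *; set v2 := (C / t)%R in hK *.
lra.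
Qed.

End mean_ergodic.

(** * Application to the branching process *)

Lemma pairing_scale {R : realType} (nu : config R) (f : R -> R) (la : R) :
  0 < la -> nonneg_on_pos f -> measurable_fun setT (ext0 f) ->
  pairing nu (fun y => la * f y) = la * pairing nu f.
Proof.
move=> la0 f0 mf; rewrite !pairing_mkcond.
have e0 x : 0 <= ext0 f x by exact: ext0_ge0.
rewrite (_ : (\int[nu]_x (ext0 (fun y => la * f y) x)%:E = la%:E * \int[nu]_x (ext0 f x)%:E)%E).
  have : (0 <= \int[nu]_x (ext0 f x)%:E)%E by apply: integral_ge0 => x _; rewrite lee_fin.
  case: (\int[nu]_x _)%E => [y||]//= _.
  by rewrite gt0_muley ?lte_fin//= mulr0.
rewrite -ge0_integralZl_EFin//; last 3 first.
- by move=> x _; rewrite lee_fin.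
- exact/measurable_EFinP.
- exact: ltW.
apply: eq_integral => x _; rewrite -EFinM; congr EFin.
have [x0|x0] := ltP 0 x; first by rewrite !ext0_pos.
by rewrite !ext0_le0// mulr0.
Qed.

Lemma measurable_pairing {R : realType} (f : R -> R) :
  nonneg_on_pos f -> measurable_fun setT (ext0 f) ->
  measurable_fun setT (fun nu : config R => pairing nu f).
Proof.
move=> f0 mf; rewrite (_ : (fun _ => _) = fun nu : config R => fine (\int[nu]_x (ext0 f x)%:E)%E).
  apply: (measurableT_comp (@fine_measurable R _ measurableT)).
  apply: (measurable_config_lineage (fun x => (ext0 f x)%:E)).
    by move=> x; rewrite lee_fin ext0_ge0.
  exact/measurable_EFinP.
by apply/funext => nu; rewrite pairing_mkcond.
Qed.

Lemma pairing_ge0 {R : realType} (nu : config R) (f : R -> R) :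
  nonneg_on_pos f -> 0 <= pairing nu f.
Proof.
move=> f0; rewrite pairing_mkcond fine_ge0//.
by apply: integral_ge0 => x _; rewrite lee_fin ext0_ge0.
Qed.

Section process_estimates.
Context {R : realType}.
Local Notation mu := (@lebesgue_measure R).
Local Open Scope ereal_scope.
Variables (alpha : R -> R) (p : R -> nat -> R).
Hypotheses (halpha : is_C1plus alpha) (hp : is_offspring_law p).
Variable G : probability (measurableTypeR R) R.
Hypothesis Gpos : G `]-oo, 0%R]%classic = 0.
Hypothesis G1 : \int[G]_x `|x|%:E < +oo.
Hypothesis hi : \int[mu]_(s in pos_reals) renewal_density alpha p G s < 1.
Variable L : {finite_measure set (config R) -> \bar R}.
Hypothesis L1 : \int[L]_nu \int[nu]_x `|x|%:E < +oo.
Context {d : measure_display} {Omega : measurableType d}.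
Variables (P : probability Omega R) (Y : R -> Omega -> config R)
  (K : R -> R.-pker (config R) ~> (config R)) (sigma : config R).
Hypothesis hK : is_transition_semigroup alpha p G L K.
Hypothesis hM : is_markov P Y K sigma.
Hypothesis rY : forall w t, (0 <= t)%R -> Y s w @[s --> t^'+] --> Y t w.
Variable f : R -> R.
Hypothesis hf : is_Bplus f.

Let f0 : nonneg_on_pos f. Proof. by case: hf. Qed.
Let fB : bounded_on_pos f. Proof. by case: hf => -[]. Qed.
Let mf : measurable_fun setT (ext0 f).
Proof. by case: hf => -[mf _] _; exact: measurable_ext0. Qed.

Local Opaque birth_rate thinned_rate lineage_occupation.

(** Values at negative times are frozen so that the path is jointly
    measurable on the whole line. *)
Definition paired_path (g : R -> R) (s : R) (w : Omega) : R :=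
  pairing (Y (Num.max 0%R s) w) g.

Lemma paired_path_ge0 s w : (0 <= paired_path f s w)%R.
Proof. exact: pairing_ge0. Qed.

Lemma measurable_paired_path :
  measurable_fun setT (fun z : R * Omega => paired_path f z.1 z.2).
Proof.
have mY t : (0 <= t)%R -> measurable_fun setT (Y t) by exact: (measurable_state P Y K sigma hM t).
rewrite (_ : (fun _ => _) = fun z : R * Omega =>
  fine (\int[Y (Num.max 0%R z.1) z.2]_x (ext0 f x)%:E)); last first.
  by apply/funext => z; rewrite /paired_path pairing_mkcond.
apply: (measurableT_comp (@fine_measurable R _ measurableT)).
apply: (@measurable_random_integral R _ _ (R * Omega)%type (measurableTypeR R)
  (fun z => config_measure (Y (Num.max 0%R z.1) z.2)) _ (fun z => (ext0 f z.2)%:E)).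
- by move=> A mA; exact: (measurable_process Y mY rY A mA).
- by apply/measurable_EFinP; apply: (measurableT_comp mf).
- by move=> z; rewrite lee_fin ext0_ge0.
Qed.

Lemma scaled_Bplus (la : R) : (0 <= la)%R -> is_Bplus (fun y => la * f y)%R.
Proof.
move=> la0; case: hf => -[mf' [M hM']] f0'; split; last first.
  by move=> x x0; rewrite mulr_ge0// f0'.
split; first exact: measurable_funM.
exists (la * M)%R => x x0; rewrite normrM ger0_norm//.
by rewrite ler_wpM2l// hM'.
Qed.

Local Notation c := (fine (occupation_rate alpha p G L f)).

Definition initial_occupation : R :=
  fine (\int[sigma]_x lineage_occupation (birth_rate alpha p) G f x).

(** The exponent in the Laplace formula splits into the contribution of the
    initial state and the immigration. *)
Lemma cumulant_estimate (la : R) : (0 < la)%R -> exists u b q,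
  is_cumulant alpha p G (fun y => la * f y)%R u /\
  laplace_estimate P (paired_path f) c initial_occupation la
    (fine (total_exponent L u)) b q.
Proof.
move=> la0; have la0' := ltW la0.
case: hK => _ _ /(_ _ (scaled_Bplus la la0'))[u hu hlap].
pose beta t := (\int[mu]_(s in `]0%R, t]) psi L (u s))%R.
pose q s := config_integral (clip u) s sigma.
exists u, (fun t => expR (- beta t)), q; split => //.
have v0 := clip_ge0 alpha p G f la u hu.
have mv : measurable_fun setT (fun z : R * R => clip u z.1 z.2).
  by apply: measurable_clip; case: hu.
have beta_itv := integral_psi_le alpha p halpha hp G Gpos G1 hi L L1 f f0 fB mf la u la0' hu.
have beta_ge := integral_psi_ge alpha p halpha hp G Gpos G1 hi L L1 f f0 fB mf la u la0' hu.
have rate_fin := occupation_rate_fin alpha p halpha hp G G1 hi L L1 f f0 fB mf.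
have tot_fin := total_exponent_fin alpha p halpha hp G Gpos G1 hi L L1 f f0 fB mf la u la0' hu.
have tot_le := total_exponent_le alpha p halpha hp G Gpos G1 hi L f f0 fB mf la u la0' hu.
have q_ge0 s : 0 <= q s by exact: config_integral_ge0.
have mcfg := measurable_config_integral (clip u) v0 mv.
have lapE t nu : (0 <= t)%R -> \int[K t nu]_eta (expR (- pairing eta (fun y => la * f y)%R))%:E =
    (expR (- pairing nu (u t) - beta t))%:E by exact: hlap.
have mg : measurable_fun setT (fun nu : config R => pairing nu (fun y => la * f y)%R).
  rewrite (_ : (fun _ => _) = fun nu : config R => (la * pairing nu f)%R).
    by apply: measurable_funM => //; exact: measurable_pairing.
  by apply/funext => nu; rewrite pairing_scale.
have mut t : (0 <= t)%R -> measurable_fun setT (fun nu : config R => pairing nu (u t)).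
  move=> t0; rewrite (_ : (fun _ => _) = fun nu => fine (config_integral (clip u) t nu)).
    apply: (measurableT_comp (@fine_measurable R _ measurableT)).
    exact: (measurableT_comp mcfg (measurable_pair1 t)).
  by apply/funext => nu; exact: pairing_clip.
have dampedE s w : (0 <= s)%R ->
    damped (paired_path f) la s w = expR (- pairing (Y s w) (fun y => la * f y)%R).
  by move=> s0; rewrite /damped /paired_path max_r// pairing_scale.
split.
- apply/andP; split.
    by have /andP[] := beta_itv 0%R; exact: le_trans.
  by rewrite -lee_fin fineK// EFinM fineK.
- move=> t t0; have /andP[h1 h2] := beta_itv t.
  by rewrite ler_expR lerN2 h2/= -expR0 ler_expR oppr_le0.
- move=> e e0; have [T0 [T00 h]] := beta_ge e e0.
  exists T0 => // t Tt; rewrite ler_expR lerNl opprB; exact: h.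
- by [].
- exact: (measurableT_comp mcfg (measurable_pair2 sigma)).
- rewrite EFinM fineK; first exact: (integral_config_clip_le alpha p halpha hp G Gpos G1 hi f f0 fB mf la u la0' hu).
  rewrite ge0_fin_numE; first exact: config_lineage_fin.
  exact: config_lineage_ge0.
- move=> s s0.
  rewrite (eq_integral (fun w => (expR (- pairing (Y s w) (fun y => la * f y)%R))%:E)); last first.
    by move=> w _; rewrite dampedE.
  rewrite (integral_laplace P Y K sigma hM _ u beta mg mut lapE s s0).
  by rewrite expRD pairing_clip.
- move=> r t r0 t0.
  rewrite (eq_integral (fun w => (expR (- pairing (Y r w) (fun y => la * f y)%R) *
     expR (- pairing (Y (r + t)%R w) (fun y => la * f y)%R))%:E)); last first.
    by move=> w _; rewrite !dampedE// addr_ge0.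
  rewrite [in leRHS](eq_integral (fun w => (expR (- pairing (Y r w) (fun y => la * f y)%R))%:E)); last first.
    by move=> w _; rewrite dampedE.
  apply: (integral_laplace2_le P Y K sigma hM _ u beta mg _ lapE r t r0 t0).
  by move=> t' nu t'0; rewrite pairing_clip// fine_ge0// config_integral_ge0.
Qed.

Lemma initial_occupation_ge0 : (0 <= initial_occupation)%R.
Proof. by rewrite fine_ge0//; exact: config_lineage_ge0. Qed.

Lemma paired_path_estimates (la : R) : (0 < la)%R -> exists A b q,
  laplace_estimate P (paired_path f) c initial_occupation la A b q.
Proof.
move=> la0; have [u [b [q [_ H]]]] := cumulant_estimate la la0.
by exists (fine (total_exponent L u)), b, q.
Qed.

Lemma paired_path_sharp_estimates (e : R) : (0 < e)%R -> exists la A b q,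
  [/\ (0 < la <= e)%R,
   laplace_estimate P (paired_path f) c initial_occupation la A b q &
   (la * (c - e) <= A)%R].
Proof.
move=> e0.
have [la /andP[la0 lae] h] := total_exponent_ge alpha p halpha hp G Gpos G1 hi L L1 f f0 fB mf e e0.
have [u [b [q [hu H]]]] := cumulant_estimate la la0.
by exists la, (fine (total_exponent L u)), b, q; split => //; [rewrite la0|exact: h].
Qed.

Lemma paired_path_mean_le t : (0 <= t)%R ->
  \int[P]_w time_integral (paired_path f) t w <= (c * t + initial_occupation)%:E.
Proof.
exact: (mean_occupation_le P (paired_path f) measurable_paired_path paired_path_ge0
  c initial_occupation paired_path_estimates).
Qed.

Lemma paired_path_deviation_cvg (eps : R) : (0 < eps)%R ->
  exists2 T : R, (0 < T)%R & forall t, (T <= t)%R ->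
  \int[P]_w `|fine (time_integral (paired_path f) t w) / t - c|%:E <= eps%:E.
Proof.
exact: (mean_deviation_cvg P (paired_path f) measurable_paired_path paired_path_ge0
  c initial_occupation initial_occupation_ge0 paired_path_estimates
  paired_path_sharp_estimates).
Qed.

End process_estimates.

(** * Signed test functions *)

Section signed_parts.
Context {R : realType}.
Local Open Scope ereal_scope.

Definition pos_part (f : R -> R) (y : R) : R := Num.max 0%R (f y).
Definition neg_part (f : R -> R) : R -> R := pos_part (fun y => - f y)%R.

Lemma pos_partB (f : R -> R) y : (pos_part f y - neg_part f y)%R = f y.
Proof.
rewrite /neg_part /pos_part; have [h|h] := leP 0%R (f y).
  by rewrite max_l ?subr0// oppr_le0.
by rewrite max_r ?sub0r ?opprK// oppr_ge0 ltW.
Qed.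

Lemma pos_part_Bplus (f : R -> R) : is_B f -> is_Bplus (pos_part f).
Proof.
move=> [mf [M hM]]; split; last by move=> x _; rewrite le_max lexx.
split; first exact: measurable_maxr.
exists M => x x0; rewrite ger0_norm ?le_max ?lexx// ge_max.
by rewrite (le_trans _ (hM x x0))// (le_trans (ler_norm _) (hM x x0)).
Qed.

Lemma neg_part_Bplus (f : R -> R) : is_B f -> is_Bplus (neg_part f).
Proof.
move=> [mf [M hM]]; apply: pos_part_Bplus; split; first exact: measurableT_comp.
by exists M => x x0; rewrite normrN hM.
Qed.

Lemma Rintegral_sub {d} {T : measurableType d} (m : {measure set T -> \bar R})
    (D : set T) (a b : T -> R) : measurable D ->
  measurable_fun D a -> measurable_fun D b ->
  (forall x, (0 <= a x)%R) -> (forall x, (0 <= b x)%R) ->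
  \int[m]_(x in D) (a x)%:E < +oo -> \int[m]_(x in D) (b x)%:E < +oo ->
  (\int[m]_(x in D) (a x - b x) =
    fine (\int[m]_(x in D) (a x)%:E)%E - fine (\int[m]_(x in D) (b x)%:E)%E)%R.
Proof.
move=> mD ma mb a0 b0 ia ib.
have int_of (g : T -> R) : measurable_fun D g -> (forall x, (0 <= g x)%R) ->
    \int[m]_(x in D) (g x)%:E < +oo -> m.-integrable D (EFin \o g).
  move=> mg g0 ig; apply/integrableP; split; first exact/measurable_EFinP.
  by under eq_integral => x _ do rewrite /= ger0_norm//.
exact: RintegralB (int_of a ma a0 ia) (int_of b mb b0 ib).
Qed.

Lemma pairing_fin (nu : config R) (f : R -> R) : is_Bplus f ->
  \int[nu]_x (ext0 f x)%:E < +oo.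
Proof.
move=> [[mf [M hM]] f0].
apply: (@le_lt_trans _ _ (\int[nu]_x (cst (Num.max 0%R M)%:E x))).
  apply: ge0_le_integral_nomeas => x _; rewrite lee_fin; first exact: ext0_ge0.
  have [x0|x0] := ltP 0%R x; last by rewrite ext0_le0// le_max lexx.
  by rewrite ext0_pos// le_max (le_trans (ler_norm _) (hM x x0)) orbT.
rewrite integral_cst// lte_mul_pinfty// ?lee_fin ?le_max ?lexx//.
by rewrite -ge0_fin_numE// config_mass_fin.
Qed.

Lemma pairing_parts (nu : config R) (f : R -> R) : is_B f ->
  pairing nu f = (pairing nu (pos_part f) - pairing nu (neg_part f))%R.
Proof.
move=> Bf; have Bp := pos_part_Bplus f Bf; have Bn := neg_part_Bplus f Bf.
have mext (g : R -> R) : is_Bplus g -> measurable_fun setT (ext0 g).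
  by case=> -[mg _] _; exact: measurable_ext0.
have e0 (g : R -> R) x : is_Bplus g -> (0 <= ext0 g x)%R by case=> _ g0; exact: ext0_ge0.
rewrite [LHS]pairing_mkcond (_ : fine _ = \int[nu]_x (ext0 (pos_part f) x - ext0 (neg_part f) x))%R.
  rewrite Rintegral_sub ?pairing_mkcond//.
  - exact: mext.
  - exact: mext.
  - by move=> x; exact: e0.
  - by move=> x; exact: e0.
  - exact: pairing_fin.
  - exact: pairing_fin.
apply: eq_Rintegral => x _.
have [x0|x0] := ltP 0%R x; first by rewrite !ext0_pos// pos_partB.
by rewrite !ext0_le0// subrr.
Qed.

(** The integral of a signed function is by definition a difference of integrals
    of nonnegative functions, each measurable by Tonelli. *)
Lemma measurable_Rtime_integral {d} {Omega : measurableType d} (X : R -> Omega -> R) (t : R) :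
  measurable_fun setT (fun z : R * Omega => X z.1 z.2) ->
  measurable_fun setT (fun w =>
    \int[@lebesgue_measure R]_(s in `]0%R, t]) X s w)%R.
Proof.
move=> mX; apply: (measurableT_comp (@fine_measurable R _ measurableT)).
pose D : set (measurableTypeR R) := `]0%R, t]%classic.
have mD : measurable D by exact: measurable_itv.
pose k (z : measurableTypeR R * Omega) : \bar R := (\1_D z.1)%:E * (X z.1 z.2)%:E.
have mk : measurable_fun setT k.
  apply: emeasurable_funM; last exact/measurable_EFinP.
  apply/measurable_EFinP; exact: (measurableT_comp (@measurable_indic _ _ R _ D mD)).
rewrite (_ : (fun _ => _) = fun w => \int[@lebesgue_measure R]_s (k^\+ (s, w)) -
  \int[@lebesgue_measure R]_s (k^\- (s, w))).
  apply: emeasurable_funB.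
    apply: (measurable_fun_fubini_tonelli_G (m1 := @lebesgue_measure R) k^\+) => //.
    exact: measurable_funepos.
  apply: (measurable_fun_fubini_tonelli_G (m1 := @lebesgue_measure R) k^\-) => //.
  exact: measurable_funeneg.
apply/funext => w; rewrite integral_mkcond [LHS]integralE.
rewrite (_ : _ \_ _ = fun s => k (s, w)); last first.
  by apply/funext => s; rewrite /k patchE indicE; case: ifPn; rewrite ?mul1e ?mul0e.
by congr (_ - _); apply: eq_integral => s _; rewrite ?funeposE ?funenegE.
Qed.

End signed_parts.

Section convergence_in_probability.
Context {R : realType}.
Local Open Scope ereal_scope.

Lemma cvg_at_infinity_0 (F : R -> \bar R) : (forall t, 0 <= F t) ->
  (forall e : R, (0 < e)%R -> exists2 T : R, (0 < T)%R & forall t, (T <= t)%R -> F t <= e%:E) ->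
  F t @[t --> +oo%R] --> 0.
Proof.
move=> F0 hF.
have [T1 _ h1] := hF 1%R ltr01.
apply: (@fine_cvgP _ _ _ _ F 0%R).2; split.
  apply: (filterS _ (nbhs_pinfty_ge (num_real T1))) => t Tt.
  by rewrite ge0_fin_numE//; apply: le_lt_trans (h1 t Tt) (ltry _).
apply/cvgrPdist_le => e e0; have [T _ hT] := hF e e0.
apply: (filterS _ (nbhs_pinfty_ge (num_real T))) => t Tt.
rewrite sub0r normrN /=; have := hT t Tt; have := F0 t.
case: (F t) => [x||]//=.
by rewrite !lee_fin => x0 xe; rewrite ger0_norm.
Qed.

Lemma signed_deviation_le (x y cp cn t r : R) : (0 <= x)%R -> (0 <= y)%R -> (0 <= r)%R ->
  (`|t^-1 * (x - y) - (cp - cn)| <= `|x / t - cp| + `|y / t - cn| + r * (x + y))%R.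
Proof.
move=> x0 y0 r0; apply: (@le_trans _ _ (`|x / t - cp| + `|y / t - cn|)%R); last first.
  by rewrite lerDl mulr_ge0// addr_ge0.
rewrite (_ : t^-1 * (x - y) - (cp - cn) = (x / t - cp) - (y / t - cn))%R; last by ring.
exact: ler_normB.
Qed.

Context {d : measure_display} {Omega : measurableType d}.
Variables (P : probability Omega R) (Xp Xn : R -> Omega -> R) (V : R -> Omega -> R).
Hypotheses (mXp : measurable_fun setT (fun z : R * Omega => Xp z.1 z.2))
  (mXn : measurable_fun setT (fun z : R * Omega => Xn z.1 z.2)).
Hypotheses (Xp0 : forall s w, (0 <= Xp s w)%R) (Xn0 : forall s w, (0 <= Xn s w)%R).
Variables (cp cn Cp Cn : R).
Hypothesis mV : forall t, (0 <= t)%R -> measurable_fun setT (V t).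
Hypothesis VE : forall t w, (0 <= t)%R ->
  time_integral Xp t w < +oo -> time_integral Xn t w < +oo ->
  V t w = (fine (time_integral Xp t w) - fine (time_integral Xn t w))%R.
Hypothesis Mp : forall t, (0 <= t)%R -> \int[P]_w time_integral Xp t w <= (cp * t + Cp)%:E.
Hypothesis Mn : forall t, (0 <= t)%R -> \int[P]_w time_integral Xn t w <= (cn * t + Cn)%:E.
Hypothesis Dp : forall eps : R, (0 < eps)%R -> exists2 T : R, (0 < T)%R &
  forall t, (T <= t)%R -> \int[P]_w `|fine (time_integral Xp t w) / t - cp|%:E <= eps%:E.
Hypothesis Dn : forall eps : R, (0 < eps)%R -> exists2 T : R, (0 < T)%R &
  forall t, (T <= t)%R -> \int[P]_w `|fine (time_integral Xn t w) / t - cn|%:E <= eps%:E.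

(** Integrals over time are finite only almost surely; the term [r *: (Zp + Zn)]
    with [r] small absorbs the paths along which one of them is infinite. *)
Lemma markov_signed (t eps r e : R) : (0 < t)%R -> (0 < eps)%R -> (0 < r)%R ->
  \int[P]_w `|fine (time_integral Xp t w) / t - cp|%:E <= e%:E ->
  \int[P]_w `|fine (time_integral Xn t w) / t - cn|%:E <= e%:E ->
  eps%:E * P [set w | (eps < `|t^-1 * V t w - (cp - cn)|)%R] <=
  (e + e + r * ((cp * t + Cp) + (cn * t + Cn)))%:E.
Proof.
move=> t0 eps0 r0 hp hn; have t0' := ltW t0; have r0' := ltW r0.
set S := [set w | _].
have mW : measurable_fun setT (fun w => `|t^-1 * V t w - (cp - cn)|%R).
  apply: (measurableT_comp (@normr_measurable R setT)).
  apply: measurable_funB => //; apply: measurable_funM => //; exact: mV.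
have mS : measurable S by exact: (measurable_lt_set (cst eps)).
have mZ (X : R -> Omega -> R) :
    measurable_fun setT (fun z : R * Omega => X z.1 z.2) -> (forall s w, (0 <= X s w)%R) ->
    measurable_fun setT (time_integral X t).
  by move=> mX X0; exact: (measurable_occupation X mX X0 t).
have mD (X : R -> Omega -> R) c :
    measurable_fun setT (fun z : R * Omega => X z.1 z.2) -> (forall s w, (0 <= X s w)%R) ->
    measurable_fun setT (fun w => `|fine (time_integral X t w) / t - c|%:E).
  move=> mX X0; apply/measurable_EFinP; apply: (measurableT_comp (@normr_measurable R setT)).
  apply: measurable_funB => //; apply: measurable_funM => //.
  exact: (measurableT_comp (@fine_measurable R _ measurableT) (mZ X mX X0)).
have Zp0 w : 0 <= time_integral Xp t w by exact: occupation_ge0.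
have Zn0 w : 0 <= time_integral Xn t w by exact: occupation_ge0.
rewrite -integral_cst//.
apply: (@le_trans _ _ (\int[P]_w ((`|fine (time_integral Xp t w) / t - cp|%:E +
   `|fine (time_integral Xn t w) / t - cn|%:E) +
   r%:E * (time_integral Xp t w + time_integral Xn t w)))).
  rewrite integral_mkcond; apply: ge0_le_integral_nomeas => w _.
    by rewrite patchE; case: ifPn => // _; rewrite lee_fin ltW.
  rewrite patchE; case: ifPn => [/set_mem wS|_]; last first.
    apply: adde_ge0; first exact: adde_ge0.
    by apply: mule_ge0; [rewrite lee_fin|exact: adde_ge0].
  move: wS (Zp0 w) (Zn0 w); rewrite /S/=; have := VE t w t0'.
  case: (time_integral Xp t w) => [x||]//; case: (time_integral Xn t w) => [y||]//=; last 3 first.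
  - by move=> _ _ _ _; rewrite gt0_muley ?lte_fin// addey// leey.
  - by move=> _ _ _ _; rewrite gt0_muley ?lte_fin// addey// leey.
  - by move=> _ _ _ _; rewrite gt0_muley ?lte_fin// addey// leey.
  move=> /(_ (ltry _) (ltry _)) -> h x0 y0.
  rewrite !lee_fin in x0 y0.
  rewrite -(EFinD x y) -(EFinM r) -(EFinD `|x / t - cp|%R) -EFinD lee_fin.
  apply: (le_trans (ltW h)); exact: signed_deviation_le.
have mDp := mD Xp cp mXp Xp0; have mDn := mD Xn cn mXn Xn0.
have mZp := mZ Xp mXp Xp0; have mZn := mZ Xn mXn Xn0.
have n0 (x : R) : 0 <= `|x|%:E by rewrite lee_fin.
have mZpn := emeasurable_funD mZp mZn.
have Z0 w : 0 <= time_integral Xp t w + time_integral Xn t w by exact: adde_ge0.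
have rZ0 w : 0 <= r%:E * (time_integral Xp t w + time_integral Xn t w).
  by apply: mule_ge0; rewrite ?lee_fin.
have mrZ : measurable_fun setT (fun w => r%:E * (time_integral Xp t w + time_integral Xn t w)).
  by apply: emeasurable_funM.
rewrite (ge0_integralD P measurableT (fun w _ => adde_ge0 (n0 _) (n0 _))
  (emeasurable_funD mDp mDn) (fun w _ => rZ0 w) mrZ).
rewrite (ge0_integralD P measurableT (fun w _ => n0 _) mDp (fun w _ => n0 _) mDn).
rewrite (ge0_integralZl_EFin P measurableT (fun w _ => Z0 w) mZpn r0').
rewrite (ge0_integralD P measurableT (fun w _ => Zp0 w) mZp (fun w _ => Zn0 w) mZn).
rewrite (EFinD (e + e)%R) (EFinD e e) (EFinM r) (EFinD (cp * t + Cp)%R).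
apply: (leeD (leeD hp hn)); apply: lee_wpmul2l; first by rewrite lee_fin.
exact: (leeD (Mp t t0') (Mn t t0')).
Qed.

Lemma signed_average_cvg :
  cvg_in_probability P (fun t w => t^-1 * V t w)%R (cp - cn)%R.
Proof.
move=> eps eps0; apply: cvg_at_infinity_0 => // e e0.
pose e1 := (eps * e / 3)%R.
have e10 : (0 < e1)%R by rewrite divr_gt0// mulr_gt0.
have [Tp Tp0 hTp] := Dp e1 e10; have [Tn Tn0 hTn] := Dn e1 e10.
exists (Tp + Tn)%R => [|t Tt]; first by rewrite addr_gt0.
have Tpt : (Tp <= t)%R by apply: le_trans Tt; rewrite lerDl ltW.
have Tnt : (Tn <= t)%R by apply: le_trans Tt; rewrite lerDr ltW.
have t0 : (0 < t)%R by exact: lt_le_trans Tpt.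
pose B : R := `|(cp * t + Cp) + (cn * t + Cn)|%R.
have B1 : (0 < B + 1)%R by apply: ltr_wpDl; [exact: normr_ge0|].
have r0 : (0 < e1 / (B + 1))%R by rewrite divr_gt0.
have := markov_signed t eps _ e1 t0 eps0 r0 (hTp t Tpt) (hTn t Tnt).
have : 0 <= P [set w | (eps < `|t^-1 * V t w - (cp - cn)|)%R] by [].
case: (P _) => [x||]//; last by rewrite gt0_muley ?lte_fin// leye_eq.
rewrite -EFinM !lee_fin => x0 h.
have hB : (e1 / (B + 1) * ((cp * t + Cp) + (cn * t + Cn)) <= e1)%R.
  rewrite mulrAC ler_pdivrMr// ler_pM2l//.
  by apply: (le_trans (ler_norm _)); rewrite lerDl.
rewrite -(ler_pM2l eps0); apply: (le_trans h).
have -> : (eps * e = e1 + e1 + e1)%R by rewrite /e1; field.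
by rewrite lerD2l.
Qed.

End convergence_in_probability.

(** * Total mass of the moment equation *)

Lemma measurable_swap_args {R : realType} (w : R -> R -> \bar R) :
  measurable_fun setT (fun z : R * R => w z.1 z.2) ->
  measurable_fun setT (fun z : R * R => w z.2 z.1).
Proof.
move=> mw; apply: (measurableT_comp mw (_ : measurable_fun setT (fun z : R * R => (z.2, z.1)))).
exact: measurable_fun_pair.
Qed.

Section balanced_renewal.
Context {R : realType}.
Local Notation mu := (@lebesgue_measure R).
Local Open Scope ereal_scope.
Variables (G : {sigma_finite_measure set (measurableTypeR R) -> \bar R}).
Variables (k h1 h2 w1 w2 : R -> R -> \bar R).
Hypotheses (mk : measurable_fun setT (fun z : R * R => k z.1 z.2))
  (mh1 : measurable_fun setT (fun z : R * R => h1 z.1 z.2))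
  (mh2 : measurable_fun setT (fun z : R * R => h2 z.1 z.2))
  (mw1 : measurable_fun setT (fun z : R * R => w1 z.1 z.2))
  (mw2 : measurable_fun setT (fun z : R * R => w2 z.1 z.2)).
Hypotheses (k0 : forall x s, 0 <= k x s) (h10 : forall x t, 0 <= h1 x t)
  (h20 : forall x t, 0 <= h2 x t) (w10 : forall t x, 0 <= w1 t x)
  (w20 : forall t x, 0 <= w2 t x).
Hypothesis balance : forall x t,
  w1 t x + forcing G k h2 w2 x t = w2 t x + forcing G k h1 w1 x t.

Lemma measurable_forcing (h w : R -> R -> \bar R) x :
  measurable_fun setT (fun z : R * R => h z.1 z.2) ->
  measurable_fun setT (fun z : R * R => w z.1 z.2) -> (forall t x, 0 <= w t x) ->
  measurable_fun setT (forcing G k h w x).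
Proof.
move=> mh mw w0; apply: emeasurable_funD; first exact: (measurable_section2 h x mh).
exact: (measurable_convolution _ _ (measurable_section2 _ x mk)
  (measurable_mean_of G w mw w0) (k0 x) (mean_of_ge0 G w w0)).
Qed.

Lemma forcing_ge0 (h w : R -> R -> \bar R) x t : (forall x t, 0 <= h x t) ->
  (forall t x, 0 <= w t x) -> 0 <= forcing G k h w x t.
Proof.
move=> h0 w0; apply: adde_ge0 => //.
by apply: integral_ge0 => s _; apply: mule_ge0 (k0 x s) (mean_of_ge0 G w w0 _).
Qed.

(** A signed equation [w1 - w2 = (h1 - h2) + k * (w1 - w2)] written without
    subtractions can be integrated over time with no integrability condition. *)
Lemma total_balance x :
  total_of w1 x + (\int[mu]_t h2 x t + (\int[mu]_s k x s) * \int[mu]_t mean_of G w2 t) =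
  total_of w2 x + (\int[mu]_t h1 x t + (\int[mu]_s k x s) * \int[mu]_t mean_of G w1 t).
Proof.
rewrite -(integral_forcing G k h2 w2 mk mh2 mw2 k0 h20 w20) -(integral_forcing G k h1 w1 mk mh1 mw1 k0 h10 w10).
have F2 t : 0 <= forcing G k h2 w2 x t by exact: forcing_ge0.
have F1 t : 0 <= forcing G k h1 w1 x t by exact: forcing_ge0.
have mF2 := measurable_forcing h2 w2 x mh2 mw2 w20.
have mF1 := measurable_forcing h1 w1 x mh1 mw1 w10.
rewrite -(ge0_integralD mu measurableT (fun t _ => w10 t x) (measurable_section1 w1 x mw1)
  (fun t _ => F2 t) mF2).
rewrite -(ge0_integralD mu measurableT (fun t _ => w20 t x) (measurable_section1 w2 x mw2)
  (fun t _ => F1 t) mF1).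
by apply: eq_integral => t _; exact: balance.
Qed.

Lemma mean_balance :
  \int[mu]_t mean_of G w1 t + (\int[G]_x \int[mu]_t h2 x t +
     (\int[G]_x \int[mu]_s k x s) * \int[mu]_t mean_of G w2 t) =
  \int[mu]_t mean_of G w2 t + (\int[G]_x \int[mu]_t h1 x t +
     (\int[G]_x \int[mu]_s k x s) * \int[mu]_t mean_of G w1 t).
Proof.
rewrite -(mean_integral_forcing G k h2 w2 mk mh2 mw2 k0 h20 w20).
rewrite -(mean_integral_forcing G k h1 w1 mk mh1 mw1 k0 h10 w10).
rewrite (integral_mean_of G w1 mw1 w10) (integral_mean_of G w2 mw2 w20).
have mF (h w : R -> R -> \bar R) : measurable_fun setT (fun z : R * R => h z.1 z.2) ->
    measurable_fun setT (fun z : R * R => w z.1 z.2) -> (forall x t, 0 <= h x t) ->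
    (forall t x, 0 <= w t x) ->
    measurable_fun setT (fun x => \int[mu]_t forcing G k h w x t).
  move=> mh mw h0 w0; under eq_fun do rewrite (integral_forcing G k h w mk mh mw k0 h0 w0).
  apply: emeasurable_funD; first exact: measurable_total.
  by apply: emeasurable_funM; [exact: measurable_total|exact: measurable_cst].
have mF2 := mF h2 w2 mh2 mw2 h20 w20; have mF1 := mF h1 w1 mh1 mw1 h10 w10.
have mt (w : R -> R -> \bar R) : measurable_fun setT (fun z : R * R => w z.1 z.2) ->
    (forall t x, 0 <= w t x) -> measurable_fun setT (total_of w).
  move=> mw w0.
  exact: (measurable_total (fun x t => w t x) (measurable_swap_args w mw) (fun x t => w0 t x)).
have t0 (w : R -> R -> \bar R) x : (forall t x, 0 <= w t x) -> 0 <= total_of w x.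
  by move=> w0; exact: integral_ge0.
have f0 (h w : R -> R -> \bar R) x : (forall x t, 0 <= h x t) -> (forall t x, 0 <= w t x) ->
    0 <= \int[mu]_t forcing G k h w x t.
  by move=> h0 w0; apply: integral_ge0 => t _; exact: forcing_ge0.
rewrite -(ge0_integralD G measurableT (fun x _ => t0 w1 x w10) (mt w1 mw1 w10)
  (fun x _ => f0 h2 w2 x h20 w20) mF2).
rewrite -(ge0_integralD G measurableT (fun x _ => t0 w2 x w20) (mt w2 mw2 w20)
  (fun x _ => f0 h1 w1 x h10 w10) mF1).
apply: eq_integral => x _.
rewrite (integral_forcing G k h2 w2 mk mh2 mw2 k0 h20 w20) (integral_forcing G k h1 w1 mk mh1 mw1 k0 h10 w10).
exact (total_balance x).
Qed.

End balanced_renewal.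

Lemma balance_signed {R : realFieldType} (a b c d y z : R) :
  a - b = c - d + (y - z) -> a + (d + z) = b + (c + y).
Proof. by move=> h; lra. Qed.

(** The first equation determines [Ja - Jb], and the second then gives [A - B]. *)
Lemma balance_totals {R : realFieldType} (A B Fp Fn K Ja Jb Hp Hn r : R) : r < 1 ->
  Ja + (Hn + r * Jb) = Jb + (Hp + r * Ja) ->
  A + (Fn + K * Jb) = B + (Fp + K * Ja) ->
  A - B = Fp + K * (Hp / (1 - r)) - (Fn + K * (Hn / (1 - r))).
Proof.
move=> r1 hJ hA; have d0 : 1 - r != 0 by rewrite gt_eqF// subr_gt0.
have hJ' : Ja - Jb = Hp / (1 - r) - Hn / (1 - r).
  apply: (mulIf d0); rewrite -mulrBl mulrAC -mulrA divff// mulr1; lra.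
have -> : A - B = Fp - Fn + K * (Ja - Jb) by lra.
by rewrite hJ' mulrBr; lra.
Qed.

Lemma balance_totals_ereal {R : realFieldType} (A B Fp Fn K Ja Jb : \bar R) (Hp Hn r : R) :
  A \is a fin_num -> B \is a fin_num -> Fp \is a fin_num -> Fn \is a fin_num ->
  K \is a fin_num -> Ja \is a fin_num -> Jb \is a fin_num -> r < 1 ->
  (Ja + (Hn%:E + r%:E * Jb) = Jb + (Hp%:E + r%:E * Ja))%E ->
  (A + (Fn + K * Jb) = B + (Fp + K * Ja))%E ->
  fine A - fine B = fine (Fp + K * (Hp / (1 - r))%:E)%E - fine (Fn + K * (Hn / (1 - r))%:E)%E.
Proof.
case: A => [A||]//; case: B => [B||]//; case: Fp => [Fp||]//; case: Fn => [Fn||]//.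
case: K => [K||]//; case: Ja => [Ja||]//; case: Jb => [Jb||]// _ _ _ _ _ _ _ r1 [hJ] [hA].
exact: balance_totals r1 hJ hA.
Qed.

Lemma parts_le_of_balance {R : realFieldType} (a b : R) (X Y : \bar R) :
  (0 <= X)%E -> (0 <= Y)%E -> a = 0 \/ b = 0 -> (a%:E + X = b%:E + Y)%E ->
  (a%:E <= Y)%E /\ (b%:E <= X)%E.
Proof.
move=> X0 Y0 [->|->]; first by rewrite add0e => ->; split => //; rewrite leeDl.
by rewrite add0e => <-; split => //; rewrite leeDl.
Qed.

Section moments.
Context {R : realType}.
Local Notation mu := (@lebesgue_measure R).
Local Open Scope ereal_scope.
Variables (alpha : R -> R) (p : R -> nat -> R).
Hypotheses (halpha : is_C1plus alpha) (hp : is_offspring_law p).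
Variable G : probability (measurableTypeR R) R.
Hypothesis G1 : \int[G]_x `|x|%:E < +oo.
Hypothesis hi : \int[mu]_(s in pos_reals) renewal_density alpha p G s < 1.
Variable f : R -> R.
Hypothesis Bf : is_B f.
Variable v : R -> R -> R.
Hypothesis hv : is_moment alpha p G f v.
Local Notation b := (birth_rate alpha p).
Local Notation k := (kernel_of b).

Let b0 y : (0 <= b y)%R. Proof. exact: birth_rate_ge0. Qed.
Let mb : measurable_fun setT b. Proof. exact: measurable_birth_rate. Qed.
Let mk := measurable_kernel_of b mb.
Let k0 x s : 0 <= k x s. Proof. exact: kernel_of_ge0. Qed.

Local Opaque birth_rate.

Let fp_ge0 : nonneg_on_pos (pos_part f). Proof. by case: (pos_part_Bplus f Bf). Qed.
Let fn_ge0 : nonneg_on_pos (neg_part f). Proof. by case: (neg_part_Bplus f Bf). Qed.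
Let fp_bnd : bounded_on_pos (pos_part f). Proof. by case: (pos_part_Bplus f Bf) => -[]. Qed.
Let fn_bnd : bounded_on_pos (neg_part f). Proof. by case: (neg_part_Bplus f Bf) => -[]. Qed.
Let mfp : measurable_fun setT (ext0 (pos_part f)).
Proof. by case: (pos_part_Bplus f Bf) => -[mf _] _; exact: measurable_ext0. Qed.
Let mfn : measurable_fun setT (ext0 (neg_part f)).
Proof. by case: (neg_part_Bplus f Bf) => -[mf _] _; exact: measurable_ext0. Qed.

Definition moment_pos (t x : R) : R := (Num.max 0 (clip v t x))%R.
Definition moment_neg (t x : R) : R := (Num.max 0 (- clip v t x))%R.

Local Notation wp := (fun t x : R => (moment_pos t x)%:E).
Local Notation wn := (fun t x : R => (moment_neg t x)%:E).
Local Notation srcp := (source_of (pos_part f)).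
Local Notation srcn := (source_of (neg_part f)).

Lemma moment_pos_ge0 t x : (0 <= moment_pos t x)%R.
Proof. by rewrite le_max lexx. Qed.

Lemma moment_neg_ge0 t x : (0 <= moment_neg t x)%R.
Proof. by rewrite le_max lexx. Qed.

Lemma moment_parts t x : (moment_pos t x - moment_neg t x)%R = clip v t x.
Proof. exact: (pos_partB (clip v t) x). Qed.

Let mclip : measurable_fun setT (fun z : R * R => clip v z.1 z.2).
Proof. by apply: measurable_clip; case: hv. Qed.

Lemma measurable_moment_pos : measurable_fun setT (fun z : R * R => moment_pos z.1 z.2).
Proof. by apply: measurable_maxr => //; exact: measurable_cst. Qed.

Lemma measurable_moment_neg : measurable_fun setT (fun z : R * R => moment_neg z.1 z.2).
Proof.
by apply: measurable_maxr; [exact: measurable_cst|exact: measurableT_comp].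
Qed.

Let wp0 t x : 0 <= wp t x. Proof. by rewrite lee_fin moment_pos_ge0. Qed.
Let wn0 t x : 0 <= wn t x. Proof. by rewrite lee_fin moment_neg_ge0. Qed.
Let mwp : measurable_fun setT (fun z : R * R => wp z.1 z.2).
Proof. by apply/measurable_EFinP; exact: measurable_moment_pos. Qed.
Let mwn : measurable_fun setT (fun z : R * R => wn z.1 z.2).
Proof. by apply/measurable_EFinP; exact: measurable_moment_neg. Qed.

Lemma moment_bound (T : R) : exists2 C : R, (0 <= C)%R &
  forall t x, (t <= T)%R -> (moment_pos t x <= C)%R /\ (moment_neg t x <= C)%R.
Proof.
case: hv => -[_ /(_ T)[C hC]] _; exists (Num.max 0 C)%R; first by rewrite le_max lexx.
move=> t x tT; suff h : (`|clip v t x| <= Num.max 0 C)%R.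
  rewrite /moment_pos /moment_neg !(ge_max, le_max) lexx/=.
  have h1 := le_trans (ler_norm _) h; have h2 := le_trans (ler_norm _) (etrans (congr1 (fun y => y <= _)%R (normrN (clip v t x))) h).
  by move: h1 h2; rewrite !le_max => -> ->.
rewrite le_max; have [t0|t0] := ltP t 0%R; first by rewrite clip_lt0// normr0 lexx.
have [x0|x0] := ltP 0%R x; last by rewrite clip_le0// normr0 lexx.
by rewrite clipE// hC ?orbT// t0.
Qed.

Let mean_bound (T : R) : exists2 C : R, (0 <= C)%R &
  forall t, (t <= T)%R -> mean_of G wp t <= C%:E /\ mean_of G wn t <= C%:E.
Proof.
have [C C0 hC] := moment_bound T; exists C => // t tT.
have CE : \int[G]_x (cst C%:E x) = C%:E.
  exact: integral_probability_cst.
split; rewrite -CE; apply: ge0_le_integral_nomeas => x _ //; rewrite lee_fin.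
  by case: (hC t x tT).
by case: (hC t x tT).
Qed.

Let mean_fin t : (mean_of G wp t \is a fin_num) /\ (mean_of G wn t \is a fin_num).
Proof.
have [C C0 hC] := mean_bound t; have [h1 h2] := hC t (lexx _).
split; rewrite ge0_fin_numE ?mean_of_ge0//.
  by apply: le_lt_trans h1 _; rewrite ltry.
by apply: le_lt_trans h2 _; rewrite ltry.
Qed.

Let mean_lt0 t : (t < 0)%R -> mean_of G wp t = 0 /\ mean_of G wn t = 0.
Proof.
move=> t0; split; rewrite /mean_of integral0_eq// => x _.
  by rewrite /moment_pos clip_lt0// maxxx.
by rewrite /moment_neg clip_lt0// oppr0 maxxx.
Qed.

Let mean_G_parts t : (0 <= t)%R ->
  mean_G G (v t) = (fine (mean_of G wp t) - fine (mean_of G wn t))%R.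
Proof.
move=> t0; rewrite /mean_G /Rintegral integral_mkcond.
rewrite (_ : \int[G]_x _ = \int[G]_x (moment_pos t x - moment_neg t x)%:E); last first.
  apply: eq_integral => x _; rewrite moment_parts patchE mem_setE in_itv/= andbT.
  by case: ltP => x0; [rewrite clipE|rewrite clip_le0].
have [hp1 hn1] := mean_fin t.
apply: (Rintegral_sub G setT) => //.
- exact: (measurableT_comp measurable_moment_pos (measurable_pair1 t)).
- exact: (measurableT_comp measurable_moment_neg (measurable_pair1 t)).
- by move=> x; exact: moment_pos_ge0.
- by move=> x; exact: moment_neg_ge0.
- by move: hp1; rewrite ge0_fin_numE//; exact: mean_of_ge0.
- by move: hn1; rewrite ge0_fin_numE//; exact: mean_of_ge0.
Qed.

(** The signed equation, with negative terms moved across: all terms are then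
    nonnegative and can be integrated. *)
Lemma moment_identity x t :
  wp t x + forcing G k srcn wn x t = wn t x + forcing G k srcp wp x t.
Proof.
have [t0|t0] := ltP t 0%R.
  have conv0 (w : R -> R -> \bar R) : (forall s, (s < 0)%R -> mean_of G w s = 0) ->
      \int[mu]_s (k x s * mean_of G w (t - s)%R) = 0.
    move=> hw; rewrite integral0_eq// => s _.
    have [s0|s0] := leP s 0%R; first by rewrite kernel_of_le0// mul0e.
    by rewrite hw ?mule0// subr_lt0 (lt_trans t0).
  have src0 g : source_of g x t = 0 by rewrite /source_of (lt_geF t0).
  have p0 : moment_pos t x = 0%R by rewrite /moment_pos clip_lt0// maxxx.
  have n0 : moment_neg t x = 0%R by rewrite /moment_neg clip_lt0// oppr0 maxxx.
  rewrite /forcing (conv0 wp (fun s h => (mean_lt0 s h).1)).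
  by rewrite (conv0 wn (fun s h => (mean_lt0 s h).2)) !src0 p0 n0.
have [x0|x0] := ltP 0%R x; last first.
  have conv0 (w : R -> R -> \bar R) : \int[mu]_s (k x s * mean_of G w (t - s)%R) = 0.
    rewrite integral0_eq// => s _.
    have [s0|s0] := leP s 0%R; first by rewrite kernel_of_le0// mul0e.
    by rewrite /kernel_of s0 birth_rate_le0 ?mul0e// subr_le0 (le_trans x0)// ltW.
  have src0 g : source_of g x t = 0.
    by rewrite /source_of t0 ext0_le0// subr_le0 (le_trans x0).
  have p0 : moment_pos t x = 0%R by rewrite /moment_pos clip_le0// maxxx.
  have n0 : moment_neg t x = 0%R by rewrite /moment_neg clip_le0// oppr0 maxxx.
  by rewrite /forcing (conv0 wp) (conv0 wn) !src0 p0 n0.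
have [C C0 bC] := birth_rate_bounded alpha p halpha hp.
have [M M0 hM] := mean_bound t.
pose D : set (measurableTypeR R) := `]0%R, t]%classic.
have mD : measurable D by exact: measurable_itv.
pose cv (w : R -> R -> \bar R) (s : R) : R := (b (x - s) * fine (mean_of G w (t - s)))%R.
have conv (w : R -> R -> \bar R) : (forall t x, 0 <= w t x) ->
    measurable_fun setT (fun z : R * R => w z.1 z.2) ->
    (forall s, mean_of G w s \is a fin_num) ->
    (forall s, (s < 0)%R -> mean_of G w s = 0) ->
    (forall s, (s <= t)%R -> mean_of G w s <= M%:E) ->
    [/\ \int[mu]_s (k x s * mean_of G w (t - s)%R) = \int[mu]_(s in D) (cv w s)%:E,
      measurable_fun D (cv w), (forall s, 0 <= cv w s)%R &
      \int[mu]_(s in D) (cv w s)%:E < +oo].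
  move=> w0 mw fw zw Mw; split.
  - rewrite [RHS]integral_mkcond; apply: eq_integral => s _.
    rewrite patchE mem_setE in_itv/=.
    have [s0|s0] := ltP 0%R s; last by rewrite kernel_of_le0// mul0e.
    have [st|st] /= := leP s t; last by rewrite zw ?mule0// subr_lt0.
    by rewrite /kernel_of s0 /cv [RHS]EFinM fineK.
  - apply: measurable_funTS; apply: measurable_funM.
      by apply: (measurableT_comp mb); exact: measurable_funB.
    apply: (measurableT_comp (@fine_measurable R _ measurableT)).
    apply: (measurableT_comp (measurable_mean_of G w mw w0)).
    exact: measurable_funB.
  - by move=> s; apply: (mulr_ge0 (b0 _)); exact: fine_ge0 (mean_of_ge0 G w w0 _).
  - apply: (@le_lt_trans _ _ (\int[mu]_(s in D) (cst (C * M)%:E s))).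
      apply: ge0_le_integral_nomeas => s; rewrite /D/= in_itv/= => /andP[s0 st].
        by rewrite lee_fin; apply: (mulr_ge0 (b0 _)); exact: fine_ge0 (mean_of_ge0 G w w0 _).
      rewrite lee_fin; apply: ler_pM => //; first exact: fine_ge0 (mean_of_ge0 G w w0 _).
      by rewrite -lee_fin fineK// Mw// gerBl ltW.
    rewrite integral_cst//= lebesgue_measure_itv/=; case: ifP => _.
      by rewrite -EFinB -EFinM ltry.
    by rewrite mule0 ltry.
have [Ep mp p0 pf] := conv wp wp0 mwp (fun s => (mean_fin s).1)
  (fun s h => (mean_lt0 s h).1) (fun s h => (hM s h).1).
have [En mn n0 nf] := conv wn wn0 mwn (fun s => (mean_fin s).2)
  (fun s h => (mean_lt0 s h).2) (fun s h => (hM s h).2).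
have veq : clip v t x = (ext0 f (x - t) +
    (fine (\int[mu]_(s in D) (cv wp s)%:E)%E - fine (\int[mu]_(s in D) (cv wn s)%:E)%E))%R.
  rewrite clipE//; case: hv => _ /(_ t x t0 x0) ->; congr (_ + _)%R.
  rewrite -(Rintegral_sub mu D (cv wp) (cv wn) mD mp mn p0 n0 pf nf).
  apply: eq_Rintegral => s; rewrite inE /D/= in_itv/= => /andP[s0 st].
  by rewrite /cv -mulrBr -mean_G_parts// subr_ge0.
have fpn : ext0 f (x - t) = (ext0 (pos_part f) (x - t) - ext0 (neg_part f) (x - t))%R.
  have [y0|y0] := ltP 0%R (x - t)%R; first by rewrite !ext0_pos// pos_partB.
  by rewrite !ext0_le0// subrr.
rewrite /forcing Ep En /source_of t0.
have ip0 : 0 <= \int[mu]_(s in D) (cv wp s)%:E by apply: integral_ge0 => s _; rewrite lee_fin.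
have in0 : 0 <= \int[mu]_(s in D) (cv wn s)%:E by apply: integral_ge0 => s _; rewrite lee_fin.
have := moment_parts t x; rewrite veq fpn; move: pf nf ip0 in0.
case: (\int[mu]_(s in D) (cv wp s)%:E) => [y||]//; case: (\int[mu]_(s in D) (cv wn s)%:E) => [z||]//=.
move=> _ _ _ _ h; rewrite -!EFinD; congr EFin; exact: balance_signed h.
Qed.

Let msp := measurable_source_of (pos_part f) mfp.
Let msn := measurable_source_of (neg_part f) mfn.
Let sp0 x t : 0 <= srcp x t. Proof. exact: source_of_ge0. Qed.
Let sn0 x t : 0 <= srcn x t. Proof. exact: source_of_ge0. Qed.

(** Since one of the two parts vanishes, each part satisfies a renewal inequality
    of its own. *)
Let parts_disjoint t x : moment_pos t x = 0%R \/ moment_neg t x = 0%R.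
Proof.
rewrite /moment_pos /moment_neg; have [c0|c0] := leP 0%R (clip v t x).
  by right; rewrite max_l// oppr_le0.
by left.
Qed.

Let moment_parts_le t x : wp t x <= forcing G k srcp wp x t /\ wn t x <= forcing G k srcn wn x t.
Proof.
exact: (parts_le_of_balance _ _ _ _ (forcing_ge0 G k k0 srcn wn x t sn0 wn0)
  (forcing_ge0 G k k0 srcp wp x t sp0 wp0) (parts_disjoint t x) (moment_identity x t)).
Qed.

Let mean_total_fin (g : R -> R) (w : R -> R -> R) :
  nonneg_on_pos g -> bounded_on_pos g -> measurable_fun setT (ext0 g) ->
  measurable_fun setT (fun z : R * R => w z.1 z.2) -> (forall t x, (0 <= w t x)%R) ->
  (forall t x, (t < 0)%R -> w t x = 0%R) ->
  (forall T : R, exists C : R, forall t x, (t <= T)%R -> (w t x <= C)%R) ->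
  (forall x t, (w t x)%:E <= forcing G k (source_of g) (fun t x : R => (w t x)%:E) x t) ->
  \int[mu]_t mean_of G (fun t x : R => (w t x)%:E) t < +oo /\
  forall x, \int[mu]_t (w t x)%:E < +oo.
Proof.
move=> g0 gB mg mw w0 wz wB wf.
have [m m0 mE] := own_occupation_total G G1 g g0 gB mg.
have [r r01 rE] := mean_offspring_total_lt1 alpha p halpha hp G hi.
have [C C0 hC] := birth_rate_bounded alpha p halpha hp.
have w0' t x : 0 <= (w t x)%:E by rewrite lee_fin.
have mw' : measurable_fun setT (fun z : R * R => (w z.1 z.2)%:E) by exact/measurable_EFinP.
have ms := measurable_source_of g mg.
have s0 x t : 0 <= source_of g x t by exact: source_of_ge0.
have Jle : \int[mu]_t mean_of G (fun t x : R => (w t x)%:E) t <= (m / (1 - r))%:E.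
  have wB' T : exists C : R, forall t x, (t <= T)%R -> (w t x)%:E <= C%:E.
    by have [C' hC'] := wB T; exists C' => t x tT; rewrite lee_fin hC'.
  have wz' t x : (t < 0)%R -> (w t x)%:E = 0 by move=> t0; rewrite wz.
  have r1 : (r < 1)%R by case/andP: r01.
  exact: (renewal_mean_le G k (source_of g) (fun t x => (w t x)%:E) mk ms mw' k0 s0 w0'
    (fun x s => kernel_of_le0 b x s) wz' wB' m r mE rE r1 wf).
split; first exact: (le_lt_trans Jle (ltry _)).
move=> x; have [+ _] := total_le_forcing G _ _ _ mk ms mw' k0 s0 w0' wf.
move=> /(_ x) /le_lt_trans; apply; apply: lte_add_pinfty.
  have [M _ hM] := own_occupation_linear g g0 gB; have /andP[_ h] := hM x.
  exact: (le_lt_trans h (ltry _)).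
have /andP[K0 KC] : 0 <= mean_offspring b x <= (C * `|x|)%:E.
  apply: mean_offspring_bound => //; last by move=> y y0; exact: birth_rate_le0.
  by move=> y; rewrite b0 hC.
apply: (@le_lt_trans _ _ ((C * `|x|)%:E * (m / (1 - r))%:E)); last by rewrite -EFinM ltry.
apply: lee_pmul KC Jle => //.
by apply: integral_ge0 => t _; exact: mean_of_ge0.
Qed.

Let Jp_fin : \int[mu]_t mean_of G wp t < +oo /\ forall x, \int[mu]_t wp t x < +oo.
Proof.
apply: (mean_total_fin (pos_part f) moment_pos fp_ge0 fp_bnd mfp
  measurable_moment_pos moment_pos_ge0).
- by move=> t x t0; rewrite /moment_pos clip_lt0// maxxx.
- by move=> T; have [C _ hC] := moment_bound T; exists C => t x tT; case: (hC t x tT).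
- by move=> x t; case: (moment_parts_le t x).
Qed.

Let Jn_fin : \int[mu]_t mean_of G wn t < +oo /\ forall x, \int[mu]_t wn t x < +oo.
Proof.
apply: (mean_total_fin (neg_part f) moment_neg fn_ge0 fn_bnd mfn
  measurable_moment_neg moment_neg_ge0).
- by move=> t x t0; rewrite /moment_neg clip_lt0// oppr0 maxxx.
- by move=> T; have [C _ hC] := moment_bound T; exists C => t x tT; case: (hC t x tT).
- by move=> x t; case: (moment_parts_le t x).
Qed.

Local Notation rho := (fine (\int[G]_x mean_offspring b x)).

Lemma moment_total x :
  (fine (\int[mu]_t wp t x) - fine (\int[mu]_t wn t x) =
   fine (lineage_occupation b G (pos_part f) x) -
   fine (lineage_occupation b G (neg_part f) x))%R.
Proof.
have [mp mp0 mpE] := own_occupation_total G G1 (pos_part f) fp_ge0 fp_bnd mfp.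
have [mn mn0 mnE] := own_occupation_total G G1 (neg_part f) fn_ge0 fn_bnd mfn.
have [r r01 rE] := mean_offspring_total_lt1 alpha p halpha hp G hi.
have r1 : (r < 1)%R by case/andP: r01.
have [C C0 hC] := birth_rate_bounded alpha p halpha hp.
have fin_of (z : \bar R) : 0 <= z -> z < +oo -> z \is a fin_num.
  by move=> z0 z1; rewrite ge0_fin_numE.
have own_fin g : nonneg_on_pos g -> bounded_on_pos g -> own_occupation g x \is a fin_num.
  move=> g0 gB; have [M _ hM] := own_occupation_linear g g0 gB; have /andP[h0 h] := hM x.
  exact: (fin_of _ h0 (le_lt_trans h (ltry _))).
have bC y : (0 <= b y <= C)%R by rewrite b0 hC.
have /andP[K0 KC] := mean_offspring_bound b C x C0 bC (birth_rate_le0 alpha p).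
have J0 (w : R -> R -> \bar R) : (forall t x, 0 <= w t x) -> 0 <= \int[mu]_t mean_of G w t.
  by move=> w0; apply: integral_ge0 => t _; exact: mean_of_ge0.
have hx := total_balance G k srcp srcn wp wn mk msp msn mwp mwn k0 sp0 sn0 wp0 wn0 moment_identity x.
have hm := mean_balance G k srcp srcn wp wn mk msp msn mwp mwn k0 sp0 sn0 wp0 wn0 moment_identity.
have hm' : \int[mu]_t mean_of G wp t + (mn%:E + r%:E * \int[mu]_t mean_of G wn t) =
    \int[mu]_t mean_of G wn t + (mp%:E + r%:E * \int[mu]_t mean_of G wp t).
  by rewrite -mpE -mnE -rE; exact hm.
have -> : lineage_occupation b G (pos_part f) x =
    own_occupation (pos_part f) x + mean_offspring b x * (mp / (1 - r))%:E.
  by rewrite /lineage_occupation mpE -/(mean_offspring_total alpha p G) rE.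
have -> : lineage_occupation b G (neg_part f) x =
    own_occupation (neg_part f) x + mean_offspring b x * (mn / (1 - r))%:E.
  by rewrite /lineage_occupation mnE -/(mean_offspring_total alpha p G) rE.
have Ap : \int[mu]_t wp t x \is a fin_num.
  by apply: (fin_of _ _ (Jp_fin.2 x)); apply: integral_ge0 => t _; exact: wp0.
have An : \int[mu]_t wn t x \is a fin_num.
  by apply: (fin_of _ _ (Jn_fin.2 x)); apply: integral_ge0 => t _; exact: wn0.
have Kf : mean_offspring b x \is a fin_num := fin_of _ K0 (le_lt_trans KC (ltry _)).
exact (balance_totals_ereal _ _ _ _ _ _ _ mp mn r Ap An
  (own_fin _ fp_ge0 fp_bnd) (own_fin _ fn_ge0 fn_bnd) Kf
  (fin_of _ (J0 wp wp0) Jp_fin.1) (fin_of _ (J0 wn wn0) Jn_fin.1) r1 hm' hx).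
Qed.

Lemma moment_potential x : (0 < x)%R ->
  potential v x = (fine (lineage_occupation b G (pos_part f) x) -
    fine (lineage_occupation b G (neg_part f) x))%R.
Proof.
move=> x0; rewrite -moment_total /potential.
have on_pos (w : R -> R -> R) : measurable_fun setT (fun t => w t x) ->
    (forall t, (t < 0)%R -> w t x = 0%R) ->
    \int[mu]_(t in pos_reals) (w t x)%:E = \int[mu]_t (w t x)%:E.
  move=> mw wz; rewrite integral_itv_obnd_cbnd; last exact/measurable_funTS/measurable_EFinP.
  rewrite integral_mkcond; apply: eq_integral => t _.
  by rewrite patchE mem_setE in_itv/= andbT; case: ltP => // t0; rewrite wz.
have mp : measurable_fun setT (moment_pos ^~ x).
  exact: (measurableT_comp measurable_moment_pos (measurable_pair2 x)).
have mn : measurable_fun setT (moment_neg ^~ x).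
  exact: (measurableT_comp measurable_moment_neg (measurable_pair2 x)).
have Ep : \int[mu]_(t in pos_reals) wp t x = \int[mu]_t wp t x.
  by apply: on_pos => // t t0; rewrite /moment_pos clip_lt0// maxxx.
have En : \int[mu]_(t in pos_reals) wn t x = \int[mu]_t wn t x.
  by apply: on_pos => // t t0; rewrite /moment_neg clip_lt0// oppr0 maxxx.
rewrite -Ep -En -(Rintegral_sub mu pos_reals (moment_pos ^~ x) (moment_neg ^~ x)).
- apply: eq_Rintegral => t; rewrite inE /pos_reals/= in_itv/= andbT => t0.
  by rewrite moment_parts clipE// ltW.
- exact: measurable_itv.
- exact: measurable_funTS.
- exact: measurable_funTS.
- by move=> t; exact: moment_pos_ge0.
- by move=> t; exact: moment_neg_ge0.
- by rewrite Ep; exact: Jp_fin.2.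
- by rewrite En; exact: Jn_fin.2.
Qed.

End moments.

(** * Identification of the limit *)

Section limit_identification.
Context {R : realType}.
Local Notation mu := (@lebesgue_measure R).
Local Open Scope ereal_scope.
Variables (alpha : R -> R) (p : R -> nat -> R).
Hypotheses (halpha : is_C1plus alpha) (hp : is_offspring_law p).
Variable G : probability (measurableTypeR R) R.
Hypothesis G1 : \int[G]_x `|x|%:E < +oo.
Hypothesis hi : \int[mu]_(s in pos_reals) renewal_density alpha p G s < 1.
Variable L : {finite_measure set (config R) -> \bar R}.
Hypothesis L1 : \int[L]_nu \int[nu]_x `|x|%:E < +oo.
Local Notation b := (birth_rate alpha p).
Local Notation c f := (fine (occupation_rate alpha p G L f)).

Local Opaque birth_rate.

Lemma lineage_occupation_le0 f x : (x <= 0)%R -> lineage_occupation b G f x = 0.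
Proof.
move=> x0; rewrite /lineage_occupation (own_occupation_le0 f x x0).
by rewrite (mean_offspring_le0 b x (birth_rate_le0 alpha p) x0) mul0e adde0.
Qed.

Local Opaque lineage_occupation.

Section one_sign.
Variable f : R -> R.
Hypothesis hf : is_Bplus f.

Let f0 : nonneg_on_pos f. Proof. by case: hf. Qed.
Let fB : bounded_on_pos f. Proof. by case: hf => -[]. Qed.
Let mf : measurable_fun setT (ext0 f).
Proof. by case: hf => -[mf _] _; exact: measurable_ext0. Qed.
Let b0 y : (0 <= b y)%R. Proof. exact: birth_rate_ge0. Qed.
Let mb : measurable_fun setT b. Proof. exact: measurable_birth_rate. Qed.
Let mlin := measurable_lineage_occupation G f f0 mf b b0 mb.

Lemma lineage_fin x : (fine (lineage_occupation b G f x))%:E = lineage_occupation b G f x.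
Proof.
have [C C0 hC] := lineage_occupation_bound alpha p halpha hp G G1 hi f f0 fB mf.
have /andP[h0 h1] := hC x; rewrite fineK// ge0_fin_numE//.
exact: (le_lt_trans h1 (ltry _)).
Qed.

Lemma fine_lineage_ge0 x : (0 <= fine (lineage_occupation b G f x))%R.
Proof.
have [C C0 hC] := lineage_occupation_bound alpha p halpha hp G G1 hi f f0 fB mf.
by apply: fine_ge0; case/andP: (hC x).
Qed.

Lemma measurable_fine_lineage :
  measurable_fun setT (fun x => fine (lineage_occupation b G f x)).
Proof.
apply: (measurableT_comp (@fine_measurable R _ measurableT)).
exact: mlin.
Qed.

Lemma config_fine_lineage (nu : config R) :
  \int[nu]_x (fine (lineage_occupation b G f x))%:E = \int[nu]_x lineage_occupation b G f x.
Proof. by apply: eq_integral => x _; exact: lineage_fin. Qed.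

Lemma config_lineageK (nu : config R) :
  (fine (\int[nu]_x lineage_occupation b G f x))%:E = \int[nu]_x lineage_occupation b G f x.
Proof.
rewrite fineK// ge0_fin_numE.
  exact: (config_lineage_fin alpha p halpha hp G G1 hi f f0 fB mf).
exact: (config_lineage_ge0 alpha p halpha hp G G1 hi f f0 fB mf).
Qed.

Lemma measurable_config_fine :
  measurable_fun setT (fun nu : config R => fine (\int[nu]_x lineage_occupation b G f x)).
Proof.
apply: (measurableT_comp (@fine_measurable R _ measurableT)).
apply: measurable_config_lineage; last exact: mlin.
by move=> x; rewrite -lineage_fin lee_fin fine_lineage_ge0.
Qed.

Lemma nonnull_occupation_rate :
  \int[L]_(nu in nonnull_config) (fine (\int[nu]_x lineage_occupation b G f x))%:E =
  occupation_rate alpha p G L f.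
Proof.
rewrite /occupation_rate -integral_nonnull.
  by apply: eq_integral => nu _; exact: config_lineageK.
move=> nu nu0; apply: integral_null_config => // x.
by rewrite -lineage_fin lee_fin fine_lineage_ge0.
Qed.

End one_sign.

Variables (f : R -> R) (v : R -> R -> R).
Hypotheses (Bf : is_B f) (hv : is_moment alpha p G f v).

Let Bp := pos_part_Bplus f Bf.
Let Bn := neg_part_Bplus f Bf.

Lemma pairing_potential (nu : config R) : pairing nu (potential v) =
  (fine (\int[nu]_x lineage_occupation b G (pos_part f) x)%E -
   fine (\int[nu]_x lineage_occupation b G (neg_part f) x)%E)%R.
Proof.
have lt_y (g : R -> R) : is_Bplus g ->
    \int[nu]_x (fine (lineage_occupation b G g x))%:E < +oo.
  by move=> hg; rewrite (config_fine_lineage g hg) -(config_lineageK g hg) ltry.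
have fineE (g : R -> R) : is_Bplus g -> fine (\int[nu]_x lineage_occupation b G g x) =
    fine (\int[nu]_x (fine (lineage_occupation b G g x))%:E).
  by move=> hg; rewrite (config_fine_lineage g hg).
apply: (etrans _ (esym (congr2 (fun y z => y - z)%R (fineE _ Bp) (fineE _ Bn)))).
rewrite pairing_mkcond.
apply: (etrans _ (Rintegral_sub nu setT (fun x => fine (lineage_occupation b G (pos_part f) x))
  (fun x => fine (lineage_occupation b G (neg_part f) x)) measurableT
  (measurable_fine_lineage _ Bp) (measurable_fine_lineage _ Bn)
  (fine_lineage_ge0 _ Bp) (fine_lineage_ge0 _ Bn) (lt_y _ Bp) (lt_y _ Bn))).
apply: eq_Rintegral => x _; have [x0|x0] := ltP 0%R x.
  by rewrite (ext0_pos _ x x0) (moment_potential alpha p halpha hp G G1 hi f Bf v hv x x0).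
by rewrite (ext0_le0 _ x x0) !(lineage_occupation_le0 _ x x0) subrr.
Qed.

(** All the integrals being finite, the difference of potentials can be
    integrated term by term. *)
Lemma limit_potential :
  (\int[L]_(nu in nonnull_config) pairing nu (potential v) =
   c (pos_part f) - c (neg_part f))%R.
Proof.
have lt_y (g : R -> R) : is_Bplus g ->
    \int[L]_(nu in nonnull_config) (fine (\int[nu]_x lineage_occupation b G g x))%:E < +oo.
  move=> hg; rewrite (nonnull_occupation_rate g hg); have [[mg bg] g0] := hg.
  by rewrite -(fineK (occupation_rate_fin alpha p halpha hp G G1 hi L L1 g g0 bg (measurable_ext0 g mg))) ltry.
have ge0 (g : R -> R) : is_Bplus g ->
    forall nu : config R, (0 <= fine (\int[nu]_x lineage_occupation b G g x)%E)%R.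
  move=> hg nu; rewrite -(config_fine_lineage g hg nu); apply: fine_ge0.
  by apply: integral_ge0 => x _; rewrite lee_fin (fine_lineage_ge0 g hg).
have fineE (g : R -> R) : is_Bplus g -> c g =
    fine (\int[L]_(nu in nonnull_config) (fine (\int[nu]_x lineage_occupation b G g x))%:E).
  by move=> hg; rewrite (nonnull_occupation_rate g hg).
apply: (etrans _ (esym (congr2 (fun y z => y - z)%R (fineE _ Bp) (fineE _ Bn)))).
apply: (etrans _ (Rintegral_sub L nonnull_config
  (fun nu : config R => fine (\int[nu]_x lineage_occupation b G (pos_part f) x))
  (fun nu : config R => fine (\int[nu]_x lineage_occupation b G (neg_part f) x))
  measurable_nonnull (measurable_funTS (measurable_config_fine _ Bp))
  (measurable_funTS (measurable_config_fine _ Bn)) (ge0 _ Bp) (ge0 _ Bn) (lt_y _ Bp) (lt_y _ Bn))).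
by apply: eq_Rintegral => nu _; exact: pairing_potential.
Qed.

End limit_identification.

Section first_moments.
Context {R : realType}.
Local Open Scope ereal_scope.

Let norm_le_exp (a x : R) : (0 < a)%R -> (0 < x)%R ->
  `|x|%:E <= (a^-1)%:E * (expR (a * x)%R)%:E.
Proof.
move=> a0 x0; rewrite -EFinM lee_fin gtr0_norm// ler_pdivlMl//.
by have := expR_ge1Dx (a * x)%R; lra.
Qed.

Let mexp (a : R) : measurable_fun (setT : set (measurableTypeR R)) (fun x : R => (expR (a * x)%R)%:E).
Proof.
apply/measurable_EFinP; apply: (measurableT_comp (@measurable_expR R)).
exact: measurable_funM.
Qed.

Let mnorm : measurable_fun setT (fun x : R => `|x|%:E).
Proof. by apply/measurable_EFinP; exact: normr_measurable. Qed.

Lemma law_first_moment (G : probability (measurableTypeR R) R) (a : R) : (0 < a)%R ->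
  G `]-oo, 0%R]%classic = 0 ->
  \int[G]_(x in pos_reals) (expR (a * x)%R)%:E < +oo -> \int[G]_x `|x|%:E < +oo.
Proof.
move=> a0 Gpos ha; have n0 (x : R) : 0 <= `|x|%:E by rewrite lee_fin.
rewrite -(integral_supported_pos G _ Gpos mnorm n0).
apply: (@le_lt_trans _ _ ((a^-1)%:E * \int[G]_(x in pos_reals) (expR (a * x)%R)%:E)); last first.
  by rewrite lte_mul_pinfty// ?lee_fin ?invr_ge0 ?ltW.
rewrite -ge0_integralZl_EFin ?invr_ge0 ?(ltW a0)//; last 2 first.
- exact: measurable_itv.
- exact: measurable_funTS.
apply: ge0_le_integral_nomeas => x; rewrite /pos_reals/= in_itv/= andbT => x0.
  by rewrite lee_fin.
exact: norm_le_exp.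
Qed.

Lemma immigration_first_moment (L : {finite_measure set (config R) -> \bar R}) (a : R) :
  (0 < a)%R ->
  \int[L]_(nu in nonnull_config) \int[nu]_(x in pos_reals) (expR (a * x)%R)%:E < +oo ->
  \int[L]_nu \int[nu]_x `|x|%:E < +oo.
Proof.
move=> a0 ha; rewrite -integral_nonnull; last first.
  by move=> nu nu0; apply: integral_null_config => // x; rewrite lee_fin.
pose I (nu : config R) := \int[nu]_(x in pos_reals) (expR (a * x)%R)%:E.
have I0 nu : 0 <= I nu by apply: integral_ge0 => x _; rewrite lee_fin expR_ge0.
have mI : measurable_fun setT I.
  rewrite (_ : I = fun nu : config R => \int[nu]_x (((fun x : R => (expR (a * x)%R)%:E) \_ pos_reals) x)).
    apply: measurable_config_lineage.
      by move=> x; rewrite patchE; case: ifP => // _; rewrite lee_fin expR_ge0.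
    by move/(measurable_restrictT _ measurable_pos_reals): (measurable_funTS (mexp a) (D := pos_reals)).
  by apply/funext => nu; rewrite /I integral_mkcond.
apply: (@le_lt_trans _ _ ((a^-1)%:E * \int[L]_(nu in nonnull_config) I nu)); last first.
  by rewrite lte_mul_pinfty// ?lee_fin ?invr_ge0 ?ltW.
rewrite -ge0_integralZl_EFin ?invr_ge0 ?(ltW a0)//; last 2 first.
- exact: measurable_nonnull.
- exact: measurable_funTS.
apply: ge0_le_integral_nomeas => nu _; first by apply: integral_ge0 => x _; rewrite lee_fin.
have n0 (x : R) : 0 <= `|x|%:E by rewrite lee_fin.
rewrite -(integral_supported_pos nu _ (config_pos nu) mnorm n0).
rewrite /I -ge0_integralZl_EFin ?invr_ge0 ?(ltW a0)//; last 2 first.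
- exact: measurable_itv.
- exact: measurable_funTS.
apply: ge0_le_integral_nomeas => x; rewrite /pos_reals/= in_itv/= andbT => x0.
  by rewrite lee_fin.
exact: norm_le_exp.
Qed.

End first_moments.

(** * Convergence of the time average *)

Theorem theorem6p3 (R : realType)
  (alpha : R -> R) (p : R -> nat -> R)
  (G : probability (measurableTypeR R) R)
  (L : {finite_measure set (config R) -> \bar R})
  (halpha : is_C1plus alpha)
  (hp : is_offspring_law p)
  (hG : is_lifetime_law G)
  (hL : is_immigration_measure L)
  (alpha1 : R)
  (hi : (\int[lebesgue_measure]_(s in pos_reals)
           renewal_density alpha p G s < 1)%E)
  (halpha1 : 0 < alpha1)
  (hii_dri : directly_riemann_integrable
     (fun t => expR (alpha1 * t) * (1 - dist_fun G t)))
  (hii_malthus : (\int[lebesgue_measure]_(s in pos_reals)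
     ((expR (alpha1 * s)%R)%:E * renewal_density alpha p G s) = 1)%E)
  (hiii : (\int[L]_(nu in nonnull_config)
     \int[nu]_(x in pos_reals) (expR (alpha1 * x)%R)%:E < +oo)%E)
  (hiv_G : (\int[G]_(x in pos_reals) (expR (2 * alpha1 * x)%R)%:E < +oo)%E)
  (hiv_g : exists M : R, forall x, 0 < x -> (`|gen_fun2 p x| <= M%:E)%E)
  (sigma : config R) (f : R -> R) (hf : is_B f)
  (pif : R -> R -> R) (hpif : is_moment alpha p G f pif)
  (d : measure_display) (Omega : measurableType d) (P : probability Omega R)
  (Y : R -> Omega -> config R)
  (hY : is_cadlag_realization alpha p G L P Y sigma) :
  cvg_in_probability P (fun t w => t^-1 * occupation Y t f w)
    (\int[L]_(nu in nonnull_config) pairing nu (potential pif)).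

Proof.
have Gpos : G `]-oo, 0]%classic = 0%E by case: hG.
have a20 : 0 < 2 * alpha1 by rewrite mulr_gt0.
have G1 := law_first_moment G (2 * alpha1) a20 Gpos hiv_G.
have L1 := immigration_first_moment L alpha1 halpha1 hiii.
have [[K hK hM] hcad] := hY.
have rY w t (t0 : 0 <= t) : Y s w @[s --> t^'+] --> Y t w by case: (hcad w) => + _; apply.
have Bp := pos_part_Bplus f hf; have Bn := neg_part_Bplus f hf.
rewrite (limit_potential alpha p halpha hp G G1 hi L L1 f pif hf hpif).
have path_eq t w s : 0 < s -> pairing (Y s w) f =
    paired_path Y (pos_part f) s w - paired_path Y (neg_part f) s w.
  by move=> s0; rewrite /paired_path max_r ?ltW// pairing_parts.
have mXp := measurable_paired_path P Y K sigma hM rY _ Bp.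
have mXn := measurable_paired_path P Y K sigma hM rY _ Bn.
have occE t w : occupation Y t f w =
    \int[lebesgue_measure]_(s in `]0, t])
      (paired_path Y (pos_part f) s w - paired_path Y (neg_part f) s w).
  apply: eq_Rintegral => s; rewrite inE/= in_itv/= => /andP[s0 _].
  exact: path_eq.
apply: (signed_average_cvg P (paired_path Y (pos_part f)) (paired_path Y (neg_part f))
  (fun t w => occupation Y t f w) mXp mXn
  (paired_path_ge0 Y _ Bp) (paired_path_ge0 Y _ Bn) _ _
  (initial_occupation alpha p G sigma (pos_part f))
  (initial_occupation alpha p G sigma (neg_part f))).
- move=> t t0; rewrite (_ : (fun w => _) = fun w => \int[lebesgue_measure]_(s in `]0, t])
      (paired_path Y (pos_part f) s w - paired_path Y (neg_part f) s w)); last first.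
    by apply/funext => w; exact: occE.
  apply: (measurable_Rtime_integral (fun s w =>
    paired_path Y (pos_part f) s w - paired_path Y (neg_part f) s w)).
  exact: measurable_funB.
- move=> t w t0 hp1 hn1; rewrite occE; apply: Rintegral_sub => //.
  + by apply: measurable_funTS; exact: (measurableT_comp mXp (measurable_pair2 w)).
  + by apply: measurable_funTS; exact: (measurableT_comp mXn (measurable_pair2 w)).
  + by move=> s; exact: paired_path_ge0.
  + by move=> s; exact: paired_path_ge0.
- exact: (paired_path_mean_le alpha p halpha hp G Gpos G1 hi L L1 P Y K sigma hK hM rY _ Bp).
- exact: (paired_path_mean_le alpha p halpha hp G Gpos G1 hi L L1 P Y K sigma hK hM rY _ Bn).
- exact: (paired_path_deviation_cvg alpha p halpha hp G Gpos G1 hi L L1 P Y K sigma hK hM rY _ Bp).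
- exact: (paired_path_deviation_cvg alpha p halpha hp G Gpos G1 hi L L1 P Y K sigma hK hM rY _ Bn).
Qed.
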